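(* Let $I=[\alpha_0,\alpha_1]\subset(0,1)$ be a compact interval. Assume $\varphi\in L^2(0,L)$, $\varphi\ge0$ almost everywhere, and $\varphi\not\equiv0$. Then $$(\mathcal{A}^{-1}\varphi)(x)>0,\qquad 0<x<L.$$ Consequently, for every interior sensor $x_*\in(0,L)$, one sufficiently late point temperature value determines at most one admissible $\alpha\in I$ (that is, there exists $T_I>1$ such that for every $t_0\ge T_I$ and $d_0\in\mathbb{R}$ the equation $u_\alpha(t_0,x_* )=d_0$ has at most one solution $\alpha\in I$); for data generated by the model (that is, $d_0=u_{\alpha}(t_0,x_* )$ for some $\alpha\in I$), the admissible order is unique. The corresponding observation map $I\ni\alpha\mapsto u_\alpha(t_0,x_* )$ is eventually (for all sufficiently large $t_0$) strictly decreasing.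
   Context: Let $L>0$, $\kappa>0$, $q\ge0$, and let $\mathcal{A}=-\kappa\frac{d^2}{dx^2}+q$ on $L^2(0,L)$ with domain $H^2(0,L)\cap H_0^1(0,L)$. Its eigenpairs are $\lambda_n=\kappa(n\pi/L)^2+q$, $v_n(x)=\sqrt{2/L}\,\sin(n\pi x/L)$, $n\ge1$. For $\alpha\in(0,1)$ and $\varphi\in L^2(0,L)$, $u_\alpha$ is the mild solution of the Caputo problem $\partial_t^\alpha u-\kappa u_{xx}+qu=0$ for $t>0$, $0<x<L$, with $u(t,0)=u(t,L)=0$ and $u(0,x)=\varphi(x)$, given by $u_\alpha(t,x)=\sum_{n=1}^\infty\varphi_nE_{\alpha,1}(-\lambda_nt^\alpha)v_n(x)$, $\varphi_n=\int_0^L\varphi v_n\,dx$, where $E_{\alpha,1}(z)=\sum_{i\ge0}z^i/\Gamma(\alpha i+1)$. For $t>0$, $u_\alpha(t,\cdot)\in\operatorname{Dom}(\mathcal{A})$ has a continuous representative, and $u_\alpha(t,x_* )$ is its value at $x_*$. Likewise $\mathcal{A}^{-1}\varphi\in H^2(0,L)\cap H^1_0(0,L)$ is identified with its continuous representative. *)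

(* Defs.v *)
From HB Require Import structures.
From mathcomp Require Import all_boot all_order all_algebra.
From mathcomp Require Import all_classical all_reals all_analysis.

Set Implicit Arguments.
Unset Strict Implicit.
Unset Printing Implicit Defensive.

Import Order.TTheory GRing.Theory Num.Theory.
Import numFieldNormedType.Exports.

Local Open Scope classical_set_scope.
Local Open Scope ring_scope.

(* Functions on (0, L) are represented by functions R -> R whose values outside
   the interval are irrelevant: every notion below only looks at the
   restriction to `]0, L[, or to `[0, L] when continuity up to the boundary
   is involved. *)

Definition isL2 (R : realType) (L : R) (f : R -> R) : Prop :=
  (f \_ `]0, L[) \in @Lfun _ _ R (@lebesgue_measure R) 2%:E.

Definition norm2 (R : realType) (L : R) (f : R -> R) : \bar R :=
  'N[@lebesgue_measure R]_2%:E[EFin \o (f \_ `]0, L[)%R]%E.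

(* C^1_c(0, L): the usual test functions for Sobolev spaces on an interval,
   e.g. in Brezis, "Functional Analysis, Sobolev Spaces and PDE", Ch. 8 *)
Definition test_function (R : realType) (L : R) (psi : R -> R) : Prop :=
  [/\ forall x, derivable psi x 1,
      continuous (derive1 psi) &
      closure [set x | psi x != 0] `<=` `]0, L[ ].

Definition weak_derivative (R : realType) (L : R) (f g : R -> R) : Prop :=
  [/\ isL2 L f, isL2 L g &
      forall psi, test_function L psi ->
        \int[lebesgue_measure]_(x in `]0, L[) (f x * derive1 psi x) =
        - \int[lebesgue_measure]_(x in `]0, L[) (g x * psi x)].

Definition sobolevH1 (R : realType) (L : R) (f : R -> R) : Prop :=
  exists g, weak_derivative L f g.

Definition sobolevH2 (R : realType) (L : R) (f : R -> R) : Prop :=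
  exists2 g, weak_derivative L f g & sobolevH1 L g.

(* closure of the test functions in H^1(0, L) *)
Definition sobolevH10 (R : realType) (L : R) (f : R -> R) : Prop :=
  exists2 g, weak_derivative L f g &
  exists psi : nat -> R -> R,
    [/\ forall k, test_function L (psi k),
        norm2 L (f \- psi k) @[k --> \oo] --> 0%E &
        norm2 L (g \- derive1 (psi k)) @[k --> \oo] --> 0%E].

Definition domA (R : realType) (L : R) (w : R -> R) : Prop :=
  sobolevH2 L w /\ sobolevH10 L w.

(* A w = f, where A = - kappa d^2/dx^2 + q is an operator on L^2(0, L) *)
Definition graphA (R : realType) (L kappa q : R) (w f : R -> R) : Prop :=
  domA L w /\
  exists w1 w2, [/\ weak_derivative L w w1, weak_derivative L w1 w2 &
    {ae lebesgue_measure, forall x, x \in `]0, L[ ->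
      - kappa * w2 x + q * w x = f x}].

(* the continuous representative on [0, L] of A^-1 f *)
Definition invA (R : realType) (L kappa q : R) (f : R -> R) : R -> R :=
  get [set w : R -> R | {within `[0, L], continuous w} /\
                        graphA L kappa q w f].

Definition eigenvalueA (R : realType) (L kappa q : R) (n : nat) : R :=
  kappa * (n%:R * pi / L) ^+ 2 + q.

Definition eigenfunA (R : realType) (L : R) (n : nat) (x : R) : R :=
  Num.sqrt (2 / L) * sin (n%:R * pi * x / L).

Definition eigencoef (R : realType) (L : R) (phi : R -> R) (n : nat) : R :=
  \int[lebesgue_measure]_(x in `]0, L[) (phi x * eigenfunA L n x).

(* Euler's Gamma function, meaningful for 0 < s *)
Definition Gamma (R : realType) (s : R) : R :=
  \int[lebesgue_measure]_(x in `]0, +oo[) (x `^ (s - 1) * expR (- x)).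

(* E_{alpha,1} *)
Definition mittag_leffler (R : realType) (alpha z : R) : R :=
  limn (series (fun i : nat => z ^+ i / Gamma (alpha * i%:R + 1))).

Definition mild_partial_sum (R : realType) (L kappa q : R) (phi : R -> R)
    (alpha t : R) (N : nat) (x : R) : R :=
  \sum_(1 <= n < N.+1) eigencoef L phi n *
    mittag_leffler alpha (- eigenvalueA L kappa q n * t `^ alpha) *
    eigenfunA L n x.

(* for 0 < t, the continuous representative on [0, L] of the L^2(0, L)-sum of
   the series defining the mild solution u_alpha(t, .) *)
Definition mild_solution (R : realType) (L kappa q : R) (phi : R -> R)
    (alpha t : R) : R -> R :=
  get [set w : R -> R | {within `[0, L], continuous w} /\
    norm2 L (w \- mild_partial_sum L kappa q phi alpha t N) @[N --> \oo]
      --> 0%E].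

(* Main.v *)
Require Import Defs.
From mathcomp Require Import all_boot all_order all_algebra.
From mathcomp Require Import all_classical all_reals all_analysis.
From mathcomp Require Import measurable_realfun ring lra complex.

Set Implicit Arguments.
Unset Strict Implicit.
Unset Printing Implicit Defensive.

Import Order.TTheory GRing.Theory Num.Theory.
Import numFieldNormedType.Exports.
Local Open Scope classical_set_scope.
Local Open Scope ring_scope.

(** Two facts carry the theorem.

    _Positivity of A^-1 phi._  With m = q / kappa, let S solve S'' = m S,
    S 0 = 0, S' 0 = 1.  The function [green_sol] is the integral of phi against
    a multiple of S(min(x,y)) S(L - max(x,y)), which is positive inside the
    square; it satisfies A w = phi in the weak sense ([green_graphA]) and is
    positive as soon as phi is nonnegative and not almost everywhere zero
    ([green_sol_gt0]).  Any solution w of A w = phi has sine coefficients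
    phi_n / lambda_n ([eigencoef_graphA]), and a continuous function is
    determined by its sine coefficients ([sine_complete]); hence every
    continuous representative of A^-1 phi, in particular the chosen one, equals
    on (0, L) both [green_sol] and the sum W(x) of the series of
    phi_n v_n(x) / lambda_n.  So W(x) > 0 on (0, L).

    _Asymptotics of u_alpha that are uniform in alpha._  The Mittag-Leffler
    function on the negative axis is a superposition of exponentials,

      E_a(- y) = int_R k_a(e^(a s) / y) exp(- e^s) ds,
      k_a(z) = (sin(pi a) / pi) z / (1 + 2 z cos(pi a) + z^2)

    ([mittag_leffler_kernel]).  After the substitution y = t^a and a shift of s,
    both sides are functions of t with the same Laplace transform
    p^(a-1) / (p^a + 1): on the left by integrating the power series termwise
    ([laplace_mittag_leffler]), on the right by a Stieltjes transform that is
    computed with a rectangular contour ([stieltjes_ml_kernel]).  Equality of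
    the transforms at p0, p0 + 1, p0 + 2, and so on is the vanishing of all
    moments of the difference in the variable exp(- t), which forces the
    difference to vanish ([moments_eq0]; the same lemma gives [sine_complete]).

    In this representation lambda t^a E_a(- lambda t^a) is seen to be bounded,
    Lipschitz in a, and convergent as t grows to the positive limit
    (sin(pi a) / pi) Gamma(a), all of it uniformly in lambda >= lambda_1 and in
    a in a compact subinterval of (0, 1).  Since the series of
    |phi_n v_n(x)| / lambda_n converges, u_a(t, x) = t^-a V(a, t) where V is
    Lipschitz in a uniformly in t >= 1 and eventually bounded below by a positive
    constant, its limit being W(x) (sin(pi a) / pi) Gamma(a).  The logarithmic
    derivative of t^-a in a is - ln t, so for large t the factor t^-a dominates
    the variation of V and a |-> u_a(t, x) is strictly decreasing
    ([eventually_strictly_decreasing]).  A strictly decreasing map is injective,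
    which is the uniqueness of the order. *)

(** * Integration tools and the moment problem *)

Lemma is_derive_continuous (R : realType) (f : R -> R) (x df : R) :
  is_derive x 1 f df -> {for x, continuous f}.
Proof.
by move=> [? _]; apply: differentiable_continuous; apply/derivable1_diffP.
Qed.

Section real_integrals.
Context d (T : measurableType d) (R : realType).
Variable mu : {measure set T -> \bar R}.
Implicit Types (D : set T) (f g : T -> R).

Lemma integrable_measurable D f :
  mu.-integrable D (EFin \o f) -> measurable_fun D f.
Proof. by move=> /measurable_int/measurable_EFinP. Qed.

Lemma integrable_le D f g : measurable D -> measurable_fun D f ->
  (forall x, D x -> `|f x| <= g x) ->
  mu.-integrable D (EFin \o g) -> mu.-integrable D (EFin \o f).
Proof.
move=> mD mf fg ig; apply: le_integrable ig => //.
  exact/measurable_EFinP.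
by move=> x Dx; rewrite /= lee_fin (le_trans (fg _ Dx))// ler_norm.
Qed.

Lemma integrable_addr D f g : measurable D ->
  mu.-integrable D (EFin \o f) -> mu.-integrable D (EFin \o g) ->
  mu.-integrable D (EFin \o (fun x => f x + g x)).
Proof. by move=> mD If Ig; exact: (integrableD mD If Ig). Qed.

Lemma integrable_subr D f g : measurable D ->
  mu.-integrable D (EFin \o f) -> mu.-integrable D (EFin \o g) ->
  mu.-integrable D (EFin \o (fun x => f x - g x)).
Proof. by move=> mD If Ig; exact: (integrableB mD If Ig). Qed.

Lemma integrable_mull D (c : R) f : measurable D ->
  mu.-integrable D (EFin \o f) ->
  mu.-integrable D (EFin \o (fun x => c * f x)).
Proof. by move=> mD If; exact: (integrableZl mD c If). Qed.

Lemma integrable_bounded_mul D f g (M : R) : measurable D ->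
  measurable_fun D f -> (forall x, D x -> `|f x| <= M) ->
  mu.-integrable D (EFin \o g) ->
  mu.-integrable D (EFin \o (fun x => f x * g x)).
Proof.
move=> mD mf fM ig.
apply: (@integrable_le _ _ (fun x => M * `|g x|)) => //.
- exact/measurable_funM/integrable_measurable.
- by move=> x Dx; rewrite normrM ler_wpM2r// fM.
- exact/integrable_mull/integrable_norm.
Qed.

Lemma integrable_bounded D f (M : R) : measurable D -> (mu D < +oo)%E ->
  measurable_fun D f -> (forall x, D x -> `|f x| <= M) ->
  mu.-integrable D (EFin \o f).
Proof.
move=> mD fD mf fM; apply: measurable_bounded_integrable => //.
exists M; split; first exact: num_real.
by move=> N MN x Dx /=; rewrite (le_trans (fM _ Dx))// ltW.
Qed.

Lemma le_norm_Rintegral D f g : measurable D ->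
  mu.-integrable D (EFin \o f) -> mu.-integrable D (EFin \o g) ->
  (forall x, D x -> `|f x| <= g x) ->
  `|\int[mu]_(x in D) f x| <= \int[mu]_(x in D) g x.
Proof.
move=> mD If Ig fg; apply: (le_trans (le_normr_Rintegral mD If)).
by apply: le_Rintegral => //; exact: integrable_norm.
Qed.

Lemma Rdominated_convergence D (F : nat -> T -> R) f g : measurable D ->
  (forall n, measurable_fun D (F n)) -> measurable_fun D f ->
  {ae mu, forall x, D x -> F n x @[n --> \oo] --> f x} ->
  mu.-integrable D (EFin \o g) ->
  (forall n x, D x -> `|F n x| <= g x) ->
  mu.-integrable D (EFin \o f) /\
  \int[mu]_(x in D) F n x @[n --> \oo] --> \int[mu]_(x in D) f x.
Proof.
move=> mD mF mf Ff ig Fg.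
have [] := @dominated_convergence _ T R mu D mD (fun n => EFin \o F n)
  (EFin \o f) (EFin \o g).
- by move=> n; exact/measurable_EFinP.
- exact/measurable_EFinP.
- apply: filterS Ff => x /[apply] h.
  by apply: cvg_EFin; [exact: nearW|exact: h].
- exact: ig.
- by apply: aeW => x n Dx; rewrite /= lee_fin Fg.
move=> fi _ cv; split => //.
apply: fine_cvg; rewrite fineK; last exact: integrable_fin_num.
exact: cv.
Qed.

Lemma Rintegral_sum D (I : Type) (s : seq I) (F : I -> T -> R) :
  measurable D -> (forall i, mu.-integrable D (EFin \o F i)) ->
  \int[mu]_(x in D) (\sum_(i <- s) F i x) = \sum_(i <- s) \int[mu]_(x in D) F i x.
Proof.
move=> mD iF; elim: s => [|i s IH].
  rewrite big_nil; under eq_Rintegral do rewrite big_nil.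
  by rewrite Rintegral_cst// mul0r.
rewrite big_cons; under eq_Rintegral do rewrite big_cons.
rewrite RintegralD// ?IH//.
have := @integrable_sum _ _ _ mu D mD _ s xpredT (fun i => EFin \o F i) (fun i _ => iF i).
by apply: eq_integrable => // x _; rewrite /= sumEFin.
Qed.

Lemma Rintegral_restrict_sub D E f : measurable D -> measurable E ->
  E `<=` D -> \int[mu]_(x in E) f x = \int[mu]_(x in D) (\1_E x * f x).
Proof.
move=> mD mE ED; rewrite Rintegral_mkcond [RHS]Rintegral_mkcond.
apply: eq_Rintegral => x _; rewrite !patchE /=.
rewrite indicE; case: (boolP (x \in E)) => xE.
  by rewrite mem_set ?mul1r//; apply/ED/set_mem.
by case: ifP => // _; rewrite mul0r.
Qed.

End real_integrals.

Section moments.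
Context (R : realType).
Notation mu := (@lebesgue_measure R).

Lemma lebesgue_itv_lty (a b : R) (s t : bool) :
  (mu [set` Interval (BSide s a) (BSide t b)] < +oo)%E.
Proof. by rewrite lebesgue_measure_itv/=; case: ifP => _ //; rewrite ltry. Qed.

Lemma bernoulli_ineq (u : R) n : u <= 1 -> 1 - u *+ n <= (1 - u) ^+ n.
Proof.
move=> u1; elim: n => [|n IH]; first by rewrite mulr0n subr0 expr0.
rewrite exprS mulrSr; have [un|un] := leP (u *+ n) 1; last first.
  have u0 : 0 <= u.
    by rewrite leNgt; apply/negP => u0; move: un; apply/negP; rewrite -leNgt;
       rewrite (le_trans _ ler01)// mulrn_wle0// ltW.
  rewrite (@le_trans _ _ 0)//; last by rewrite -exprS exprn_ge0// subr_ge0.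
  by rewrite subr_le0 (le_trans (ltW un))// lerDl.
have : (1 - u) * (1 - u *+ n) <= (1 - u) * (1 - u) ^+ n.
  by rewrite ler_wpM2l// subr_ge0.
apply: le_trans.
have : 0 <= u * (u *+ n) by rewrite mulrnAr mulrn_wge0// -expr2 sqr_ge0.
by lra.
Qed.

(** At u in (0, 1) this is close to exp(- (u / c)^n): a smoothed indicator of
    u < c on (0, 1). *)
Definition step_poly (c : R) (n : nat) : {poly R} :=
  (1 - 'X^n) ^+ (Num.truncn (c^-1 ^+ n)).

Lemma step_polyE c n (u : R) :
  (step_poly c n).[u] = (1 - u ^+ n) ^+ Num.truncn (c^-1 ^+ n).
Proof. by rewrite /step_poly horner_exp !hornerE. Qed.

Lemma cvg_step_poly_lt (c u : R) : 0 < c < 1 -> 0 <= u < c ->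
  (step_poly c n).[u] @[n --> \oo] --> (1 : R).
Proof.
move=> /andP[c0 c1] /andP[u0 uc].
have uc1 : u / c < 1 by rewrite ltr_pdivrMr// mul1r.
have u1 : u < 1 by exact: lt_trans c1.
apply: (@squeeze_cvgr _ _ _ _ (fun n => 1 - (u / c) ^+ n) (fun=> 1)).
- apply: nearW => n; rewrite step_polyE; apply/andP; split; last first.
    by rewrite exprn_ile1 ?subr_ge0 ?lerBlDr ?lerDl ?exprn_ge0// exprn_ile1// ltW.
  apply: le_trans (bernoulli_ineq _ _); last by rewrite exprn_ile1// ltW.
  rewrite lerB// -mulr_natr exprMn ler_wpM2l ?exprn_ge0//.
  have cn0 : 0 <= c^-1 ^+ n by rewrite exprn_ge0// invr_ge0 ltW.
  by case/andP: (Num.Theory.truncn_itv cn0).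
- rewrite -[X in _ --> X]subr0; apply: cvgB; first exact: cvg_cst.
  by apply: cvg_expr; rewrite ger0_norm// divr_ge0// ltW.
- exact: cvg_cst.
Qed.

Lemma cvg_step_poly_gt (c u : R) : 0 < c < 1 -> c < u < 1 ->
  (step_poly c n).[u] @[n --> \oo] --> (0 : R).
Proof.
move=> /andP[c0 c1] /andP[cu u1].
have u0 : 0 < u by exact: lt_trans cu.
have uc1 : 1 < u / c by rewrite ltr_pdivlMr// mul1r.
apply: (@squeeze_cvgr _ _ _ _ (fun=> 0) (fun n => (c / u) ^+ n)).
- apply: nearW => n; rewrite step_polyE.
  set M := Num.truncn _.
  have un1 : u ^+ n <= 1 by rewrite exprn_ile1// ltW.
  have un0 : 0 < u ^+ n by rewrite exprn_gt0.
  apply/andP; split; first by rewrite exprn_ge0// subr_ge0.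
  have h : c^-1 ^+ n < M.+1%:R.
    have cn0 : 0 <= c^-1 ^+ n by rewrite exprn_ge0// invr_ge0 ltW.
    by case/andP: (Num.Theory.truncn_itv cn0).
  have h2 : (1 - u ^+ n) ^+ M * (1 + u ^+ n) ^+ M <= 1.
    rewrite -exprMn exprn_ile1//.
      by rewrite mulr_ge0 ?subr_ge0// addr_ge0// ltW.
    have := sqr_ge0 (u ^+ n); lra.
  have h3 : (u / c) ^+ n <= (1 + u ^+ n) ^+ M.
    apply: (@le_trans _ _ (1 - (- u ^+ n) *+ M)).
      rewrite exprMn mulNrn opprK.
      apply: (@le_trans _ _ (u ^+ n * M.+1%:R)); first by rewrite ler_wpM2l// ltW.
      by rewrite -natr1 mulrDr mulr1 addrC lerD// mulr_natr.
    rewrite -{2}[u ^+ n]opprK; apply: bernoulli_ineq.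
    by rewrite (le_trans _ ler01)// oppr_le0 ltW.
  rewrite -[c / u]invf_div exprVn.
  have uc0 : 0 < (u / c) ^+ n by rewrite exprn_gt0// divr_gt0.
  rewrite -[_^-1]mul1r ler_pdivlMr// (le_trans _ h2)// ler_wpM2l//.
  by rewrite exprn_ge0// subr_ge0.
- exact: cvg_cst.
- apply: cvg_expr; rewrite ger0_norm ?divr_ge0// 1?ltW//.
  by rewrite ltr_pdivrMr// mul1r.
Qed.

Lemma step_poly_bound (c u : R) n : 0 <= u <= 1 -> `|(step_poly c n).[u]| <= 1.
Proof.
move=> /andP[u0 u1]; rewrite step_polyE.
have un1 : 0 <= 1 - u ^+ n <= 1.
  by rewrite subr_ge0 exprn_ile1//= lerBlDr lerDl exprn_ge0.
case/andP: un1 => a b.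
by rewrite ger0_norm ?exprn_ge0// exprn_ile1.
Qed.

Lemma Rintegral_horner_eq0 d (T : measurableType d)
  (nu : {measure set T -> \bar R}) (D : set T) (X g : T -> R) (p : {poly R}) :
  measurable D -> measurable_fun D X -> (forall x, D x -> 0 <= X x <= 1) ->
  nu.-integrable D (EFin \o g) ->
  (forall n, \int[nu]_(x in D) (X x ^+ n * g x) = 0) ->
  \int[nu]_(x in D) (p.[X x] * g x) = 0.
Proof.
move=> mD mX X01 ig mom.
have iX n : nu.-integrable D (EFin \o (fun x => X x ^+ n * g x)).
  apply: (integrable_bounded_mul (M := 1)) => //.
    exact: measurable_funX.
  move=> x Dx; have /andP[a b] := X01 _ Dx.
  by rewrite ger0_norm ?exprn_ge0// exprn_ile1.
under eq_Rintegral => x _ do rewrite horner_coef mulr_suml.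
have -> : (fun x => \sum_(i < size p) p`_i * X x ^+ i * g x) =
  (fun x => \sum_(i < size p) p`_i * (X x ^+ i * g x)).
  by apply/funext => x; apply: eq_bigr => i _; rewrite mulrA.
rewrite Rintegral_sum//; last by move=> i; exact: integrable_mull.
by apply: big1 => i _; rewrite RintegralZl// mom mulr0.
Qed.

(** Since X decreases, X < X y is the tail ]y, +oo[; the polynomials
    [step_poly (X y)] in X converge to its indicator, boundedly, so dominated
    convergence carries the vanishing of the moments over to tail integrals. *)
Lemma tail_Rintegral_eq0 (D : set R) (X g : R -> R) (y : R) :
  measurable D -> measurable_fun D X -> D y ->
  (forall x, D x -> 0 < X x < 1) ->
  (forall x z, D x -> D z -> x < z -> X z < X x) ->
  mu.-integrable D (EFin \o g) ->
  (forall n, \int[mu]_(x in D) (X x ^+ n * g x) = 0) ->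
  \int[mu]_(x in D `&` `]y, +oo[) g x = 0.
Proof.
move=> mD mX Dy X01 Xdecr ig mom.
have X01' x : D x -> 0 <= X x <= 1.
  by move=> /X01 /andP[a b]; rewrite !ltW.
have mg := integrable_measurable ig.
rewrite (@Rintegral_restrict_sub _ _ _ mu D)//; last exact: measurableI.
set E := D `&` _.
have mE : measurable E by exact: measurableI.
have [] := @Rdominated_convergence _ _ R mu D
  (fun n x => (step_poly (X y) n).[X x] * g x) (fun x => \1_E x * g x)
  (fun x => `|g x|) mD.
- move=> n; apply: measurable_funM => //.
  have -> : (fun x => (step_poly (X y) n).[X x]) =
      (fun x => (1 - X x ^+ n) ^+ Num.truncn ((X y)^-1 ^+ n)).
    by apply/funext => x; rewrite step_polyE.
  apply: measurable_funX; apply: measurable_funB => //.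
  exact: measurable_funX.
- by apply: measurable_funM => //; exact: measurable_indic.
  (* at x = y the limit is e^-1, not a value of the indicator *)
- exists [set y]; split; [exact: measurable_set1|exact: lebesgue_measure_set1|].
  move=> x /= xy; apply: contrapT => xney; apply: xy => Dx.
  apply: cvgM; last exact: cvg_cst.
  have /andP[Xx0 Xx1] := X01 _ Dx.
  have [yx|xy|xy] := ltgtP y x; last by rewrite xy in xney.
    rewrite indicE mem_set /E/=; last by rewrite in_itv/= yx.
    by apply: cvg_step_poly_lt; [exact: X01|rewrite ltW//= Xdecr].
  rewrite indicE memNset /E/=; last by rewrite in_itv/= ltNge (ltW xy) => -[].
  by apply: cvg_step_poly_gt; [exact: X01|rewrite Xx1 andbT Xdecr].
- exact: integrable_norm.
- move=> n x Dx; rewrite normrM ler_piMl//.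
  by apply: step_poly_bound; exact: X01'.
move=> _.
rewrite (_ : (fun n => _) = (fun=> 0)); last first.
  apply/funext => n; exact: Rintegral_horner_eq0.
by move=> /cvg_lim <-//; rewrite lim_cst.
Qed.

(** If g were positive at x, it would have a positive integral over some
    interval ]x, z], although this integral is a difference of two tails. *)
Lemma moments_eq0 (D : set R) (X g : R -> R) :
  open D -> measurable_fun D X ->
  (forall x, D x -> 0 < X x < 1) ->
  (forall x z, D x -> D z -> x < z -> X z < X x) ->
  mu.-integrable D (EFin \o g) -> (forall x, D x -> {for x, continuous g}) ->
  (forall n, \int[mu]_(x in D) (X x ^+ n * g x) = 0) ->
  forall x, D x -> g x = 0.
Proof.
move=> oD + X01 Xdecr.
have mD : measurable D by exact: open_measurable.
suff H (h : R -> R) : measurable_fun D X ->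
  mu.-integrable D (EFin \o h) -> (forall x, D x -> {for x, continuous h}) ->
  (forall n, \int[mu]_(x in D) (X x ^+ n * h x) = 0) ->
  forall x, D x -> h x <= 0.
  move=> mX ig cg mom x Dx; apply/eqP; rewrite eq_le (H g)//=.
  rewrite -oppr_le0.
  suff : forall x, D x -> - g x <= 0 by exact.
  apply: H => //.
  - rewrite (_ : EFin \o _ = EFin \o (fun z => - 1 * g z)).
      exact: integrable_mull.
    by apply/funext => z; rewrite /= mulN1r.
  - by move=> z Dz; apply: continuousN; exact: cg.
  - move=> n; under eq_Rintegral do rewrite mulrN -mulN1r.
    rewrite RintegralZl ?mom ?mulr0//.
    apply: (integrable_bounded_mul (M := 1)) => //; first exact: measurable_funX.
    move=> z Dz; have /andP[a b] := X01 _ Dz.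
    by rewrite ger0_norm ?exprn_ge0 ?exprn_ile1 ?ltW.
move=> mX ih ch mom x Dx; rewrite leNgt; apply/negP => hx.
have hx2 : h x / 2 < h x by lra.
have : \forall z \near x, D z /\ h x / 2 < h z.
  near=> z; split; first by near: z; exact: open_nbhs_nbhs.
  near: z; have /cvgr_gt : h z @[z --> x] --> h x by exact: ch.
  by apply.
move=> /nbhs_ballP[e /= e0 ball_e].
pose z := x + e / 2.
have xz : x < z by rewrite ltrDl divr_gt0.
have xzD u : x <= u <= z -> D u /\ h x / 2 < h u.
  move=> /andP[xu uz]; apply: ball_e; rewrite /ball/= distrC ger0_norm ?subr_ge0//.
  by move: uz; rewrite /z; lra.
have Dz : D z by apply: (xzD _ _).1; rewrite lexx ltW.
have Tx := tail_Rintegral_eq0 mD mX Dx X01 Xdecr ih mom.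
have Tz := tail_Rintegral_eq0 mD mX Dz X01 Xdecr ih mom.
have sub : `]x, z]%classic `<=` D.
  by move=> u /=; rewrite in_itv/= => /andP[xu uz]; apply: (xzD u _).1; rewrite (ltW xu).
have E : D `&` `]x, +oo[ = `]x, z] `|` (D `&` `]z, +oo[).
  apply/seteqP; split => u /=; rewrite !in_itv/= ?andbT.
    by move=> [Du xu]; have [zu|zu] := ltP z u; [right|left; rewrite xu].
  move=> [/andP[xu uz]|[Du zu]]; last by split => //; exact: lt_trans zu.
  by split => //; apply: sub; rewrite /= in_itv/= xu.
have mI : measurable (D `&` `]z, +oo[) by exact: measurableI.
move: Tx; rewrite E Rintegral_setU//; first last.
- apply/disj_setPS => u /=; rewrite !in_itv/= => -[/andP[_ uz] [_]].
  by rewrite andbT ltNge uz.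
- by rewrite -E; apply: integrableS ih => //; exact: measurableI.
rewrite Tz addr0.
have : \int[mu]_(u in `]x, z]) (h x / 2) <= \int[mu]_(u in `]x, z]) h u.
  apply: le_Rintegral => //.
  - apply: (integrable_bounded (M := h x / 2)) => //.
      exact: lebesgue_itv_lty.
    by move=> u _; rewrite gtr0_norm// divr_gt0.
  - by apply: integrableS ih => //; exact: mD.
  - by move=> u /=; rewrite in_itv/= => /andP[xu uz]; apply/ltW/(xzD u _).2; rewrite (ltW xu).
rewrite Rintegral_cst//= lebesgue_measure_itv/= lte_fin xz/= => h1 h2.
move: h1; rewrite h2 leNgt => /negP; apply.
by rewrite mulr_gt0// ?divr_gt0// subr_gt0.
Unshelve. all: by end_near. Qed.

End moments.

(** * Uniformly convergent series; completeness of the sine system *)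

Section uniform_series.
Context (R : realType).
Variables (A : set R) (u : nat -> R -> R) (M : nat -> R).
Hypothesis uM : forall n x, A x -> `|u n x| <= M n.
Hypothesis cM : cvgn (series M).

Lemma Mtest_cvg x : A x -> cvgn (series (u ^~ x)).
Proof.
move=> Ax; apply: normed_cvg; apply: series_le_cvg cM.
- by move=> n /=.
- by move=> n; apply: le_trans (uM n Ax).
- by move=> n; exact: uM.
Qed.

Lemma Mtest_tail N x : A x ->
  `|limn (series (u ^~ x)) - series (u ^~ x) N| <= limn (series M) - series M N.
Proof.
move=> Ax.
have h n : (N <= n)%N ->
   `|series (u ^~ x) n - series (u ^~ x) N| <= series M n - series M N.
  move=> Nn; rewrite !sub_series_geq//; apply: le_trans (ler_norm_sum _ _ _) _.
  by apply: ler_sum => i _; exact: uM.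
have c1 : `|series (u ^~ x) n - series (u ^~ x) N| @[n --> \oo] -->
    `|limn (series (u ^~ x)) - series (u ^~ x) N|.
  apply: cvg_norm; apply: cvgB; last exact: cvg_cst.
  exact: Mtest_cvg.
have c2 : series M n - series M N @[n --> \oo] --> limn (series M) - series M N.
  by apply: cvgB; [exact: cM|exact: cvg_cst].
rewrite -(cvg_lim _ c1)// -(cvg_lim _ c2)//.
apply: ler_lim; [by apply/cvg_ex; eexists; exact: c1|by apply/cvg_ex; eexists; exact: c2|].
by exists N => // n /= Nn; exact: h.
Qed.

Lemma Mtest_tail_cvg0 : limn (series M) - series M N @[N --> \oo] --> (0 : R).
Proof.
rewrite -(subrr (limn (series M))).
by apply: cvgB; [exact: cvg_cst|exact: cM].
Qed.

Lemma Mtest_continuous :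
  (forall n, {within A, continuous (u n)}) ->
  {within A, continuous (fun x => limn (series (u ^~ x)))}.
Proof.
move=> uc; apply/subspace_continuousP => x Ax.
apply/cvgrPdist_lt => e e0.
have e3 : 0 < e / 3 by rewrite divr_gt0.
have [N _ HN] : \forall N \near \oo, limn (series M) - series M N < e / 3.
  by have /cvgr_lt := Mtest_tail_cvg0; apply.
have {}HN := HN _ (leqnn N).
have sc : {within A, continuous (fun y => series (u ^~ y) N)}.
  apply/subspace_continuousP => y Ay; rewrite /series/=.
  apply: cvg_big => [|i _].
    by move=> z; exact: add_continuous.
  by have /subspace_continuousP := uc i; apply.
have /subspace_continuousP /(_ x Ax)/cvgrPdist_lt/(_ _ e3) := sc.
rewrite !near_withinE; apply: filterS => y /[swap] Ay /(_ Ay) H.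
have H1 := Mtest_tail N Ax; have H2 := Mtest_tail N Ay.
move: HN H H1 H2.
set a := limn _; set b := limn _; set c := limn (series (u ^~ y)).
set a' := series _ N; set b' := series (u ^~ x) N; set c' := series (u ^~ y) N.
rewrite ltr_norml !ler_norml.
rewrite /from_subspace -/b -/c -/b' -/c' => h0 /andP[h1 h2] /andP[h3 h4] /andP[h5 h6].
by rewrite ltr_norml; apply/andP; split; lra.
Qed.

End uniform_series.

Section sine_family.
Context (R : realType).
Notation mu := (@lebesgue_measure R).
Implicit Types (L : R) (f : R -> R).

Lemma within_continuous_bounded (a b : R) f : a <= b ->
  {within `[a, b], continuous f} ->
  exists2 M, 0 <= M & forall x, a <= x <= b -> `|f x| <= M.
Proof.
move=> ab cf.
have cg : {within `[a, b], continuous (fun x => `|f x|)}.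
  apply/subspace_continuousP => x Ax; apply: cvg_norm.
  by have /subspace_continuousP := cf; apply.
have [c cab H] := EVT_max ab cg.
by exists `|f c| => // x xab; apply: H.
Qed.

Lemma continuous_itv_integrable (a b : R) f : a <= b ->
  {within `[a, b], continuous f} -> mu.-integrable `]a, b[ (EFin \o f).
Proof.
move=> ab cf; apply: (@integrableS _ _ _ mu `[a, b]%classic) => //.
  exact: subset_itv_oo_cc.
by apply: continuous_compact_integrable => //; exact: segment_compact.
Qed.

Lemma continuous_itv_measurable (a b : R) f : a <= b ->
  {within `[a, b], continuous f} -> measurable_fun `]a, b[ f.
Proof. by move=> ab cf; apply: integrable_measurable (continuous_itv_integrable ab cf). Qed.

Lemma within_continuous_oo (a b : R) f : 
  {within `[a, b], continuous f} -> forall x, a < x < b -> {for x, continuous f}.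
Proof.
move=> cf x /andP[ax xb].
have ab : a < b by exact: lt_trans xb.
have [H _ _] := (continuous_within_itvP f ab).1 cf.
by apply: H; rewrite in_itv/= ax.
Qed.

Definition phase L (x : R) : R := pi * x / L.

Lemma phase_itv L x : 0 < L -> 0 < x < L -> 0 < phase L x < pi.
Proof.
move=> L0 /andP[x0 xL]; rewrite /phase divr_gt0 ?mulr_gt0 ?pi_gt0//=.
by rewrite ltr_pdivrMr// ltr_pM2l// pi_gt0.
Qed.

Lemma continuous_phase L : continuous (phase L).
Proof.
move=> x; rewrite /phase; apply: cvgMl; apply: cvgMr; exact: cvg_id.
Qed.

(** Multiplication by X = (1 + cos(pi x / L)) / 2 turns a sine into a combination
    of itself and its two neighbouring frequencies, so all integrals of
    f X^m sin(n pi x / L) vanish; with n = 1 these are the moments in X of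
    f sin(pi x / L). *)
Lemma sine_complete L f : 0 < L -> {within `[0, L], continuous f} ->
  (forall n, (0 < n)%N ->
     \int[mu]_(x in `]0, L[) (f x * sin (n%:R * phase L x)) = 0) ->
  forall x, 0 < x < L -> f x = 0.
Proof.
move=> L0 cf H x xL.
pose X (y : R) := (1 + cos (phase L y)) / 2.
have csn n : continuous (fun y => sin (n%:R * phase L y)).
  move=> y; apply: continuous_comp; last exact: continuous_sin.
  by apply: cvgMr; exact: continuous_phase.
have cX : continuous X.
  move=> y; apply: cvgMl; apply: cvgD; first exact: cvg_cst.
  by apply: continuous_comp; [exact: continuous_phase|exact: continuous_cos].
have iXfs m n : mu.-integrable `]0, L[
    (EFin \o (fun y => f y * (X y ^+ m * sin (n%:R * phase L y)))).
  apply: continuous_itv_integrable; first exact: ltW.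
  apply/subspace_continuousP => y Ay; apply: cvgM.
    by have /subspace_continuousP := cf; apply.
  apply: cvg_within_filter; apply: cvgM; last exact: csn.
  exact: (continuous_comp (cX y) (@exprn_continuous R m _)).
have K m : forall n,
    \int[mu]_(y in `]0, L[) (f y * (X y ^+ m * sin (n%:R * phase L y))) = 0.
  elim: m => [n|m IH n].
    under eq_Rintegral do rewrite expr0 mul1r.
    have [->|n0] := posnP n; last exact: H.
    under eq_Rintegral do rewrite mul0r sin0 mulr0.
    by rewrite Rintegral_cst// mul0r.
  case: n => [|n].
    under eq_Rintegral do rewrite mul0r sin0 !mulr0.
    by rewrite Rintegral_cst// mul0r.
  have E y : f y * (X y ^+ m.+1 * sin (n.+1%:R * phase L y)) =
      2^-1 * (f y * (X y ^+ m * sin (n.+1%:R * phase L y))) +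
      4^-1 * (f y * (X y ^+ m * sin (n.+2%:R * phase L y)) +
              f y * (X y ^+ m * sin (n%:R * phase L y))).
    have -> : n.+2%:R * phase L y = n.+1%:R * phase L y + phase L y.
      by rewrite -[in LHS]natr1 mulrDl mul1r.
    have -> : n%:R * phase L y = n.+1%:R * phase L y - phase L y.
      by rewrite -[in RHS]natr1 mulrDl mul1r addrK.
    by rewrite exprS; move: (X y ^+ m) => Z; rewrite sinD sinB /X; field.
  under eq_Rintegral do rewrite E.
  rewrite RintegralD//=; last 2 first.
  - exact: integrable_mull.
  - by apply: integrable_mull => //; apply: integrable_addr.
  rewrite RintegralZl// RintegralZl//; last exact: integrable_addr.
  by rewrite RintegralD// !IH addr0 !mulr0 addr0.
have D0 : open `]0, L[%classic by exact: itv_open.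
suff : f x * sin (phase L x) = 0.
  move/eqP; rewrite mulf_eq0 => /orP[/eqP//|/eqP s0].
  by have := sin_gt0_pi (phase_itv L0 xL); rewrite s0 ltxx.
have cfx := within_continuous_oo cf.
apply: (@moments_eq0 _ `]0, L[ X (fun y => f y * sin (phase L y))) => //.
- by apply: measurable_funTS; exact: continuous_measurable_fun.
- move=> y /=; rewrite in_itv/= => /(phase_itv L0)/andP[a b].
  rewrite /X; have c1 : cos (phase L y) < 1.
    by rewrite -cos0 ltr_cos// in_itv/= ?lexx ?pi_ge0// !ltW.
  have c2 : -1 < cos (phase L y).
    by rewrite -cospi ltr_cos// in_itv/= ?lexx ?pi_ge0// !ltW.
  by apply/andP; split; lra.
- move=> y z /=; rewrite !in_itv/= => yL zL yz.
  have /andP[a b] := phase_itv L0 yL; have /andP[c d] := phase_itv L0 zL.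
  rewrite /X ltr_pM2r ?invr_gt0// ltrD2l ltr_cos ?in_itv/= ?ltW//.
  by rewrite /phase ltr_pM2r ?invr_gt0// ltr_pM2l// pi_gt0.
- have := iXfs 0%N 1%N; congr (mu.-integrable _ (EFin \o _)).
  by apply/funext => y; rewrite expr0 !mul1r.
- move=> y /=; rewrite in_itv/= => yL; apply: continuousM; first exact: cfx.
  by apply: continuous_comp; [exact: continuous_phase|exact: continuous_sin].
- move=> n; rewrite -[RHS](K n 1%N); apply: eq_Rintegral => y _.
  by rewrite mul1r; ring.
Qed.

End sine_family.

(** * The space L^2(0, L) *)

Section sequences.
Context (R : realType).
Implicit Types u : nat -> R.

Lemma cvg_mulr0 u (c : R) : u n @[n --> \oo] --> 0 ->
  u n * c @[n --> \oo] --> (0 : R).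
Proof. by move=> u0; rewrite -[X in _ --> X](mul0r c); exact: cvgMl. Qed.

Lemma cvg_sqr0 u : u n @[n --> \oo] --> 0 -> u n ^+ 2 @[n --> \oo] --> (0 : R).
Proof.
move=> u0; have : u n * u n @[n --> \oo] --> (0 : R) * 0 by exact: cvgM.
by rewrite mul0r; under eq_fun do rewrite -expr2.
Qed.

Lemma cvg_sqrt0 u : u n @[n --> \oo] --> 0 ->
  Num.sqrt (u n) @[n --> \oo] --> (0 : R).
Proof.
move=> u0; rewrite -[X in _ --> X]sqrtr0.
by apply: continuous_cvg; [exact: sqrt_continuous|exact: u0].
Qed.

End sequences.

Section square_integrable.
Context (R : realType) (L : R).
Notation mu := (@lebesgue_measure R).
Notation D := (`]0, L[%classic : set R).
Implicit Types f g h : R -> R.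

Let mD : measurable D. Proof. exact: measurable_itv. Qed.

Let restrict_sqr f : (fun x => (f \_ D) x ^+ 2) = (fun x => f x ^+ 2) \_ D.
Proof.
by apply/funext => x; rewrite !patchE; case: ifP => // _; rewrite expr0n.
Qed.

Lemma isL2P f : isL2 L f <->
  measurable_fun D f /\ mu.-integrable D (EFin \o (fun x => f x ^+ 2)).
Proof.
split=> [fL2|[mf if2]].
  have /andP[/[!inE]/= mf _] := fL2; split.
    exact/(measurable_restrictT f mD).
  have := Lfun2_integrable_sqr fL2.
  rewrite restrict_sqr -restrict_EFin => h.
  exact: (@integrable_mkcond _ _ _ mu D _ mD).2 h.
apply/andP; split; rewrite inE /=.
  exact/(measurable_restrictT f mD).
rewrite /finite_norm unlock /=.
apply: poweR_lty.
have := (@integrable_mkcond _ _ _ mu D _ mD).1 if2.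
rewrite restrict_EFin -restrict_sqr => /integrableP[_].
apply: le_lt_trans; rewrite le_eqVlt; apply/orP; left; apply/eqP.
apply: eq_integral => x _ /=.
by rewrite powR_mulrn// real_normK ?num_real// ger0_norm ?sqr_ge0.
Qed.

Lemma isL2_measurable f : isL2 L f -> measurable_fun D f.
Proof. by move=> /isL2P[]. Qed.

Lemma isL2_sqr f : isL2 L f -> mu.-integrable D (EFin \o (fun x => f x ^+ 2)).
Proof. by move=> /isL2P[]. Qed.

Lemma norm2E f : isL2 L f ->
  norm2 L f = (Num.sqrt (\int[mu]_(x in D) f x ^+ 2))%:E.
Proof.
move=> fL2; rewrite /norm2 unlock /=.
have -> : (\int[mu]_x `|((f \_ D) x)%:E| `^ 2)%E =
    (\int[mu]_(x in D) f x ^+ 2)%:E.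
  rewrite /Rintegral fineK; last first.
    exact: integrable_fin_num (isL2_sqr fL2).
  rewrite [RHS]integral_mkcond -[in RHS]/(EFin \o _) restrict_EFin -restrict_sqr.
  apply: eq_integral => x _ /=.
  by rewrite powR_mulrn// real_normK// num_real.
rewrite poweR_EFin -powR12_sqrt ?Rintegral_ge0// => x _; exact: sqr_ge0.
Qed.

Lemma norm2_cvg0 (F : nat -> R -> R) : (forall k, isL2 L (F k)) ->
  norm2 L (F k) @[k --> \oo] --> 0%E <->
  \int[mu]_(x in D) F k x ^+ 2 @[k --> \oo] --> (0 : R).
Proof.
move=> FL2; under eq_fun do rewrite norm2E//.
have I0 k : 0 <= \int[mu]_(x in D) F k x ^+ 2.
  by apply: Rintegral_ge0 => x _; exact: sqr_ge0.
split.
  move/fine_cvgP => [_] /= c.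
  by have := cvg_sqr0 c; under eq_fun do rewrite /= sqr_sqrtr//.
move=> c; apply: cvg_EFin; first exact: nearW.
exact: cvg_sqrt0.
Qed.

Lemma isL2_mul f g : isL2 L f -> isL2 L g ->
  mu.-integrable D (EFin \o (fun x => f x * g x)).
Proof.
move=> /isL2P[mf if2] /isL2P[mg ig2].
apply: (@integrable_le _ _ _ mu _ _ (fun x => f x ^+ 2 + g x ^+ 2)) => //.
- exact: measurable_funM.
- move=> x _; rewrite normrM -(real_normK (num_real (f x))) -(real_normK (num_real (g x))).
  have := sqr_ge0 (`|f x| - `|g x|); have := sqr_ge0 (`|f x| + `|g x|); nra.
- exact: integrable_addr.
Qed.

Lemma isL2_bounded f (M : R) : measurable_fun D f ->
  (forall x, 0 < x < L -> `|f x| <= M) -> isL2 L f.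
Proof.
move=> mf fM; apply/isL2P; split => //.
apply: (integrable_bounded (M := M ^+ 2)) => //.
- exact: lebesgue_itv_lty.
- exact: measurable_funX.
- move=> x /=; rewrite in_itv/= => /fM xM.
  by rewrite normrX ler_pXn2r// nnegrE// (le_trans _ xM).
Qed.

Lemma isL2_add f g : isL2 L f -> isL2 L g -> isL2 L (fun x => f x + g x).
Proof.
move=> fL gL; have /isL2P[mf if2] := fL; have /isL2P[mg ig2] := gL.
apply/isL2P; split; first exact: measurable_funD.
rewrite (_ : EFin \o _ =
    EFin \o (fun x => (f x ^+ 2 + 2 * (f x * g x)) + g x ^+ 2)); last first.
  by apply/funext => x /=; congr EFin; ring.
apply: integrable_addr => //; apply: integrable_addr => //.
by apply: integrable_mull => //; exact: isL2_mul.
Qed.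

Lemma isL2_scale (c : R) f : isL2 L f -> isL2 L (fun x => c * f x).
Proof.
move=> /isL2P[mf if2]; apply/isL2P; split; first exact: measurable_funM.
rewrite (_ : EFin \o _ = EFin \o (fun x => c ^+ 2 * f x ^+ 2)).
  exact: integrable_mull.
by apply/funext => x /=; rewrite exprMn.
Qed.

Lemma isL2_sub f g : isL2 L f -> isL2 L g -> isL2 L (fun x => f x - g x).
Proof.
move=> fL gL; have := isL2_add fL (isL2_scale (-1) gL).
by under eq_fun do rewrite mulN1r.
Qed.

Lemma isL2_continuous f : 0 < L -> {within `[0, L], continuous f} -> isL2 L f.
Proof.
move=> L0 cf; have [M M0 fM] := within_continuous_bounded (ltW L0) cf.
apply: (isL2_bounded (M := M)).
  exact: continuous_itv_measurable (ltW L0) cf.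
by move=> x /andP[a b]; apply: fM; rewrite !ltW.
Qed.

Lemma isL2_cst (c : R) : isL2 L (fun=> c).
Proof. exact: (isL2_bounded (M := `|c|)). Qed.

Lemma isL2_integrable f : isL2 L f -> mu.-integrable D (EFin \o f).
Proof.
move=> fL; have := isL2_mul fL (isL2_cst 1).
by rewrite (_ : (fun x => f x * 1) = f)//; apply/funext => x; rewrite mulr1.
Qed.

(** The quadratic A - 2 t B + t^2 C in t is an integral of squares; it is
    evaluated at its minimum t = B / C, and when C = 0 at a t that would make it
    equal to -1 unless B = 0. *)
Lemma Cauchy_Schwarz f g : isL2 L f -> isL2 L g ->
  (\int[mu]_(x in D) (f x * g x)) ^+ 2 <=
  (\int[mu]_(x in D) f x ^+ 2) * (\int[mu]_(x in D) g x ^+ 2).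
Proof.
move=> fL gL; set A := \int[mu]_(x in D) f x ^+ 2.
set B := \int[mu]_(x in D) (f x * g x); set C := \int[mu]_(x in D) g x ^+ 2.
have A0 : 0 <= A by apply: Rintegral_ge0 => x _; exact: sqr_ge0.
have C0 : 0 <= C by apply: Rintegral_ge0 => x _; exact: sqr_ge0.
have H t : 0 <= A - 2 * t * B + t ^+ 2 * C.
  have -> : A - 2 * t * B + t ^+ 2 * C =
      \int[mu]_(x in D) (f x - t * g x) ^+ 2.
    have E x : (f x - t * g x) ^+ 2 =
        (f x ^+ 2 - 2 * t * (f x * g x)) + t ^+ 2 * g x ^+ 2 by ring.
    under eq_Rintegral do rewrite E.
    have i1 := isL2_sqr fL; have i2 := isL2_mul fL gL; have i3 := isL2_sqr gL.
    rewrite RintegralD//; last 2 first.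
    - by apply: integrable_subr => //; apply: integrable_mull.
    - exact: integrable_mull.
    rewrite RintegralB//; last exact: integrable_mull.
    by rewrite !RintegralZl.
  by apply: Rintegral_ge0 => x _; exact: sqr_ge0.
have [C1|C1] := ltP 0 C.
  have := H (B / C); have -> : A - 2 * (B / C) * B + (B / C) ^+ 2 * C =
     A - B ^+ 2 / C by field; rewrite gt_eqF.
  by rewrite subr_ge0 ler_pdivrMr.
have CE : C = 0 by apply/eqP; rewrite eq_le C0 C1.
rewrite CE mulr0.
have [->|B0] := eqVneq B 0; first by rewrite expr0n.
have := H ((A + 1) / (2 * B)); rewrite CE mulr0 addr0.
have -> : A - 2 * ((A + 1) / (2 * B)) * B = - 1 by field.
by rewrite oppr_ge0 leNgt ltr01.
Qed.

Lemma L2_cvg0_mul (F : nat -> R -> R) g : (forall k, isL2 L (F k)) ->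
  isL2 L g ->
  \int[mu]_(x in D) F k x ^+ 2 @[k --> \oo] --> (0 : R) ->
  \int[mu]_(x in D) (F k x * g x) @[k --> \oo] --> (0 : R).
Proof.
move=> FL gL F0.
set C := \int[mu]_(x in D) g x ^+ 2.
have c : Num.sqrt ((\int[mu]_(x in D) F k x ^+ 2) * C) @[k --> \oo] --> (0 : R).
  by apply: cvg_sqrt0; apply: cvg_mulr0.
apply/cvgr0Pnorm_le => e e0.
have /cvgr0Pnorm_le /(_ _ e0) := c; apply: filterS => k.
apply: le_trans; rewrite [leRHS]ger0_norm ?sqrtr_ge0//.
by rewrite -sqrtr_sqr ler_wsqrtr// Cauchy_Schwarz.
Qed.

Lemma Rintegral0_continuous g : 
  mu.-integrable D (EFin \o g) -> (forall x, 0 < x < L -> {for x, continuous g}) ->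
  (forall x, 0 < x < L -> 0 <= g x) ->
  \int[mu]_(x in D) g x = 0 -> forall x, 0 < x < L -> g x = 0.
Proof.
move=> ig cg g0 I0 x xL; apply/eqP; rewrite eq_le g0// andbT leNgt.
apply/negP => gx.
have xD : nbhs x D by apply: open_nbhs_nbhs; split; [exact: itv_open|rewrite /= in_itv].
have : \forall z \near x, 0 < z < L /\ g x / 2 < g z.
  near=> z; split.
    by near: z; apply: filterS xD => u; rewrite /= in_itv.
  near: z; have /cvgr_gt : g z @[z --> x] --> g x by exact: cg.
  apply; lra.
move=> /nbhs_ballP[e /= e0 ball_e].
pose z := x + e / 2.
have xz : x < z by rewrite ltrDl divr_gt0.
have xzD u : x < u <= z -> 0 < u < L /\ g x / 2 < g u.
  move=> /andP[xu uz]; apply: ball_e; rewrite /ball/= distrC gtr0_norm ?subr_gt0//.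
  by move: uz; rewrite /z; lra.
have sub : `]x, z]%classic `<=` D.
  by move=> u /=; rewrite !in_itv/= => /xzD[].
have : (g x / 2) * (z - x) <= \int[mu]_(u in D) g u.
  have -> : (g x / 2) * (z - x) = \int[mu]_(u in D) (\1_(`]x, z]%classic) u * (g x / 2)).
    by rewrite -(@Rintegral_restrict_sub _ _ _ mu)// Rintegral_cst//= lebesgue_measure_itv/= lte_fin xz/=.
  apply: le_Rintegral => //.
  - apply: (integrable_bounded (M := g x / 2)) => //.
    + exact: lebesgue_itv_lty.
    + by apply: measurable_funM => //; exact: measurable_indic.
    + move=> u _; rewrite indicE; case: (u \in _); rewrite ?mul1r ?mul0r ?normr0.
        by rewrite gtr0_norm// divr_gt0.
      by rewrite ltW// divr_gt0.
  - move=> u Du; rewrite indicE; case: (boolP (u \in _)) => [|_].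
      by rewrite inE/= in_itv/= mul1r => /xzD[_ /ltW].
    by rewrite mul0r g0.
rewrite I0 leNgt => /negP; apply.
by rewrite mulr_gt0// ?divr_gt0// subr_gt0.
Unshelve. all: by end_near. Qed.

(** The limits agree almost everywhere by (f - g)^2 <= 2 (f - S_k)^2 + 2 (g - S_k)^2,
    hence everywhere inside since they are continuous. *)
Lemma L2_limit_unique (S : nat -> R -> R) f g : 0 < L ->
  (forall k, isL2 L (S k)) ->
  {within `[0, L], continuous f} -> {within `[0, L], continuous g} ->
  norm2 L (f \- S k) @[k --> \oo] --> 0%E ->
  norm2 L (g \- S k) @[k --> \oo] --> 0%E ->
  forall x, 0 < x < L -> f x = g x.
Proof.
move=> L0 SL cf cg fS gS.
have fL := isL2_continuous L0 cf; have gL := isL2_continuous L0 cg.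
move/norm2_cvg0 : fS => /(_ (fun k => isL2_sub fL (SL k))) fS.
move/norm2_cvg0 : gS => /(_ (fun k => isL2_sub gL (SL k))) gS.
have I0 : \int[mu]_(x in D) (f x - g x) ^+ 2 = 0.
  apply/eqP; rewrite eq_le; apply/andP; split; last first.
    by apply: Rintegral_ge0 => x _; exact: sqr_ge0.
  have c : 2 * (\int[mu]_(x in D) (f x - S k x) ^+ 2) +
    2 * (\int[mu]_(x in D) (g x - S k x) ^+ 2) @[k --> \oo] --> (0 : R).
    rewrite -[X in _ --> X](_ : 2 * (0 : R) + 2 * 0 = 0); last by ring.
    by apply: cvgD; (apply: cvgMr; assumption).
  rewrite -[leRHS](cvg_lim _ c)//; apply: limr_ge; first by apply/cvg_ex; exists 0.
  apply: nearW => k.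
  have i1 := isL2_sqr (isL2_sub fL (SL k)).
  have i2 := isL2_sqr (isL2_sub gL (SL k)).
  rewrite -RintegralZl// -RintegralZl// -RintegralD//; last 2 first.
  - exact: integrable_mull.
  - exact: integrable_mull.
  apply: le_Rintegral => //.
  - exact: isL2_sqr (isL2_sub fL gL).
  - by apply: integrable_addr => //; apply: integrable_mull.
  - by move=> x _; have := sqr_ge0 (f x + g x - 2 * S k x); nra.
move=> x xL; apply/eqP; rewrite -subr_eq0 -(sqrf_eq0 (f x - g x)); apply/eqP.
apply: (@Rintegral0_continuous (fun x => (f x - g x) ^+ 2)) => //.
- exact: isL2_sqr (isL2_sub fL gL).
- move=> y yL; apply: (@continuous_comp _ _ _ (fun x => f x - g x) (fun y => y ^+ 2));
    last exact: exprn_continuous.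
  by apply: continuousB; exact: within_continuous_oo.
- by move=> y _; exact: sqr_ge0.
Qed.

Lemma norm2_uniform_cvg0 (F : nat -> R -> R) (e : nat -> R) : 0 < L ->
  (forall k, measurable_fun D (F k)) ->
  (forall k x, 0 < x < L -> `|F k x| <= e k) -> e k @[k --> \oo] --> (0 : R) ->
  norm2 L (F k) @[k --> \oo] --> 0%E.
Proof.
move=> L0 mF Fe e0.
have FL k : isL2 L (F k) by apply: (isL2_bounded (M := e k)); [exact: mF|move=> x; exact: Fe].
apply/norm2_cvg0 => //.
apply: (@squeeze_cvgr _ _ _ _ (fun=> 0) (fun k => e k ^+ 2 * L)).
- apply: nearW => k; apply/andP; split.
    by apply: Rintegral_ge0 => x _; exact: sqr_ge0.
  have -> : e k ^+ 2 * L = \int[mu]_(x in D) (e k ^+ 2).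
    by rewrite Rintegral_cst//= lebesgue_measure_itv/= lte_fin L0/= subr0.
  apply: le_Rintegral => //; first exact: isL2_sqr.
    exact: isL2_integrable (isL2_cst _).
  move=> x /=; rewrite in_itv/= => /(Fe k) H.
  by rewrite -(real_normK (num_real _)) ler_pXn2r// nnegrE// (le_trans _ H).
- exact: cvg_cst.
- by apply: cvg_mulr0; exact: cvg_sqr0.
Qed.

End square_integrable.

(** * Rectangle contours and functions of s + i e *)

Local Notation Re := complex.Re.
Local Notation Im := complex.Im.

(** The imaginary part of Cauchy's theorem on a rectangle, for a holomorphic
    function with real part u, imaginary part v, and a the real part of its
    derivative. *)
Section rectangle.
Context (R : realType).
Notation mu := (@lebesgue_measure R).
Variables (u v a : R -> R -> R) (s1 s2 c d : R).
Hypothesis s12 : s1 < s2.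
Hypothesis du : forall s e, s1 <= s <= s2 -> c < e < d ->
  is_derive s 1 (u ^~ e) (a s e).
Hypothesis dv : forall s e, s1 <= s <= s2 -> c < e < d ->
  is_derive e 1 (v s) (a s e).
Hypothesis cu : forall s e, s1 <= s <= s2 -> c < e < d ->
  {for e, continuous (u s)}.
Hypothesis cv : forall s e, s1 <= s <= s2 -> c < e < d ->
  {for s, continuous (v ^~ e)}.
Hypothesis ca : forall s e, s1 <= s <= s2 -> c < e < d ->
  {for (s, e), continuous (fun p : R * R => a p.1 p.2)}.

Let continuous_slice e : c < e < d -> forall s, s1 <= s <= s2 ->
  {for s, continuous (a ^~ e)}.
Proof.
move=> ed s ss.
apply: (@continuous_comp _ _ _ (fun s => (s, e)) (fun p : R * R => a p.1 p.2)).
  move=> A [[P Q] [/= sP eQ] PQ]; apply: filterS sP => x Px; apply: PQ; split => //=.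
  exact: nbhs_singleton.
exact: ca.
Qed.

Let within_itv (f : R -> R) (x y : R) :
  (forall z, x <= z <= y -> {for z, continuous f}) -> {within `[x, y], continuous f}.
Proof.
move=> H; apply/subspace_continuousP => z /=; rewrite in_itv/= => xzy.
by apply: cvg_within_filter; exact: H.
Qed.

Let strip_bound c' d' : c < c' -> c' <= d' -> d' < d ->
  exists M, forall s e, s1 <= s <= s2 -> c' <= e <= d' -> `|a s e| <= M.
Proof.
move=> cc' c'd' d'd.
have H0 : (`[s1, s2]%classic `*` `[c', d']%classic : set (R * R)) !=set0.
  by exists (s1, c'); split; rewrite /= in_itv/= lexx// ltW.
have cK := compact_setX (@segment_compact R s1 s2) (@segment_compact R c' d').
have := compact_EVT_max H0 cK (f := fun p : R * R => `|a p.1 p.2|).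
case.
  apply/subspace_continuousP => -[s e] [/=]; rewrite !in_itv/= => ss /andP[ce ed].
  apply: cvg_within_filter; apply: cvg_norm; apply: ca => //.
  by rewrite (lt_le_trans cc' ce) (le_lt_trans ed d'd).
move=> p _ H; exists `|a p.1 p.2| => s e ss ee.
by apply: (H (s, e)); rewrite inE; split; rewrite /= in_itv.
Qed.

Let J e := \int[mu]_(s in `[s1, s2]) v s e.

(** Differentiating under the integral sign gives the integral of a, which
    is also the derivative of u along the horizontal side. *)
Let J_derive e : c < e < d -> derivable J e 1 /\ derive1 J e = u s2 e - u s1 e.
Proof.
move=> /andP[ce ed].
pose c' := (c + e) / 2; pose d' := (e + d) / 2.
have cc' : c < c' by rewrite /c'; lra.
have c'e : c' < e by rewrite /c'; lra.
have ed' : e < d' by rewrite /d'; lra.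
have d'd : d' < d by rewrite /d'; lra.
have sub x : c' < x < d' -> c < x < d.
  by move=> /andP[h1 h2]; rewrite (lt_trans cc' h1) (lt_trans h2 d'd).
have [M HM] := strip_bound cc' (ltW (lt_trans c'e ed')) d'd.
have Ie : (`]c', d'[%classic : set R) e by rewrite /= in_itv/= c'e.
have mB : measurable (`[s1, s2]%classic : set R) by exact: measurable_itv.
have intf x : (`]c', d'[%classic : set R) x ->
    mu.-integrable `[s1, s2] (EFin \o (fun s => v s x)).
  rewrite /= in_itv/= => /sub xd.
  apply: continuous_compact_integrable; first exact: segment_compact.
  by apply: within_itv => s ss; exact: cv.
have der x y : (`]c', d'[%classic : set R) x -> `[s1, s2]%classic y ->
    derivable (v y) x 1.
  by rewrite /= !in_itv/= => /sub xd yy; have [] := dv yy xd.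
have intM : mu.-integrable `[s1, s2] (EFin \o (fun=> `|M|)).
  apply: (integrable_bounded (M := `|M|)) => //; first exact: lebesgue_itv_lty.
  by move=> ? _; rewrite normr_id.
have ub x y : (`]c', d'[%classic : set R) x -> `[s1, s2]%classic y ->
    `|derive1 (v y) x| <= `|M|.
  rewrite /= !in_itv/= => xx yy; have xd := sub _ xx.
  rewrite derive1E (@derive_val _ _ _ _ _ _ _ (dv yy xd)).
  apply: le_trans (ler_norm _); apply: HM => //.
  by case/andP: xx => h1 h2; rewrite !ltW.
have ge0 (y : R) : 0 <= (fun=> `|M|) y by [].
have cee : c < e < d by rewrite ce.
split.
  exact: (@derivable_under_integral R _ _ mu (fun x y => v y x) _ mB e c' d' Ie intf der (fun=> `|M|) ge0 intM ub).
rewrite (@differentiation_under_integral R _ _ mu (fun x y => v y x) _ mB e c' d' Ie intf der (fun=> `|M|) ge0 intM ub).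
have -> : \int[mu]_(y in `[s1, s2]) partial1of2 (fun x y => v y x) e y =
    \int[mu]_(y in `[s1, s2]) a y e.
  apply: eq_Rintegral => y; rewrite inE/= in_itv/= => yy.
  by rewrite /partial1of2 derive1E (@derive_val _ _ _ _ _ _ _ (dv yy cee)).
rewrite /Rintegral (@continuous_FTC2 _ (a ^~ e) (u ^~ e)) ?EFinB//.
- by apply: within_itv => s ss; exact: continuous_slice.
- have cuv s : s1 <= s <= s2 -> {for s, continuous (u ^~ e)}.
    by move=> ss; exact: is_derive_continuous (du ss cee).
  split.
  + move=> x; rewrite in_itv/= => /andP[h1 h2].
    have xx : s1 <= x <= s2 by rewrite !ltW.
    by have [] := du xx cee.
  + by apply: cvg_at_right_filter; apply: cuv; rewrite lexx ltW.
  + by apply: cvg_at_left_filter; apply: cuv; rewrite lexx ltW.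
- move=> x; rewrite in_itv/= => /andP[h1 h2].
  have xx : s1 <= x <= s2 by rewrite !ltW.
  by rewrite derive1E (@derive_val _ _ _ _ _ _ _ (du xx cee)).
Qed.

Lemma rectangle_integral e1 e2 : c < e1 -> e1 < e2 -> e2 < d ->
  \int[mu]_(s in `[s1, s2]) v s e2 - \int[mu]_(s in `[s1, s2]) v s e1 =
  \int[mu]_(e in `[e1, e2]) (u s2 e - u s1 e).
Proof.
move=> ce1 e12 e2d.
have sub e : e1 <= e <= e2 -> c < e < d.
  by move=> /andP[h1 h2]; rewrite (lt_le_trans ce1 h1) (le_lt_trans h2 e2d).
have cJ e : c < e < d -> {for e, continuous J}.
  move=> ee; apply: differentiable_continuous; apply/derivable1_diffP.
  by have [] := J_derive ee.
rewrite {3}/Rintegral (@continuous_FTC2 _ _ J) ?EFinB//.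
- apply: within_itv => e /sub ee; apply: continuousB; apply: cu => //;
    by rewrite lexx ltW.
- split.
  + move=> e; rewrite in_itv/= => /andP[h1 h2].
    by have [] := @J_derive e; rewrite ?(lt_trans ce1 h1) ?(lt_trans h2 e2d).
  + by apply: cvg_at_right_filter; apply: cJ; rewrite ce1 (lt_trans e12).
  + by apply: cvg_at_left_filter; apply: cJ; rewrite e2d (lt_trans ce1).
- move=> e; rewrite in_itv/= => /andP[h1 h2].
  by have [] := @J_derive e; rewrite ?(lt_trans ce1 h1) ?(lt_trans h2 e2d).
Qed.

End rectangle.

Section holomorphic.
Context (R : realType).
Implicit Types f g : R -> R -> R[i].

(** Squared modulus, kept in R so that estimates stay in the real field. *)
Definition nsq (z : R[i]) : R := Re z ^+ 2 + Im z ^+ 2.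

Lemma ReC_D (z w : R[i]) : Re (z + w) = Re z + Re w. Proof. by case: z; case: w. Qed.
Lemma ImC_D (z w : R[i]) : Im (z + w) = Im z + Im w. Proof. by case: z; case: w. Qed.
Lemma ReC_N (z : R[i]) : Re (- z) = - Re z. Proof. by case: z. Qed.
Lemma ImC_N (z : R[i]) : Im (- z) = - Im z. Proof. by case: z. Qed.
Lemma ReC_M (z w : R[i]) : Re (z * w) = Re z * Re w - Im z * Im w.
Proof. by case: z; case: w. Qed.
Lemma ImC_M (z w : R[i]) : Im (z * w) = Re z * Im w + Im z * Re w.
Proof. by case: z; case: w. Qed.
Lemma ReC_V (z : R[i]) : Re z^-1 = Re z / nsq z. Proof. by case: z. Qed.
Lemma ImC_V (z : R[i]) : Im z^-1 = - Im z / nsq z.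
Proof. by case: z => x y; rewrite mulNr. Qed.

Lemma nsq_ge0 z : 0 <= nsq z. Proof. by rewrite addr_ge0// sqr_ge0. Qed.
Lemma nsqM z w : nsq (z * w) = nsq z * nsq w.
Proof. by rewrite /nsq ReC_M ImC_M; ring. Qed.
Lemma nsq_eq0 z : (nsq z == 0) = (z == 0).
Proof. by case: z => x y; rewrite /nsq paddr_eq0 ?sqr_ge0// !sqrf_eq0 eq_complex. Qed.
Lemma nsq_gt0 z : (0 < nsq z) = (z != 0).
Proof. by rewrite lt_neqAle nsq_ge0 andbT eq_sym nsq_eq0. Qed.
Lemma nsqN z : nsq (- z) = nsq z.
Proof. by rewrite /nsq ReC_N ImC_N !sqrrN. Qed.
Lemma nsqD_le z w : nsq (z + w) <= 2 * nsq z + 2 * nsq w.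
Proof.
rewrite /nsq ReC_D ImC_D.
have := sqr_ge0 (Re z - Re w); have := sqr_ge0 (Im z - Im w); nra.
Qed.
Lemma nsqV z : nsq z^-1 = (nsq z)^-1.
Proof.
have [->|z0] := eqVneq z 0; first by rewrite invr0 /nsq/= expr0n addr0 invr0.
apply: (@mulIf _ (nsq z)); first by rewrite nsq_eq0.
rewrite -nsqM mulVf// mulVf ?nsq_eq0//.
by rewrite /nsq/= expr0n expr1n addr0.
Qed.
Lemma Re_sqr_le z : Re z ^+ 2 <= nsq z. Proof. by rewrite lerDl sqr_ge0. Qed.
Lemma Im_sqr_le z : Im z ^+ 2 <= nsq z. Proof. by rewrite lerDr sqr_ge0. Qed.

(** Functions of a complex variable s + i e are written as functions of the two
    real variables s and e, with values in R[i]. *)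
Definition jcont f (s e : R) :=
  continuous_at (s, e) (fun p : R * R => Re (f p.1 p.2)) /\
  continuous_at (s, e) (fun p : R * R => Im (f p.1 p.2)).

(** The Cauchy-Riemann equations, g being the complex derivative of f. *)
Definition holo f g (s e : R) :=
  [/\ is_derive s 1 (fun s => Re (f s e)) (Re (g s e)),
      is_derive s 1 (fun s => Im (f s e)) (Im (g s e)),
      is_derive e 1 (fun e => Re (f s e)) (- Im (g s e)) &
      is_derive e 1 (fun e => Im (f s e)) (Re (g s e))].

Lemma jcontD f g s e : jcont f s e -> jcont g s e ->
  jcont (fun s e => f s e + g s e) s e.
Proof.
move=> [f1 f2] [g1 g2]; split.
  by under eq_fun do rewrite ReC_D; exact: continuousD.
by under eq_fun do rewrite ImC_D; exact: continuousD.
Qed.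

Lemma jcontN f s e : jcont f s e -> jcont (fun s e => - f s e) s e.
Proof.
move=> [f1 f2]; split.
  by under eq_fun do rewrite ReC_N; exact: continuousN.
by under eq_fun do rewrite ImC_N; exact: continuousN.
Qed.

Lemma jcontM f g s e : jcont f s e -> jcont g s e ->
  jcont (fun s e => f s e * g s e) s e.
Proof.
move=> [f1 f2] [g1 g2]; split.
  by under eq_fun do rewrite ReC_M; apply: cvgB; exact: cvgM.
by under eq_fun do rewrite ImC_M; apply: cvgD; exact: cvgM.
Qed.

Lemma jcontV f s e : f s e != 0 -> jcont f s e ->
  jcont (fun s e => (f s e)^-1) s e.
Proof.
move=> f0 [f1 f2].
have n : continuous_at (s, e) (fun p : R * R => nsq (f p.1 p.2)).
  by rewrite /nsq; under eq_fun do rewrite !expr2; apply: cvgD; exact: cvgM.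
have nV : continuous_at (s, e) (fun p : R * R => (nsq (f p.1 p.2))^-1).
  by apply: cvgV; [rewrite /= nsq_eq0|exact: n].
split.
  by under eq_fun do rewrite ReC_V; exact: cvgM.
by under eq_fun do rewrite ImC_V; apply: cvgM => //; exact: cvgN.
Qed.

Lemma jcont_cst (z : R[i]) s e : jcont (fun _ _ => z) s e.
Proof. by split; exact: cst_continuous. Qed.

Lemma holo_cst (z : R[i]) s e : holo (fun _ _ => z) (fun _ _ => 0) s e.
Proof. by split; rewrite /= ?oppr0; exact: is_derive_cst. Qed.

Lemma holoD f f' g g' s e : holo f f' s e -> holo g g' s e ->
  holo (fun s e => f s e + g s e) (fun s e => f' s e + g' s e) s e.
Proof.
move=> [f1 f2 f3 f4] [g1 g2 g3 g4]; split.
- by under eq_fun do rewrite ReC_D; rewrite ReC_D; exact: is_deriveD.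
- by under eq_fun do rewrite ImC_D; rewrite ImC_D; exact: is_deriveD.
- by under eq_fun do rewrite ReC_D; rewrite ImC_D opprD; exact: is_deriveD.
- by under eq_fun do rewrite ImC_D; rewrite ReC_D; exact: is_deriveD.
Qed.

Let is_deriveMR (f g : R -> R) (x df dg : R) : is_derive x 1 f df ->
  is_derive x 1 g dg -> is_derive x 1 (fun y => f y * g y) (df * g x + f x * dg).
Proof.
move=> Hf Hg; apply: (is_derive_eq (is_deriveM Hf Hg)).
by rewrite /GRing.scale/= addrC; congr (_ + _); exact: mulrC.
Qed.

Let is_deriveNR (f : R -> R) (x df : R) : is_derive x 1 f df ->
  is_derive x 1 (fun y => - f y) (- df).
Proof. by move=> Hf; exact: is_deriveN. Qed.

Lemma holoM f f' g g' s e : holo f f' s e -> holo g g' s e ->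
  holo (fun s e => f s e * g s e)
       (fun s e => f' s e * g s e + f s e * g' s e) s e.
Proof.
move=> [f1 f2 f3 f4] [g1 g2 g3 g4]; split.
- under eq_fun do rewrite ReC_M.
  apply: (is_derive_eq (is_deriveB (is_deriveMR f1 g1) (is_deriveMR f2 g2))).
  by rewrite ReC_D !ReC_M; ring.
- under eq_fun do rewrite ImC_M.
  apply: (is_derive_eq (is_deriveD (is_deriveMR f1 g2) (is_deriveMR f2 g1))).
  by rewrite ImC_D !ImC_M; ring.
- under eq_fun do rewrite ReC_M.
  apply: (is_derive_eq (is_deriveB (is_deriveMR f3 g3) (is_deriveMR f4 g4))).
  by rewrite ImC_D !ImC_M; ring.
- under eq_fun do rewrite ImC_M.
  apply: (is_derive_eq (is_deriveD (is_deriveMR f3 g4) (is_deriveMR f4 g3))).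
  by rewrite ReC_D !ReC_M; ring.
Qed.

Lemma holoV f f' s e : f s e != 0 -> holo f f' s e ->
  holo (fun s e => (f s e)^-1) (fun s e => - f' s e * (f s e)^-1 * (f s e)^-1) s e.
Proof.
move=> f0 [f1 f2 f3 f4].
have n0 : nsq (f s e) != 0 by rewrite nsq_eq0.
have dn (x : R) (p q : R -> R) (dp dq : R) : p x ^+ 2 + q x ^+ 2 != 0 ->
    is_derive x 1 p dp -> is_derive x 1 q dq ->
    is_derive x 1 (fun y => (p y ^+ 2 + q y ^+ 2)^-1)
      (- (2 * p x * dp + 2 * q x * dq) / (p x ^+ 2 + q x ^+ 2) ^+ 2).
  move=> pq0 Hp Hq.
  have -> : (fun y => (p y ^+ 2 + q y ^+ 2)^-1) =
     (fun y => (p y * p y + q y * q y)^-1) by apply/funext => y; rewrite !expr2.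
  have H := is_deriveD (is_deriveMR Hp Hp) (is_deriveMR Hq Hq).
  have H0 : p x * p x + q x * q x != 0 by rewrite -!expr2.
  apply: (is_derive_eq (is_deriveV (f := fun y => p y * p y + q y * q y) H0 H)).
  by rewrite /GRing.scale/= -!expr2; field.
split.
- under eq_fun do rewrite ReC_V /nsq.
  apply: (is_derive_eq (is_deriveMR f1 (dn _ _ _ _ _ n0 f1 f2))).
  rewrite !ReC_M !ImC_M ReC_N ImC_N ReC_V ImC_V; move: n0; rewrite /nsq => n0; field; exact: n0.
- under eq_fun do rewrite ImC_V /nsq.
  apply: (is_derive_eq (is_deriveMR (is_deriveNR f2) (dn _ _ _ _ _ n0 f1 f2))).
  rewrite !ImC_M !ReC_M ReC_N ImC_N ReC_V ImC_V; move: n0; rewrite /nsq => n0; field; exact: n0.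
- under eq_fun do rewrite ReC_V /nsq.
  apply: (is_derive_eq (is_deriveMR f3 (dn _ _ _ _ _ n0 f3 f4))).
  rewrite !ImC_M !ReC_M ReC_N ImC_N ReC_V ImC_V; move: n0; rewrite /nsq => n0; field; exact: n0.
- under eq_fun do rewrite ImC_V /nsq.
  apply: (is_derive_eq (is_deriveMR (is_deriveNR f4) (dn _ _ _ _ _ n0 f3 f4))).
  rewrite !ReC_M !ImC_M ReC_N ImC_N ReC_V ImC_V; move: n0; rewrite /nsq => n0; field; exact: n0.
Qed.

(** [cexp c s e] is [exp (c (s + i e))]. *)
Definition cexp (c s e : R) : R[i] :=
  Complex (expR (c * s) * cos (c * e)) (expR (c * s) * sin (c * e)).

Lemma jcont_cexp c s e : jcont (cexp c) s e.
Proof.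
have H1 : {for (s, e), continuous (fun p : R * R => expR (c * p.1))}.
  apply: (@continuous_comp _ _ _ (fun p : R * R => c * p.1) expR).
    by apply: cvgMr; exact: cvg_fst.
  exact: continuous_expR.
split => /=; apply: cvgM => //.
  apply: (@continuous_comp _ _ _ (fun p : R * R => c * p.2) cos).
    by apply: cvgMr; exact: cvg_snd.
  exact: continuous_cos.
apply: (@continuous_comp _ _ _ (fun p : R * R => c * p.2) sin).
  by apply: cvgMr; exact: cvg_snd.
exact: continuous_sin.
Qed.

Lemma holo_cexp c s e :
  holo (cexp c) (fun s e => Complex c 0 * cexp c s e) s e.
Proof.
have d0 (x : R) : is_derive x 1 (fun x => c * x) c.
  by apply: is_derive_eq; rewrite /GRing.scale/= mulr1.
have d1 (x : R) : is_derive x 1 (fun x => expR (c * x)) (c * expR (c * x)).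
  apply: (is_derive_eq (@is_derive1_comp _ _ _ _ _ _ (is_derive_expR (c * x)) (d0 x))).
  by rewrite mulrC.
have d2 (x : R) : is_derive x 1 (fun x => cos (c * x)) (- c * sin (c * x)).
  apply: (is_derive_eq (@is_derive1_comp _ _ _ _ _ _ (is_derive_cos (c * x)) (d0 x))).
  by rewrite mulrC mulrN mulNr.
have d3 (x : R) : is_derive x 1 (fun x => sin (c * x)) (c * cos (c * x)).
  apply: (is_derive_eq (@is_derive1_comp _ _ _ _ _ _ (is_derive_sin (c * x)) (d0 x))).
  by rewrite mulrC.
split => /=.
- apply: (is_derive_eq (is_deriveMR (d1 s) (is_derive_cst _ _ _))) => /=; ring.
- apply: (is_derive_eq (is_deriveMR (d1 s) (is_derive_cst _ _ _))) => /=; ring.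
- apply: (is_derive_eq (is_deriveMR (is_derive_cst (expR (c * s) : R) _ _) (d2 e))); rewrite /cst; ring.
- apply: (is_derive_eq (is_deriveMR (is_derive_cst (expR (c * s) : R) _ _) (d3 e))); rewrite /cst; ring.
Qed.

End holomorphic.

(** * The Stieltjes transform of the spectral density *)

Section exponential_integrability.
Context (R : realType).
Notation mu := (@lebesgue_measure R).

Lemma cvg_expRN_scale (c : R) : 0 < c -> expR (- (c * x)) @[x --> +oo] --> (0 : R).
Proof.
move=> c0; apply: (@cvg_comp _ _ _ (fun x => c * x) (fun y => expR (- y)) _ (+oo%R)).
  exact: gt0_cvgMry.
exact: cvgr_expR.
Qed.

Lemma integral_expRN (c : R) : 0 < c ->
  (\int[mu]_(x in `[0%R, +oo[) (expR (- (c * x)))%:E = (c^-1)%:E)%E.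
Proof.
move=> c0; pose F (x : R) := - c^-1 * expR (- (c * x)).
have dF (x : R) : is_derive x 1 F (expR (- (c * x))).
  have d0 : is_derive x 1 (fun x => - (c * x)) (- c).
    by apply: is_derive_eq; rewrite /GRing.scale/= mulr1.
  have d1 := @is_derive1_comp _ expR (fun x => - (c * x)) _ _ _ (is_derive_expR (- (c * x))) d0.
  apply: (is_derive_eq (is_deriveZ (- c^-1) d1)).
  by rewrite /GRing.scale/=; field; rewrite gt_eqF.
have cexp : continuous (fun x : R => expR (- (c * x))).
  move=> x; apply: (@continuous_comp _ _ _ (fun x => - (c * x)) expR); last exact: continuous_expR.
  by apply: cvgN; apply: cvgMr; exact: cvg_id.
rewrite (@ge0_continuous_FTC2y _ _ F 0 0).
- by rewrite sub0e -EFinN /F mulr0 oppr0 expR0 mulr1 opprK.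
- by move=> x _; exact: expR_ge0.
- exact: continuous_subspaceT.
- rewrite -[X in _ --> X](mulr0 (- c^-1)); apply: cvgMr.
  exact: cvg_expRN_scale.
- by move=> x _; have [] := dF x.
- by apply: cvg_at_right_filter; exact: is_derive_continuous (dF 0).
- by move=> x _; rewrite derive1E (@derive_val _ _ _ _ _ _ _ (dF x)).
Qed.

Lemma continuous_expRN_norm (c : R) : continuous (fun x : R => expR (- (c * `|x|))).
Proof.
move=> x; apply: (@continuous_comp _ _ _ (fun x => - (c * `|x|)) expR); last exact: continuous_expR.
by apply: cvgN; apply: cvgMr; exact: norm_continuous.
Qed.

Lemma integrable_expRN_norm (c : R) : 0 < c ->
  mu.-integrable setT (EFin \o (fun x : R => expR (- (c * `|x|)))).
Proof.
move=> c0; apply/integrableP; split.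
  apply/measurable_EFinP; apply: continuous_measurable_fun.
  exact: continuous_expRN_norm.
under eq_integral => x _ do rewrite /= ger0_norm ?expR_ge0//.
rewrite ge0_symfun_integralT//; last 2 first.
- exact: continuous_expRN_norm.
- by move=> x; rewrite /= normrN.
have -> : (\int[mu]_(x in [set x | (0 <= x)%R]) (expR (- (c * `|x|)))%:E =
    \int[mu]_(x in `[0%R, +oo[) (expR (- (c * x)))%:E)%E.
  rewrite -set_itvcy; apply: eq_integral => x.
  by rewrite inE/= in_itv/= andbT => x0; rewrite ger0_norm.
by rewrite integral_expRN// -EFinM ltry.
Qed.

End exponential_integrability.

Section truncation.
Context (R : realType).
Notation mu := (@lebesgue_measure R).

(** For the horizontal sides of rectangles that grow with n. *)
Lemma truncated_dominated_convergence (f : nat -> R -> R) (h g : R -> R) :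
  (forall n, measurable_fun setT (f n)) -> measurable_fun setT h ->
  {ae mu, forall s, f n s @[n --> \oo] --> h s} ->
  mu.-integrable setT (EFin \o g) -> (forall n s, `|f n s| <= g s) ->
  mu.-integrable setT (EFin \o h) /\
  \int[mu]_(s in `[(- n.+1%:R), n.+1%:R]) f n s @[n --> \oo] --> \int[mu]_s h s.
Proof.
move=> mf mh fh ig fg.
pose I (n : nat) := `[(- n.+1%:R : R), n.+1%:R]%classic.
have E n : \int[mu]_(s in I n) f n s = \int[mu]_s (\1_(I n) s * f n s).
  by apply: (@Rintegral_restrict_sub _ _ _ mu setT); [exact: measurableT|exact: measurable_itv|].
have -> : (fun n => \int[mu]_(s in `[(- n.+1%:R), n.+1%:R]) f n s) =
  (fun n => \int[mu]_s (\1_(I n) s * f n s)) by apply/funext => n; exact: E.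
apply: (@Rdominated_convergence _ _ _ mu setT (fun n s => \1_(I n) s * f n s) h g) => //.
- move=> n; apply: measurable_funM; last exact: mf.
  by apply: measurable_indic; exact: measurable_itv.
- case: fh => Z [mZ Z0 hZ]; exists Z; split => // s hs; apply: hZ => fs; apply: hs => _.
  apply: (@cvg_trans _ (f n s @[n --> \oo])); last exact: fs.
  apply: near_eq_cvg; near=> n.
  rewrite indicE mem_set ?mul1r// /I/= in_itv/= -ler_norml.
  rewrite (@le_trans _ _ n%:R) ?ler_nat//.
  by near: n; exact: nbhs_infty_ger.
- move=> n s _; rewrite normrM indicE; case: (s \in _); rewrite ?normr1 ?normr0 ?mul1r ?mul0r//.
  by apply: le_trans (fg n s).
Unshelve. all: by end_near. Qed.

End truncation.

Section stieltjes.
Context (R : realType).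
Notation mu := (@lebesgue_measure R).

Lemma half_cos_gt0 (al : R) : 0 < al < 1 -> 0 < (1 + cos (pi * al)) / 2.
Proof.
move=> /andP[al0 al1]; rewrite divr_gt0// -ltrBlDl sub0r -cospi ltr_cos.
- by rewrite gtr_pMr// pi_gt0.
- by rewrite in_itv/= mulr_ge0 ?pi_ge0 ?(ltW al0)//= ger_pMr ?pi_gt0// ltW.
- by rewrite in_itv/= pi_ge0 lexx.
Qed.

Variables (al lam : R).
Hypotheses (al0 : 0 < al) (al1 : al < 1) (lam0 : 0 < lam).

Let lamC : R[i] := Complex lam 0.

(** N(w) = (e^(al w) - 1) / ((e^w - 1) (e^(al w) + lam)) at w = s + i e.  On the
    line e = pi, e^w is - e^s and the imaginary part of N is a constant multiple
    of the integrand wanted; on the line e = 0, N is real.  The numerator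
    removes the pole of 1 / (e^w - 1) at 0 and, since
    (e^(al w) - 1) / (e^(al w) + lam) = 1 - (1 + lam) / (e^(al w) + lam), only
    contributes a factor - (1 + lam) to that imaginary part. *)
Let N (s e : R) : R[i] :=
  (cexp al s e + - 1) * ((cexp 1 s e + - 1) * (cexp al s e + lamC))^-1.

Let N' (s e : R) : R[i] :=
  (Complex al 0 * cexp al s e + 0) *
    ((cexp 1 s e + - 1) * (cexp al s e + lamC))^-1 +
  (cexp al s e + - 1) *
    (- ((Complex 1 0 * cexp 1 s e + 0) * (cexp al s e + lamC) +
        (cexp 1 s e + - 1) * (Complex al 0 * cexp al s e + 0)) *
     ((cexp 1 s e + - 1) * (cexp al s e + lamC))^-1 *
     ((cexp 1 s e + - 1) * (cexp al s e + lamC))^-1).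

Let den_neq0 s e := (cexp 1 s e + - 1) * (cexp al s e + lamC) != 0.

Let N_holo s e : den_neq0 s e -> holo N N' s e.
Proof.
move=> d0; apply: (@holoM _ (fun s e => cexp al s e + - 1)
  (fun s e => (Complex al 0 * cexp al s e + 0))
  (fun s e => ((cexp 1 s e + - 1) * (cexp al s e + lamC))^-1)).
  by apply: holoD; [exact: holo_cexp|exact: holo_cst].
apply: (@holoV _ (fun s e => (cexp 1 s e + - 1) * (cexp al s e + lamC))
  (fun s e => (Complex 1 0 * cexp 1 s e + 0) * (cexp al s e + lamC) +
        (cexp 1 s e + - 1) * (Complex al 0 * cexp al s e + 0))) => //.
apply: (@holoM _ (fun s e => cexp 1 s e + - 1) (fun s e => Complex 1 0 * cexp 1 s e + 0)
   (fun s e => cexp al s e + lamC) (fun s e => Complex al 0 * cexp al s e + 0)).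
  by apply: holoD; [exact: holo_cexp|exact: holo_cst].
by apply: holoD; [exact: holo_cexp|exact: holo_cst].
Qed.

Let jc1 s e : jcont (fun s e => cexp al s e + - 1) s e.
Proof. by apply: jcontD; [exact: jcont_cexp|exact: jcont_cst]. Qed.

Let jc2 s e : jcont (fun s e => (cexp 1 s e + - 1) * (cexp al s e + lamC)) s e.
Proof.
by apply: (@jcontM _ (fun s e => cexp 1 s e + - 1) (fun s e => cexp al s e + lamC));
  apply: jcontD; (exact: jcont_cexp || exact: jcont_cst).
Qed.

Let N_jcont s e : den_neq0 s e -> jcont N s e.
Proof.
move=> d0; apply: (@jcontM _ (fun s e => cexp al s e + - 1)
  (fun s e => ((cexp 1 s e + - 1) * (cexp al s e + lamC))^-1)) => //.
exact: (@jcontV _ (fun s e => (cexp 1 s e + - 1) * (cexp al s e + lamC))).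
Qed.

Let N'_jcont s e : den_neq0 s e -> jcont N' s e.
Proof.
move=> d0.
have j (c s' e' : R) : jcont (fun s e => Complex c 0 * cexp c s e + 0) s' e'.
  apply: (@jcontD _ (fun s e => Complex c 0 * cexp c s e) (fun _ _ => 0)); last exact: jcont_cst.
  by apply: (@jcontM _ (fun _ _ => Complex c 0)); [exact: jcont_cst|exact: jcont_cexp].
have jV := @jcontV _ (fun s e => (cexp 1 s e + - 1) * (cexp al s e + lamC)) s e d0 (jc2 s e).
have j1 : jcont (fun s e => cexp 1 s e + - 1) s e.
  by apply: jcontD; [exact: jcont_cexp|exact: jcont_cst].
have j2 : jcont (fun s e => cexp al s e + lamC) s e.
  by apply: jcontD; [exact: jcont_cexp|exact: jcont_cst].
have jd := @jcontD _ (fun s e => (Complex 1 0 * cexp 1 s e + 0) * (cexp al s e + lamC))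
  (fun s e => (cexp 1 s e + - 1) * (Complex al 0 * cexp al s e + 0)) s e
  (jcontM (j 1 s e) j2) (jcontM j1 (j al s e)).
exact: (jcontD (jcontM (j al s e) jV) (jcontM (jc1 s e) (jcontM (jcontM (jcontN jd) jV) jV))).
Qed.

Lemma nsq_cexp (c s e : R) : nsq (cexp c s e) = expR (c * s) ^+ 2.
Proof.
rewrite /nsq /cexp/= !exprMn -mulrDr cos2Dsin2 mulr1//.
Qed.

Lemma nsq_cexpD (c s e l : R) : nsq (cexp c s e + Complex l 0) =
  expR (c * s) ^+ 2 + 2 * expR (c * s) * l * cos (c * e) + l ^+ 2.
Proof.
rewrite /nsq ReC_D ImC_D /= addr0.
set x := expR _; set C := cos _; set S := sin _.
have <- : (x ^+ 2) * (C ^+ 2 + S ^+ 2) = x ^+ 2 by rewrite cos2Dsin2 mulr1.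
ring.
Qed.

Lemma nsq_cexpB1 (c s e : R) : nsq (cexp c s e + - 1) =
  (expR (c * s) - 1) ^+ 2 + 2 * expR (c * s) * (1 - cos (c * e)).
Proof.
have -> : (- 1 : R[i]) = Complex (- 1) 0 by apply/eqP; rewrite eq_complex/= oppr0 !eqxx.
by rewrite nsq_cexpD; ring.
Qed.

Let cos_al e : 0 <= e <= pi -> cos e <= cos (al * e).
Proof.
move=> /andP[e0 epi]; have [->|ene] := eqVneq e 0; first by rewrite mulr0.
have e0' : 0 < e by rewrite lt_neqAle eq_sym ene.
have ale : al * e < e by rewrite gtr_pMl.
rewrite ltW// ltr_cos ?in_itv/= ?e0 ?epi// mulr_ge0 ?ltW//=.
exact: lt_le_trans ale epi.
Qed.

Let c0 := (1 + cos (pi * al)) / 2.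

Let c0_gt0 : 0 < c0. Proof. by apply: half_cos_gt0; rewrite al0. Qed.

Let nsq_A s e : 0 <= e <= pi ->
  c0 * (expR (al * s) + lam) ^+ 2 <= nsq (cexp al s e + lamC).
Proof.
move=> /andP[e0 epi]; rewrite nsq_cexpD.
have H : cos (pi * al) <= cos (al * e).
  have [->|nee] := eqVneq e pi; first by rewrite mulrC.
  rewrite ltW// mulrC ltr_cos ?in_itv/=.
  - by rewrite ltr_pM2l// lt_neqAle nee.
  - apply/andP; split; first by rewrite mulr_ge0// ltW.
    by apply: le_trans epi; rewrite ler_piMl// ltW.
  - by rewrite mulr_ge0 ?pi_ge0 ?(ltW al0)//= ger_pMl ?pi_gt0// ltW.
rewrite /c0; set x := expR _; have x0 : 0 < x by exact: expR_gt0.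
have xl : 0 < x * lam by exact: mulr_gt0.
have h1 := cos_le1 (pi * al).
move: H h1; set C := cos _; set C' := cos _ => H h1.
have h2 : 0 <= (1 - C) * (x - lam) ^+ 2 by rewrite mulr_ge0 ?sqr_ge0// subr_ge0.
have h3 : 0 <= x * lam * (C' - C) by rewrite mulr_ge0 ?subr_ge0// ltW.
nra.
Qed.

Let nsq_B_gt0 (s e : R) : 0 < e <= pi -> 0 < nsq (cexp 1 s e + - 1).
Proof.
move=> /andP[e0 epi]; rewrite nsq_cexpB1 ltr_wpDl ?sqr_ge0// mulr_gt0//.
  by rewrite mulr_gt0// expR_gt0.
rewrite subr_gt0 mul1r -cos0 ltr_cos ?in_itv/= ?lexx ?pi_ge0// epi ltW//.
Qed.

(** The removable singularity at w = 0, quantitatively.  For s >= 0 one has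
    |e^(al w) - 1| <= |e^w - 1|.  For s < 0 the term in 1 - cos e is compared
    either through e^s >= 1/2 or, when e^s < 1/2, through |e^w - 1|^2 >= 1/4
    while 2 (1 - cos e) <= 4; this accounts for 1 + 4 * 4 = 17. *)
Let nsq_AB s e : 0 <= e <= pi -> nsq (cexp al s e + - 1) <= 17 * nsq (cexp 1 s e + - 1).
Proof.
move=> ee; rewrite !nsq_cexpB1 !mul1r.
have := cos_al ee; have := cos_le1 e; have := cos_geN1 e; have := cos_le1 (al * e).
set C := cos _; set C' := cos _ => h1 h2 h3 h4.
set x := expR _; set X := expR _.
have x0 : 0 < x by exact: expR_gt0.
have X0 : 0 < X by exact: expR_gt0.
have [s0|s0] := leP 0 s.
  have x1 : 1 <= x by rewrite -expR0 ler_expR mulr_ge0// ltW.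
  have xX : x <= X by rewrite ler_expR ler_piMl// ltW.
  have : (x - 1) ^+ 2 <= (X - 1) ^+ 2 by rewrite ler_pXn2r ?nnegrE ?subr_ge0 ?lerD2r// (le_trans x1).
  have : x * (1 - C) <= X * (1 - C') by apply: ler_pM; rewrite ?subr_ge0 ?lerB// ltW.
  have : 0 <= X * (1 - C') by rewrite mulr_ge0 ?subr_ge0// ltW.
  have := sqr_ge0 (X - 1); nra.
have x1 : x <= 1 by rewrite -expR0 ler_expR pmulr_rle0// ltW.
have Xx : X <= x by rewrite ler_expR ler_nMl// ltW.
have h5 : (x - 1) ^+ 2 <= (X - 1) ^+ 2.
  by rewrite -sqrrN opprB -(sqrrN (X - 1)) opprB ler_pXn2r ?nnegrE ?subr_ge0 ?lerB// (le_trans Xx).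
have h6 : x * (1 - C) <= 1 * (1 - C') by apply: ler_pM; rewrite ?subr_ge0 ?lerB// ltW.
have h7 : 0 <= X * (1 - C') by rewrite mulr_ge0 ?subr_ge0// ltW.
have h8 := sqr_ge0 (X - 1).
have [X2|X2] := leP (1/2) X.
  have : 2^-1 * (1 - C') <= X * (1 - C') by rewrite ler_wpM2r// ?subr_ge0//; lra.
  nra.
have : 4^-1 <= (X - 1) ^+ 2 by nra.
nra.
Qed.

Let K := 17 / c0.
Let K_ge0 : 0 <= K. Proof. by rewrite divr_ge0// ltW. Qed.

Let nsq_N s e : 0 < e <= pi -> nsq (N s e) <= K / (expR (al * s) + lam) ^+ 2.
Proof.
move=> ee; have ee' : 0 <= e <= pi by case/andP: ee => /ltW -> ->.
rewrite /N nsqM nsqV nsqM.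
have hB := nsq_B_gt0 s ee; have hA := nsq_A s ee'; have hAB := nsq_AB s ee'.
have xl : 0 < (expR (al * s) + lam) ^+ 2.
  by rewrite exprn_gt0// addr_gt0// expR_gt0.
have hA0 : 0 < nsq (cexp al s e + lamC) by apply: lt_le_trans hA; rewrite mulr_gt0.
rewrite ler_pdivrMr ?mulr_gt0// /K.
apply: (le_trans hAB); rewrite [leRHS]mulrCA mulrC ler_wpM2l//; first exact: ltW.
rewrite mulrAC ler_pdivlMr// mulrAC ler_pdivlMr//.
by move: hA; rewrite /c0; lra.
Qed.

(** N tends to - 1 / (- lam) = 1 / lam as s tends to -oo, at the rate e^(al s).
    For s <= -1 this is read off the explicit difference, whose denominator
    stays away from 0; for -1 < s <= 0 both terms are merely bounded and the
    factor e^2 compensates for e^(2 al s) >= e^-2. *)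
Let nsq_N_inv s e : 0 < e <= pi -> s <= 0 ->
  nsq (N s e + Complex (- lam^-1) 0) <=
  (4 / (lam ^+ 4 * c0) * (4 * (1 + lam) ^+ 2 + 4 + 2 * lam ^+ 2) +
   (2 * K / lam ^+ 2 + 2 / lam ^+ 2) * expR 2) * expR (al * s) ^+ 2.
Proof.
move=> ee s0; have ee' : 0 <= e <= pi by case/andP: ee => /ltW -> ->.
set K2 := 4 / _ * _; set K3 := _ + 2 / _.
have lam2 : 0 < lam ^+ 2 by rewrite exprn_gt0.
have lam4 : 0 < lam ^+ 4 by rewrite exprn_gt0.
have K20 : 0 <= K2.
  apply: mulr_ge0; last by rewrite !addr_ge0// mulr_ge0// sqr_ge0.
  by rewrite divr_ge0// ltW// mulr_gt0.
have K30 : 0 <= K3.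
  by apply: addr_ge0; apply: divr_ge0; rewrite ?(ltW lam2)// mulr_ge0.
have x0 : 0 < expR (al * s) by exact: expR_gt0.
have x1 : expR (al * s) <= 1 by rewrite -expR0 ler_expR pmulr_rle0.
have [s1|s1] := leP s (-1); last first.
  apply: (@le_trans _ _ K3); last first.
    rewrite mulrDl -[K3 * _ * _]mulrA.
    apply: (@le_trans _ _ (K3 * (expR 2 * expR (al * s) ^+ 2))); last first.
      by rewrite lerDr mulr_ge0// sqr_ge0.
    rewrite ler_peMr// -expRM_natl -expRD -[leLHS]expR0 ler_expR.
    have : -1 <= al * s by move: al0 al1 => ? ?; nra.
    lra.
  apply: (le_trans (nsqD_le _ _)); rewrite /K3 lerD//.
    rewrite -mulrA ler_wpM2l//; apply: (le_trans (nsq_N s ee)).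
    rewrite ler_wpM2l// lef_pV2 ?posrE// ?exprn_gt0 ?addr_gt0//.
    by rewrite ler_pXn2r ?nnegrE ?addr_ge0 ?ltW// ltrDr.
  by rewrite /nsq/= expr0n addr0 sqrrN exprVn.
set X := expR s.
have X0 : 0 < X by exact: expR_gt0.
have Xx : X <= expR (al * s) by rewrite ler_expR; move: al0 al1 => ? ?; nra.
have X2 : X <= 2^-1.
  rewrite /X -[2]/(1 + 1) -lef_pV2 ?posrE ?invr_gt0// invrK -expRN.
  by apply: le_trans (expR_ge1Dx _); lra.
have hB : 4^-1 <= nsq (cexp 1 s e + - 1).
  rewrite nsq_cexpB1 !mul1r -/X.
  have : 0 <= 2 * X * (1 - cos e) by rewrite mulr_ge0 ?subr_ge0 ?cos_le1// mulr_ge0// ltW.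
  by nra.
have hA := nsq_A s ee'.
have hA1 : c0 * lam ^+ 2 <= nsq (cexp al s e + lamC).
  apply: le_trans hA; rewrite ler_wpM2l ?(ltW c0_gt0)//.
  by rewrite ler_pXn2r ?nnegrE ?addr_ge0 ?ltW// ltrDr.
have hA0 : 0 < nsq (cexp al s e + lamC) by apply: lt_le_trans hA1; rewrite mulr_gt0.
have hB0 : 0 < nsq (cexp 1 s e + - 1) by apply: lt_le_trans hB.
apply: (@le_trans _ _ (K2 * expR (al * s) ^+ 2)); last first.
  by rewrite ler_wpM2r ?sqr_ge0// lerDl mulr_ge0// expR_ge0.
have lC0 : lamC != 0 by rewrite /lamC eq_complex/= negb_and gt_eqF.
have E : N s e + Complex (- lam^-1) 0 =
   (cexp al s e * (Complex (1 + lam) 0 - cexp 1 s e) - lamC * cexp 1 s e) *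
   (lamC * ((cexp 1 s e + - 1) * (cexp al s e + lamC)))^-1.
  have -> : Complex (- lam^-1) 0 = - lamC^-1.
    have -> : lamC^-1 = Complex lam^-1 0.
      apply: (mulfI lC0); rewrite mulfV//; apply/eqP.
      have l0 : lam != 0 by rewrite gt_eqF.
      by rewrite eq_complex/=; apply/andP; split; apply/eqP; field.
    by apply/eqP; rewrite eq_complex/= oppr0 !eqxx.
  have -> : Complex (1 + lam) 0 = 1 + lamC.
    by apply/eqP; rewrite eq_complex/= addr0 !eqxx.
  have B0 : cexp 1 s e + - 1 != 0 by rewrite -nsq_gt0.
  have A0 : cexp al s e + lamC != 0 by rewrite -nsq_gt0.
  rewrite /N; move: lC0 A0 B0; move: lamC (cexp al s e) (cexp 1 s e) => l A B l0 A0 B0.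
  by field; rewrite l0 A0 B0.
rewrite E nsqM nsqV !nsqM ler_pdivrMr; last first.
  by rewrite !mulr_gt0// nsq_gt0.
have lC : nsq lamC = lam ^+ 2 by rewrite /nsq/= expr0n addr0.
apply: (@le_trans _ _ ((4 * (1 + lam) ^+ 2 + 4 + 2 * lam ^+ 2) * expR (al * s) ^+ 2)).
  apply: (le_trans (nsqD_le _ _)); rewrite nsqN !nsqM !nsq_cexp mul1r lC -/X.
  have hX2 : X ^+ 2 <= expR (al * s) ^+ 2 by rewrite ler_pXn2r// nnegrE ltW.
  have hX1 : X ^+ 2 <= 1 by nra.
  have h1 : nsq (Complex (1 + lam) 0 - cexp 1 s e) <= 2 * (1 + lam) ^+ 2 + 2.
    apply: (le_trans (nsqD_le _ _)); rewrite nsqN nsq_cexp mul1r -/X.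
    by rewrite {1}/nsq/= expr0n addr0; lra.
  have h2 : expR (al * s) ^+ 2 * nsq (Complex (1 + lam) 0 - cexp 1 s e) <=
      expR (al * s) ^+ 2 * (2 * (1 + lam) ^+ 2 + 2) by rewrite ler_wpM2l ?sqr_ge0.
  have h3 : lam ^+ 2 * X ^+ 2 <= lam ^+ 2 * expR (al * s) ^+ 2 by rewrite ler_wpM2l ?sqr_ge0.
  by move: h2 h3; nra.
rewrite /K2 lC.
set Q := _ + 2 * _; set x2 := expR _ ^+ 2.
have Q0 : 0 <= Q * x2.
  by rewrite mulr_ge0 ?sqr_ge0// !addr_ge0// mulr_ge0// sqr_ge0.
have h : 1 <= 4 / (lam ^+ 4 * c0) * (lam ^+ 2 * (nsq (cexp 1 s e + - 1) * nsq (cexp al s e + lamC))).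
  have D0 : 0 < lam ^+ 4 * c0 by rewrite mulr_gt0.
  rewrite mulrAC (ler_pdivlMr _ _ D0) mul1r.
  have : 4^-1 * (c0 * lam ^+ 2) <= nsq (cexp 1 s e + - 1) * nsq (cexp al s e + lamC).
    by apply: ler_pM => //; rewrite mulr_ge0// ltW.
  move=> h; have -> : lam ^+ 4 * c0 = 4 * (lam ^+ 2 * (4^-1 * (c0 * lam ^+ 2))) by field.
  by rewrite ler_wpM2l// ler_wpM2l// ltW.
set V := lam ^+ 2 * _; have -> : 4 / (lam ^+ 4 * c0) * Q * x2 * V = (Q * x2) * (4 / (lam ^+ 4 * c0) * V) by ring.
by rewrite ler_peMr.
Qed.

Let sqr_le_norm (y k w : R) : 0 <= k -> 0 <= w -> y ^+ 2 <= k * w ^+ 2 ->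
  `|y| <= Num.sqrt k * w.
Proof.
move=> k0 w0 h; rewrite -sqrtr_sqr.
by apply: (le_trans (ler_wsqrtr h)); rewrite sqrtrM// sqrtr_sqr ger0_norm.
Qed.

Let N_bound : exists2 C : R, 0 <= C & forall s e, 0 < e <= pi ->
  [/\ `|Im (N s e)| <= C * expR (- (al * `|s|)),
      0 <= s -> `|Re (N s e)| <= C * expR (- (al * s)) &
      s <= 0 -> `|Re (N s e) - lam^-1| <= C * expR (al * s)].
Proof.
set K5 : R := 4 / (lam ^+ 4 * c0) * (4 * (1 + lam) ^+ 2 + 4 + 2 * lam ^+ 2) +
   (2 * K / lam ^+ 2 + 2 / lam ^+ 2) * expR 2.
have K50 : 0 <= K5.
  have := @nsq_N_inv 0 pi; rewrite pi_gt0 lexx => /(_ isT (lexx _)).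
  by rewrite mulr0 expR0 expr1n mulr1; apply: le_trans; exact: nsq_ge0.
exists (Num.sqrt K + Num.sqrt K5); first by rewrite addr_ge0 ?sqrtr_ge0.
move=> s e ee.
have hpos : 0 <= s -> nsq (N s e) <= K * expR (- (al * s)) ^+ 2.
  move=> s0; apply: (le_trans (nsq_N s ee)); rewrite ler_wpM2l//.
  rewrite expRN exprVn lef_pV2 ?posrE ?exprn_gt0 ?addr_gt0 ?expR_gt0//.
  by rewrite ler_pXn2r ?nnegrE ?addr_ge0 ?expR_ge0 ?(ltW lam0)// lerDl ltW.
have hneg (s0 : s <= 0) : nsq (N s e + Complex (- lam^-1) 0) <= K5 * expR (al * s) ^+ 2.
  exact: nsq_N_inv ee s0.
have w1 (a c : R) : 0 <= c -> a <= Num.sqrt K * c -> a <= (Num.sqrt K + Num.sqrt K5) * c.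
  by move=> c0' h; apply: (le_trans h); rewrite ler_wpM2r// lerDl sqrtr_ge0.
have w2 (a c : R) : 0 <= c -> a <= Num.sqrt K5 * c -> a <= (Num.sqrt K + Num.sqrt K5) * c.
  by move=> c0' h; apply: (le_trans h); rewrite ler_wpM2r// lerDr sqrtr_ge0.
split.
- have [s0|s0] := leP 0 s.
    rewrite (ger0_norm s0); apply: w1; rewrite ?expR_ge0//.
    apply: sqr_le_norm; rewrite ?expR_ge0//.
    exact: le_trans (Im_sqr_le _) (hpos s0).
  rewrite (ltr0_norm s0) mulrN opprK; apply: w2; rewrite ?expR_ge0//.
  apply: sqr_le_norm; rewrite ?expR_ge0//.
  apply: le_trans (hneg (ltW s0)).
  by have := Im_sqr_le (N s e + Complex (- lam^-1) 0); rewrite ImC_D addr0.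
- move=> s0; apply: w1; rewrite ?expR_ge0//; apply: sqr_le_norm; rewrite ?expR_ge0//.
  exact: le_trans (Re_sqr_le _) (hpos s0).
- move=> s0; apply: w2; rewrite ?expR_ge0//; apply: sqr_le_norm; rewrite ?expR_ge0//.
  apply: le_trans (hneg s0).
  by have := Re_sqr_le (N s e + Complex (- lam^-1) 0); rewrite ReC_D.
Qed.

(** The lowest singularities above the real axis are the zero of e^w - 1 at
    2 pi i and the zero of e^(al w) + lam at height pi / al. *)
Let H : R := Num.min (2 * pi) (pi / al).

Let pi_lt_H : pi < H.
Proof.
rewrite /H lt_min; apply/andP; split.
  by rewrite ltr_pMl ?pi_gt0// ltr1n.
by rewrite ltr_pdivlMr// gtr_pMr// pi_gt0.
Qed.

Let H_den s e : 0 < e < H -> den_neq0 s e.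
Proof.
rewrite /H lt_min => /andP[e0 /andP[e2pi epial]].
have ale : 0 < al * e < pi by rewrite mulr_gt0//= mulrC -ltr_pdivlMr.
rewrite /den_neq0 mulf_neq0//; last first.
  rewrite -nsq_gt0 /nsq; apply: ltr_wpDl; first exact: sqr_ge0.
  rewrite exprn_gt0// ImC_D /= addr0 mulr_gt0 ?expR_gt0//.
  exact: sin_gt0_pi.
rewrite -nsq_gt0; have [epi|epi] := leP e pi; first by apply: nsq_B_gt0; rewrite e0.
rewrite nsq_cexpB1 ltr_wpDl ?sqr_ge0// mulr_gt0 ?mulr_gt0 ?expR_gt0//.
rewrite subr_gt0 mul1r.
have -> : cos e = cos (2 * pi - e).
  by rewrite mulr_natl addrC cosD2pi cosN.
rewrite -[ltRHS]cos0 ltr_cos ?in_itv/= ?lexx ?pi_ge0//; first by rewrite subr_gt0.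
by rewrite subr_ge0 (ltW e2pi)/= mulr_natl mulr2n; lra.
Qed.

Let Im_continuous (f : R -> R -> R[i]) s e : jcont f s e ->
  {for s, continuous (fun s => Im (f s e))}.
Proof.
move=> [_ c]; apply: (@continuous_comp _ _ _ (fun s => (s, e)) (fun p : R * R => Im (f p.1 p.2))).
  move=> A [[P Q] [/= sP eQ] PQ]; apply: filterS sP => x Px; apply: PQ; split => //=.
  exact: nbhs_singleton.
exact: c.
Qed.

Let slice_continuous (g : R[i] -> R) (f : R -> R -> R[i]) s e :
  continuous_at (s, e) (fun p : R * R => g (f p.1 p.2)) ->
  {for e, continuous (fun e => g (f s e))}.
Proof.
move=> c; apply: (@continuous_comp _ _ _ (fun e => (s, e)) (fun p : R * R => g (f p.1 p.2))).
  move=> A [[P Q] [/= sP eQ] PQ]; apply: filterS eQ => x Px; apply: PQ; split => //=.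
  exact: nbhs_singleton.
exact: c.
Qed.

(** The lower edge is lifted to the height 1 / (n + 1) to avoid the point w = 0,
    where the quotient defining N has the form 0 / 0. *)
Let contour (n : nat) :
  \int[mu]_(s in `[(- n.+1%:R), n.+1%:R]) Im (N s pi) -
  \int[mu]_(s in `[(- n.+1%:R), n.+1%:R]) Im (N s n.+1%:R^-1) =
  \int[mu]_(e in `[n.+1%:R^-1, pi]) (Re (N n.+1%:R e) - Re (N (- n.+1%:R) e)).
Proof.
have n0 : (0 : R) < n.+1%:R by rewrite ltr0n.
apply: (@rectangle_integral _ (fun s e => Re (N s e)) (fun s e => Im (N s e))
  (fun s e => Re (N' s e)) (- n.+1%:R) n.+1%:R 0 H).
- by rewrite gtrN.
- by move=> s e _ /(H_den s) /N_holo[].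
- by move=> s e _ /(H_den s) /N_holo[].
- by move=> s e _ /(H_den s) /N_jcont[c _]; exact: slice_continuous c.
- by move=> s e _ /(H_den s) /N_jcont; exact: Im_continuous.
- by move=> s e _ /(H_den s) /N'_jcont[].
- by rewrite invr_gt0.
- rewrite (@le_lt_trans _ _ 1)//; first by rewrite invf_le1// ler1n.
  by rewrite (lt_le_trans _ (pi_ge2 _))// ltr1n.
- exact: pi_lt_H.
Qed.

Let N_measurable e : 0 < e < H -> measurable_fun setT (fun s => Im (N s e)).
Proof.
move=> ee; apply: continuous_measurable_fun => s.
by apply: Im_continuous; apply: N_jcont; exact: H_den.
Qed.

Let En_gt0 (n : nat) : (0 : R) < n.+1%:R^-1. Proof. by rewrite invr_gt0. Qed.

Let En_pi (n : nat) : (n.+1%:R^-1 : R) < pi.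
Proof.
rewrite (@le_lt_trans _ _ 1)//; first by rewrite invf_le1// ler1n.
by rewrite (lt_le_trans _ (pi_ge2 _))// ltr1n.
Qed.

Let En_cvg0 : (n.+1%:R^-1 : R) @[n --> \oo] --> (0 : R).
Proof. exact: cvg_harmonic. Qed.

Let N_real s : Im (N s 0) = 0.
Proof.
have I0 c : Im (cexp c s 0) = 0 :> R by rewrite /= mulr0 sin0 mulr0.
by rewrite /N ImC_M ImC_V ImC_M !ImC_D !I0 /= !(addr0, oppr0, mulr0, mul0r).
Qed.

(** N is real on the real axis. *)
Let bottom_cvg0 : \int[mu]_(s in `[(- n.+1%:R), n.+1%:R]) Im (N s n.+1%:R^-1)
  @[n --> \oo] --> (0 : R).
Proof.
have [C C0 HC] := N_bound.
have -> : (0 : R) = \int[mu]_(s in setT) (fun=> 0 : R) s.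
  by rewrite Rintegral_cst// mul0r.
apply: (proj2 (@truncated_dominated_convergence _ (fun n s => Im (N s n.+1%:R^-1)) (fun=> 0)
   (fun s => C * expR (- (al * `|s|))) _ _ _ _ _)).
- by move=> n; apply: N_measurable; rewrite En_gt0 (lt_trans (En_pi n)) ?pi_lt_H.
- by [].
- exists [set 0]; split; [exact: measurable_set1|exact: lebesgue_measure_set1|].
  move=> s /= sn; apply: contrapT => s0; apply: sn.
  have d0 : den_neq0 s 0.
    rewrite /den_neq0 mulf_neq0//; last first.
      rewrite -nsq_gt0; apply: lt_le_trans (nsq_A s _); last by rewrite lexx pi_ge0.
      by rewrite mulr_gt0// exprn_gt0// addr_gt0// expR_gt0.
    rewrite -nsq_gt0 nsq_cexpB1 mulr0 cos0 subrr mulr0 addr0 mul1r.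
    rewrite lt_neqAle sqr_ge0 andbT eq_sym sqrf_eq0 subr_eq0 -expR0.
    by apply/negP => /eqP /expR_inj /s0.
  have [_ c] := N_jcont d0.
  have := slice_continuous c; rewrite /prop_for /continuous_at N_real => c'.
  exact: (cvg_comp _ _ En_cvg0 c').
- by apply: integrable_mull => //; exact: integrable_expRN_norm.
- move=> n s; have [|//] := HC s n.+1%:R^-1.
  by rewrite En_gt0 ltW.
Qed.

Let top_cvg : mu.-integrable setT (EFin \o (fun s => Im (N s pi))) /\
  \int[mu]_(s in `[(- n.+1%:R), n.+1%:R]) Im (N s pi) @[n --> \oo] -->
  \int[mu]_s Im (N s pi).
Proof.
have [C C0 HC] := N_bound.
apply: (@truncated_dominated_convergence _ (fun n s => Im (N s pi)) _
   (fun s => C * expR (- (al * `|s|)))).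
- by move=> n; apply: N_measurable; rewrite pi_gt0 pi_lt_H.
- by apply: N_measurable; rewrite pi_gt0 pi_lt_H.
- by apply: aeW => s; exact: cvg_cst.
- by apply: integrable_mull => //; exact: integrable_expRN_norm.
- by move=> n s; have [|//] := HC s pi; rewrite pi_gt0 lexx.
Qed.

(** N tends to 0 on the right side and to 1 / lam on the left side, both of
    length tending to pi. *)
Let side_cvg :
  \int[mu]_(e in `[n.+1%:R^-1, pi]) (Re (N n.+1%:R e) - Re (N (- n.+1%:R) e))
  @[n --> \oo] --> - (pi / lam).
Proof.
have [C C0 HC] := N_bound.
pose r n := \int[mu]_(e in `[n.+1%:R^-1, pi]) (Re (N n.+1%:R e) - Re (N (- n.+1%:R) e)).
have cN s n : {within `[n.+1%:R^-1, pi], continuous (fun e => Re (N s e))}.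
  apply/subspace_continuousP => e /=; rewrite in_itv/= => /andP[h1 h2].
  apply: cvg_within_filter.
  have ee : 0 < e < H by rewrite (lt_le_trans _ h1)// (le_lt_trans h2).
  by have [c _] := N_jcont (H_den s ee); exact: (slice_continuous c).
have iN s n : mu.-integrable `[n.+1%:R^-1, pi] (EFin \o (fun e => Re (N s e))).
  by apply: continuous_compact_integrable; [exact: segment_compact|exact: cN].
have icst n (c : R) : mu.-integrable `[n.+1%:R^-1, pi] (EFin \o (fun=> c)).
  apply: (integrable_bounded (M := `|c|)) => //; exact: lebesgue_itv_lty.
have rB n : `|r n + (pi - n.+1%:R^-1) / lam| <= 2 * C * pi * expR (- (al * n.+1%:R)).
  have -> : r n + (pi - n.+1%:R^-1) / lam =
    \int[mu]_(e in `[n.+1%:R^-1, pi]) (Re (N n.+1%:R e) - Re (N (- n.+1%:R) e) + lam^-1).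
    rewrite RintegralD//; last first.
      by apply: integrable_subr => //; exact: iN.
    rewrite Rintegral_cst//= lebesgue_measure_itv/= lte_fin En_pi/=.
    by rewrite /r mulrC.
  have n0 : (0 : R) < n.+1%:R by [].
  have il : mu.-integrable `[n.+1%:R^-1, pi]
    (EFin \o (fun e => Re (N n.+1%:R e) - Re (N (- n.+1%:R) e) + lam^-1)).
    by apply: integrable_addr => //; apply: integrable_subr => //; exact: iN.
  apply: (@le_trans _ _ (\int[mu]_(e in `[n.+1%:R^-1, pi]) (2 * C * expR (- (al * n.+1%:R))))).
    apply: le_norm_Rintegral => //.
    move=> e eI; have /andP[h1 h2] : n.+1%:R^-1 <= e <= pi by move: eI; rewrite /= in_itv.
    have ee : 0 < e <= pi by rewrite (lt_le_trans _ h1).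
    have [_ /(_ (ltW n0)) H1 _] := HC n.+1%:R e ee.
    have [_ _] := HC (- n.+1%:R) e ee; rewrite oppr_le0 => /(_ (ltW n0)).
    rewrite mulrN => H2.
    have -> : Re (N n.+1%:R e) - Re (N (- n.+1%:R) e) + lam^-1 =
      Re (N n.+1%:R e) - (Re (N (- n.+1%:R) e) - lam^-1) by ring.
    apply: (le_trans (ler_normB _ _)); apply: (le_trans (lerD H1 H2)).
    by rewrite -mulrA mulr_natl mulr2n.
  rewrite Rintegral_cst//= lebesgue_measure_itv/= lte_fin En_pi/=.
  rewrite mulrAC ler_wpM2r ?expR_ge0// ler_wpM2l ?mulr_ge0//.
  by rewrite gerBl ltW.
have ce : expR (- (al * n.+1%:R)) @[n --> \oo] --> (0 : R).
  have h : (fun n : nat => n.+1%:R : R) @ \oo --> +oo.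
    by have := @cvgr_idn R; rewrite -(cvg_shiftn 1); under eq_fun do rewrite addn1.
  exact: (cvg_comp _ _ h (cvg_expRN_scale al0)).
have c1 : r n + (pi - n.+1%:R^-1) / lam @[n --> \oo] --> (0 : R).
  apply/norm_cvg0P; apply: (@squeeze_cvgr _ _ _ _ (fun=> 0)
     (fun n => 2 * C * pi * expR (- (al * n.+1%:R)))).
  - by apply: nearW => n; rewrite normr_ge0 rB.
  - exact: cvg_cst.
  - by rewrite -[X in _ --> X](mulr0 (2 * C * pi)); apply: cvgMr.
have c2 : (pi - n.+1%:R^-1) / lam @[n --> \oo] --> (pi - 0) / lam.
  by apply: cvgMl; apply: cvgB; [exact: cvg_cst|exact: En_cvg0].
have : (r n + (pi - n.+1%:R^-1) / lam) - (pi - n.+1%:R^-1) / lam @[n --> \oo] -->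
    0 - (pi - 0) / lam by apply: cvgB.
by rewrite subr0 sub0r; under eq_fun do rewrite addrK.
Qed.

Let top_value : \int[mu]_s Im (N s pi) = - (pi / lam).
Proof.
have [_ ct] := top_cvg.
have c : \int[mu]_(s in `[(- n.+1%:R), n.+1%:R]) Im (N s pi) -
  \int[mu]_(s in `[(- n.+1%:R), n.+1%:R]) Im (N s n.+1%:R^-1) @[n --> \oo] -->
  \int[mu]_s Im (N s pi) - 0.
  by apply: cvgB; [exact: ct|exact: bottom_cvg0].
have : (fun n => \int[mu]_(s in `[(- n.+1%:R), n.+1%:R]) Im (N s pi) -
  \int[mu]_(s in `[(- n.+1%:R), n.+1%:R]) Im (N s n.+1%:R^-1)) @ \oo --> - (pi / lam).
  by under eq_fun do rewrite contour; exact: side_cvg.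
move=> /cvg_lim <-//; rewrite -[LHS]subr0.
by apply/esym/cvg_lim.
Qed.

(** At z = r^al this is the density, with respect to dr / r, of the measure whose
    Laplace transform is t |-> E_al(- t^al). *)
Definition ml_kernel (z : R) : R :=
  sin (pi * al) / pi * (z / (1 + 2 * z * cos (pi * al) + z ^+ 2)).

Let N_top s : Im (N s pi) =
  - ((1 + lam) * (pi / lam)) * (ml_kernel (expR (al * s) / lam) / (1 + expR s)).
Proof.
have := nsq_A s (e := pi); rewrite lexx pi_ge0 => /(_ isT) hA.
have xl : 0 < expR (al * s) + lam by rewrite addr_gt0// expR_gt0.
have {hA} D0 : 0 < nsq (cexp al s pi + lamC).
  by apply: lt_le_trans hA; rewrite mulr_gt0// exprn_gt0.
have DE := nsq_cexpD al s pi lam.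
rewrite /N ImC_M ReC_V ImC_V nsqM ReC_M ImC_M !ReC_D !ImC_D -/lamC.
rewrite /ml_kernel (mulrC pi al).
have -> : nsq (cexp 1 s pi + - 1) = (1 + expR s) ^+ 2.
  by rewrite nsq_cexpB1 !mul1r cospi; ring.
move: D0; rewrite DE /cexp /= !mul1r cospi sinpi.
have X0 : 0 < expR s by exact: expR_gt0.
have := cos2Dsin2 (al * pi).
move: (expR s) X0 (expR (al * s)) (cos (al * pi)) (sin (al * pi)) => X X0 x c w cw D0.
have D1 : (lam + 2 * x * c) * lam + x ^+ 2 != 0.
  by rewrite gt_eqF//; move: D0; congr (0 < _); ring.
have l0 : lam != 0 by rewrite gt_eqF.
have X1 : 1 + X != 0 by rewrite gt_eqF// addr_gt0.
have p0 : pi != 0 :> R by rewrite gt_eqF// pi_gt0.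
move: (pi : R) p0 => P p0.
by field; rewrite X1 l0 D1 p0.
Qed.

(** The value is that of the top edge, by [top_value] and [N_top]. *)
Lemma stieltjes_ml_kernel :
  mu.-integrable setT (EFin \o (fun s => ml_kernel (expR (al * s) / lam) / (1 + expR s))) /\
  \int[mu]_s (ml_kernel (expR (al * s) / lam) / (1 + expR s)) = (1 + lam)^-1.
Proof.
pose k := - ((1 + lam) * (pi / lam)).
have k0 : k != 0.
  by rewrite oppr_eq0 mulf_neq0// gt_eqF ?addr_gt0 ?divr_gt0 ?pi_gt0.
have E s : ml_kernel (expR (al * s) / lam) / (1 + expR s) = k^-1 * Im (N s pi).
  by rewrite N_top -/k mulKf.
have [iN _] := top_cvg.
split.
  rewrite (_ : EFin \o _ = EFin \o (fun s => k^-1 * Im (N s pi))).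
    exact: integrable_mull.
  by apply/funext => s /=; rewrite E.
under eq_Rintegral do rewrite E.
rewrite RintegralZl// top_value /k.
have p0 : pi != 0 :> R by rewrite gt_eqF// pi_gt0.
have l0 : lam != 0 by rewrite gt_eqF.
have l1 : 1 + lam != 0 by rewrite gt_eqF// addr_gt0.
move: (pi : R) p0 => P p0.
by field; rewrite l1 l0 p0.
Qed.

End stieltjes.

(** * The Gamma function and Laplace transforms of powers *)

Section line_integrals.
Context (R : realType).
Notation mu := (@lebesgue_measure R).

Lemma Rintegral_shift (f : R -> R) (a : R) : continuous f ->
  (forall x, 0 <= f x) -> \int[mu]_s f s = \int[mu]_s f (s + a).
Proof.
move=> cf f0; rewrite /Rintegral; congr fine.
have dS (x : R) : is_derive x 1 (fun s => s + a) 1.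
  by apply: is_derive_eq; rewrite addr0.
have dE : derive1 (fun s : R => s + a) = fun=> 1.
  by apply/funext => x; rewrite derive1E (@derive_val _ _ _ _ _ _ _ (dS x)).
rewrite (@increasing_ge0_integration_by_substitutionT _ (fun s => s + a) f).
- by apply: eq_integral => x _; rewrite dE /= mulr1.
- by move=> x y; rewrite ltrD2r.
- by rewrite dE; exact: cst_continuous.
- by rewrite dE; exact: is_cvg_cst.
- by rewrite dE; exact: is_cvg_cst.
- by move=> x; have [] := dS x.
- exact: cvg_addrr_Ny.
- exact: cvg_addrr.
- exact: cf.
- exact: f0.
Qed.

End line_integrals.

Section gamma.
Context (R : realType).
Notation mu := (@lebesgue_measure R).

Lemma continuous_powR_gt0 (s x : R) : 0 < x -> {for x, continuous (fun y => y `^ s)}.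
Proof.
move=> x0; apply: differentiable_continuous; apply/derivable1_diffP.
by apply: derivable_powR; rewrite in_itv/= x0.
Qed.

Let term (s p : R) (x : R) := x `^ s * expR (- (p * x)).

Let continuous_exp (p : R) : continuous (fun x => expR (- (p * x))).
Proof.
move=> x; apply: (@continuous_comp _ _ _ (fun x => - (p * x)) expR); last exact: continuous_expR.
by apply: cvgN; apply: cvgMr; exact: cvg_id.
Qed.

Let continuous_term s p : 0 <= s -> {within `[0, +oo[, continuous (term s p)}.
Proof.
move=> s0; apply/continuous_within_itvcyP; split.
  move=> x; rewrite in_itv/= andbT => x0.
  by apply: cvgM; [exact: continuous_powR_gt0|exact: continuous_exp].
apply: cvgM; last by apply: cvg_at_right_filter; exact: continuous_exp.
have [->|sn0] := eqVneq s 0.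
  by rewrite powRr0; under eq_fun do rewrite powRr0; exact: cvg_cst.
by rewrite powR0//; apply: powR_cvg0; rewrite lt_neqAle eq_sym sn0.
Qed.

Let measurable_term s p D : measurable_fun D (term s p).
Proof.
apply: measurable_funTS; apply: measurable_funM; first exact: measurable_powR.
by apply: continuous_measurable_fun; exact: continuous_exp.
Qed.

Lemma integrable_expRN (c : R) : 0 < c ->
  mu.-integrable `]0, +oo[ (EFin \o (fun x => expR (- (c * x)))).
Proof.
move=> c0.
have H : mu.-integrable `]0, +oo[ (EFin \o (fun x => expR (- (c * `|x|)))).
  by apply: (@integrableS _ _ _ mu setT) => //; exact: integrable_expRN_norm.
apply: (@integrable_le _ _ _ mu _ _ (fun x => expR (- (c * `|x|)))) => //.
- by apply: measurable_funTS; apply: continuous_measurable_fun; exact: continuous_exp.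
- move=> x /=; rewrite in_itv/= andbT => x0.
  by rewrite ger0_norm ?expR_ge0// gtr0_norm.
Qed.

Lemma Rintegral_expRN (c : R) : 0 < c ->
  \int[mu]_(x in `]0, +oo[) expR (- (c * x)) = c^-1.
Proof.
move=> c0; rewrite Rintegral_itv_obnd_cbnd ?integrable_expRN//.
by rewrite /Rintegral integral_expRN.
Qed.

Let powR_le_exp (s p x : R) : 0 <= s -> 0 < p -> 0 < x ->
  x `^ s <= expR (- (s * ln (p / (s + 1)))) * expR (p * x).
Proof.
move=> s0 p0 x0; rewrite -expRD /powR gt_eqF// ler_expR.
have s1 : 0 < s + 1 by rewrite ltr_wpDl.
have c0 : 0 < p / (s + 1) by rewrite divr_gt0.
have cE : s * (p / (s + 1)) <= p.
  by rewrite mulrCA ler_piMr// ?(ltW p0)// ler_pdivrMr// mul1r lerDl.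
move: (p / (s + 1)) c0 cE => c c0 cE.
have := ltW (ln_sublinear (mulr_gt0 c0 x0)).
rewrite (lnM c0 x0) => h.
have : s * ln x <= s * (c * x - ln c) by rewrite ler_wpM2l// lerBrDl.
move/le_trans; apply; rewrite mulrBr addrC lerD2l mulrA.
by rewrite ler_wpM2r ?(ltW x0).
Qed.

Lemma integrable_gamma (s p : R) : 0 <= s -> 0 < p ->
  mu.-integrable `]0, +oo[ (EFin \o (fun x => x `^ s * expR (- (p * x)))).
Proof.
move=> s0 p0; have p2 : 0 < p / 2 by rewrite divr_gt0.
apply: (@integrable_le _ _ _ mu _ _ (fun x => expR (- (s * ln ((p / 2) / (s + 1)))) * expR (- ((p / 2) * x)))) => //.
- exact: measurable_term.
- move=> x /=; rewrite in_itv/= andbT => x0.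
  rewrite ger0_norm ?mulr_ge0 ?powR_ge0 ?expR_ge0//.
  apply: le_trans (ler_wpM2r (expR_ge0 _) (powR_le_exp s0 p2 x0)) _.
  by rewrite -!expRD ler_expR; lra.
- by apply: integrable_mull => //; exact: integrable_expRN.
Qed.

Lemma GammaE (s : R) : Gamma (s + 1) = \int[mu]_(x in `]0, +oo[) (x `^ s * expR (- (1 * x))).
Proof. by rewrite /Gamma addrK; apply: eq_Rintegral => x _; rewrite mul1r. Qed.

(** The integral is at least its part over ]T, T + 1], where the integrand is at
    least T^s e^-(T+1).  As T is free, this beats every geometric growth in s. *)
Lemma Gamma_ge (s T : R) : 0 <= s -> 0 < T -> T `^ s * expR (- (T + 1)) <= Gamma (s + 1).
Proof.
move=> s0 T0; rewrite GammaE.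
have TT : T < T + 1 by rewrite ltrDl.
set k := _ * _.
have k0 : 0 <= k by rewrite mulr_ge0 ?powR_ge0 ?expR_ge0.
have E : k = \int[mu]_(x in `]0, +oo[) (\1_(`]T, T + 1]%classic) x * k).
  rewrite -(@Rintegral_restrict_sub _ _ _ mu)//; last first.
    by move=> x /=; rewrite !in_itv/= andbT => /andP[Tx _]; exact: lt_trans Tx.
  by rewrite Rintegral_cst//= lebesgue_measure_itv/= lte_fin TT/= addrAC subrr add0r mulr1.
rewrite [leLHS]E; apply: le_Rintegral => //.
- apply: (@integrableS _ _ _ mu setT) => //.
  rewrite (_ : EFin \o _ = EFin \o (fun x => k * \1_(`]T, T + 1]%classic) x)).
    by apply: integrable_mull => //; exact: integrable_indic_itv.
  by apply/funext => x /=; rewrite mulrC.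
- exact: integrable_gamma.
- move=> x /=; rewrite in_itv/= andbT => x0; rewrite indicE.
  case: (boolP (x \in _)) => [|_]; last by rewrite mul0r mulr_ge0 ?powR_ge0 ?expR_ge0.
  rewrite inE/= in_itv/= => /andP[Tx xT]; rewrite /k !mul1r.
  apply: ler_pM; rewrite ?powR_ge0 ?expR_ge0//.
    by apply: ge0_ler_powR => //; rewrite ?nnegrE ?ltW.
  by rewrite ler_expR lerN2.
Qed.

Lemma Gamma_gt0 (s : R) : 0 <= s -> 0 < Gamma (s + 1).
Proof.
move=> s0; apply: lt_le_trans (Gamma_ge s0 ltr01).
by rewrite mulr_gt0 ?powR_gt0 ?expR_gt0.
Qed.

Lemma laplace_powR (s p : R) : 0 <= s -> 0 < p ->
  \int[mu]_(x in `]0, +oo[) (x `^ s * expR (- (p * x))) = Gamma (s + 1) / p `^ (s + 1).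
Proof.
move=> s0 p0; rewrite GammaE.
have dM (x : R) : is_derive x 1 (fun x => p * x) p.
  by apply: is_derive_eq; rewrite /GRing.scale/= mulr1.
have dE : derive1 (fun x : R => p * x) = fun=> p.
  by apply/funext => x; rewrite derive1E (@derive_val _ _ _ _ _ _ _ (dM x)).
have -> : \int[mu]_(x in `]0, +oo[) (x `^ s * expR (- (1 * x))) =
    \int[mu]_(x in `]0, +oo[) (p `^ (s + 1) * (x `^ s * expR (- (p * x)))).
  rewrite /Rintegral; congr fine.
  rewrite !integral_itv_obnd_cbnd; last first.
    apply/measurable_EFinP; exact: measurable_term.
  apply/measurable_EFinP; apply: measurable_funM => //; exact: measurable_term.
  rewrite -{1}(mulr0 p).
  rewrite (@increasing_ge0_integration_by_substitutiony _ (fun x => p * x) (term s 1)).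
  - apply: eq_integral => x; rewrite inE/= in_itv/= andbT => x0; congr EFin.
    rewrite [LHS](_ : _ = term s 1 (p * x) * derive1 (fun x : R => p * x) x)//.
    rewrite dE /term mul1r powRM ?(ltW p0)// powRD ?(gt_eqF (ltr_wpDl s0 ltr01)) ?implybT//.
    by rewrite powRr1 ?(ltW p0)//; ring.
  - by move=> x y _ _ xy; rewrite ltr_pM2l.
  - by rewrite dE => x _; exact: cst_continuous.
  - by rewrite dE; exact: is_cvg_cst.
  - by rewrite dE; exact: is_cvg_cst.
  - split; first by move=> x _; have [] := dM x.
    by apply: cvg_at_right_filter; apply: cvgMr; exact: cvg_id.
  - exact: gt0_cvgMry.
  - by rewrite mulr0; exact: continuous_term.
  - by move=> x _; rewrite mulr_ge0 ?powR_ge0 ?expR_ge0.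
rewrite RintegralZl//; last exact: integrable_gamma.
by rewrite mulrC mulKf// gt_eqF// powR_gt0.
Qed.

End gamma.

(** * The integral representation of the Mittag-Leffler function *)

Section ml_kernel_bounds.
Context (R : realType).
Implicit Types al z s : R.

Lemma ml_den_ge al z : 0 <= z ->
  (1 + cos (pi * al)) / 2 * (1 + z) ^+ 2 <= 1 + 2 * z * cos (pi * al) + z ^+ 2.
Proof.
move=> z0; rewrite -subr_ge0.
have := cos_le1 (pi * al); set c := cos _ => c1.
have -> : 1 + 2 * z * c + z ^+ 2 - (1 + c) / 2 * (1 + z) ^+ 2 =
   (1 - c) / 2 * (1 - z) ^+ 2 by field.
by rewrite mulr_ge0 ?sqr_ge0// divr_ge0// subr_ge0.
Qed.

Lemma ml_den_gt0 al z : 0 < al < 1 -> 0 <= z ->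
  0 < 1 + 2 * z * cos (pi * al) + z ^+ 2.
Proof.
move=> a01 z0; apply: lt_le_trans (ml_den_ge _ z0).
by rewrite mulr_gt0 ?half_cos_gt0// exprn_gt0// ltr_wpDr.
Qed.

Lemma sin_pi_ratio al : 0 < al < 1 -> 0 < sin (pi * al) / pi <= 1.
Proof.
move=> /andP[al0 al1]; rewrite divr_gt0 ?pi_gt0 ?sin_gt0_pi//=; last first.
  by rewrite mulr_gt0 ?pi_gt0//= gtr_pMr ?pi_gt0.
rewrite ler_pdivrMr ?pi_gt0// mul1r (le_trans (sin_le1 _))//.
by rewrite (le_trans _ (pi_ge2 _))// ler1n.
Qed.

Lemma ml_kernel_ge0 al z : 0 < al < 1 -> 0 <= z -> 0 <= ml_kernel al z.
Proof.
move=> a01 z0; have /andP[/ltW h _] := sin_pi_ratio a01.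
by rewrite /ml_kernel mulr_ge0// divr_ge0// ltW// ml_den_gt0.
Qed.

Lemma ratio_exp_le (x : R) : expR x / (1 + expR x) ^+ 2 <= expR (- `|x|).
Proof.
have e0 := expR_gt0 x; have d0 : 0 < (1 + expR x) ^+ 2.
  by rewrite exprn_gt0// addr_gt0.
rewrite ler_pdivrMr//; have [x0|x0] := leP 0 x.
  rewrite ger0_norm// expRN.
  rewrite -[leLHS](mulKf (lt0r_neq0 e0)) ler_wpM2l ?invr_ge0 ?(ltW e0)//.
  by rewrite -expr2 lerXn2r ?nnegrE ?addr_ge0// ?(ltW e0)// lerDr.
rewrite ltr0_norm// opprK ler_peMr// ?(ltW e0)// exprn_ege1//.
by rewrite lerDl ltW.
Qed.

(** The denominator is at least a multiple of (1 + z)^2, so the kernel decays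
    like z at 0 and like 1 / z at infinity: exponentially on both sides in the
    logarithmic variable. *)
Lemma ml_kernel_le al (x : R) : 0 < al < 1 ->
  ml_kernel al (expR x) <= ((1 + cos (pi * al)) / 2)^-1 * expR (- `|x|).
Proof.
move=> a01; rewrite /ml_kernel.
have /andP[h0 h1] := sin_pi_ratio a01; have c0 := half_cos_gt0 a01.
have x0 := expR_gt0 x; have D := ml_den_ge al (ltW x0).
have D0 := ml_den_gt0 a01 (ltW x0).
apply: (@le_trans _ _ (expR x / (1 + 2 * expR x * cos (pi * al) + expR x ^+ 2))).
  by rewrite ler_piMl// divr_ge0// ltW.
apply: (@le_trans _ _ (((1 + cos (pi * al)) / 2)^-1 * (expR x / (1 + expR x) ^+ 2))).
  have S0 : 0 < (1 + expR x) ^+ 2 by rewrite exprn_gt0// addr_gt0.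
  rewrite mulrCA ler_wpM2l ?(ltW x0)// -invfM lef_pV2 ?posrE// mulr_gt0//.
by rewrite ler_wpM2l ?ratio_exp_le// invr_ge0 ltW.
Qed.

Lemma continuous_ml_kernel_exp al (c d : R) : 0 < al < 1 -> 0 <= d ->
  continuous (fun s => ml_kernel al (expR (c * s) * d)).
Proof.
move=> a01 d0 s; rewrite /ml_kernel.
have ce : {for s, continuous (fun s => expR (c * s) * d)}.
  apply: cvgM; last exact: cvg_cst.
  apply: (@continuous_comp _ _ _ (fun x => c * x) expR); last exact: continuous_expR.
  by apply: cvgMr; exact: cvg_id.
apply: cvgM; first exact: cvg_cst.
apply: cvgM; first exact: ce.
apply: cvgV.
  by rewrite gt_eqF// ml_den_gt0// mulr_ge0// expR_ge0.
apply: cvgD; last by apply: cvgM; exact: ce.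
apply: cvgD; first exact: cvg_cst.
by apply: cvgM; [apply: cvgM; [exact: cvg_cst|exact: ce]|exact: cvg_cst].
Qed.

End ml_kernel_bounds.

Section laplace_of_kernel.
Context (R : realType).
Notation mu := (@lebesgue_measure R).
Variable al : R.
Hypothesis al01 : 0 < al < 1.

Let g (s : R) := ml_kernel al (expR (al * s)).

Let g_ge0 s : 0 <= g s. Proof. by rewrite ml_kernel_ge0// expR_ge0. Qed.

Let g_cont : continuous g.
Proof.
have -> : g = fun s => ml_kernel al (expR (al * s) * 1).
  by apply/funext => s; rewrite mulr1.
exact: continuous_ml_kernel_exp.
Qed.

Let C := ((1 + cos (pi * al)) / 2)^-1.

Let g_le s : g s <= C * expR (- (al * `|s|)).
Proof.
have /andP[al0 _] := al01.
by rewrite -[al in al * `|s|](gtr0_norm al0) -normrM ml_kernel_le.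
Qed.

Let g_integrable : mu.-integrable setT (EFin \o g).
Proof.
have /andP[al0 _] := al01.
apply: (@integrable_le _ _ _ mu _ _ (fun s => C * expR (- (al * `|s|)))) => //.
- exact: continuous_measurable_fun.
- by move=> s _; rewrite ger0_norm.
- by apply: integrable_mull => //; exact: integrable_expRN_norm.
Qed.

Let dexp (t : R) (s : R) := expR (- (t * expR s)).

Let dexp_ge0 t s : 0 <= dexp t s. Proof. exact: expR_ge0. Qed.

Let dexp_cont t : continuous (dexp t).
Proof.
move=> s; apply: (@continuous_comp _ _ _ (fun s => - (t * expR s)) expR); last exact: continuous_expR.
by apply: cvgN; apply: cvgMr; exact: continuous_expR.
Qed.

Let F (t : R) := \int[mu]_s (g s * dexp t s).

Let g_dexp_le t s : 0 <= t -> `|g s * dexp t s| <= g s.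
Proof.
move=> t0; have h : 0 <= g s * dexp t s by exact: mulr_ge0.
rewrite ger0_norm//; apply: ler_piMr => //; rewrite /dexp -[leRHS]expR0 ler_expR.
by rewrite oppr_le0 mulr_ge0// expR_ge0.
Qed.

Let g_dexp_integrable t : 0 <= t -> mu.-integrable setT (EFin \o (fun s => g s * dexp t s)).
Proof.
move=> t0; apply: (@integrable_le _ _ _ mu _ _ g) => //.
  apply: measurable_funM; first exact: continuous_measurable_fun.
  by apply: continuous_measurable_fun; exact: dexp_cont.
by move=> s _; exact: g_dexp_le.
Qed.

Let F_EFin t : 0 <= t -> (\int[mu]_s (g s * dexp t s)%:E)%E = (F t)%:E.
Proof.
move=> t0; have /integrable_fin_num h := g_dexp_integrable t0.
by rewrite /F /Rintegral fineK//; exact: h.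
Qed.

Lemma continuous_ml_laplace t : 0 < t -> {for t, continuous F}.
Proof.
move=> t0; have := @continuity_under_integral R _ _ mu (fun t s => g s * dexp t s)
  setT measurableT 0 (2 * t).
move=> /(_ _ _ g g_integrable) H; apply: H; last first.
- by rewrite inE/= in_itv/= t0 ltr_pMl// ltr1n.
- move=> x /=; rewrite in_itv/= => /andP[x0 _]; apply: aeW => s _.
  by apply: g_dexp_le; exact: ltW.
- apply: aeW => s _ x _; apply: cvgMr; rewrite /dexp.
  apply: (@continuous_comp R R R (fun x => - (x * expR s)) expR); last exact: continuous_expR.
  by apply: cvgN; apply: cvgMl; exact: cvg_id.
- by move=> x /=; rewrite in_itv/= => /andP[/ltW x0 _]; exact: g_dexp_integrable.
Qed.

Let F_ge0 t : 0 <= F t.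
Proof. by apply: Rintegral_ge0 => s _; rewrite mulr_ge0. Qed.

Let term_cont (p : R) : {in `]0, +oo[%classic, continuous (fun t => expR (- (p * t)) * F t)}.
Proof.
move=> t; rewrite inE/= in_itv/= andbT => t0; apply: cvgM; last exact: continuous_ml_laplace.
apply: (@continuous_comp _ _ _ (fun x => - (p * x)) expR); last exact: continuous_expR.
by apply: cvgN; apply: cvgMr; exact: cvg_id.
Qed.

Let term_measurable (p : R) : measurable_fun (`]0, +oo[%classic : set R) (fun t => expR (- (p * t)) * F t).
Proof. by apply: open_continuous_measurable_fun; [exact: interval_open|exact: term_cont]. Qed.

Let joint_measurable (p : R) : measurable_fun setT
  (fun x : R * R => \1_(`]0, +oo[%classic) x.1 * expR (- (p * x.1)) * (g x.2 * dexp x.1 x.2)).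
Proof.
have m1 : measurable_fun setT (fun x : R * R => x.1) by exact: measurable_fst.
have m2 : measurable_fun setT (fun x : R * R => x.2) by exact: measurable_snd.
have me : measurable_fun setT (@expR R) by exact: measurable_expR.
apply: measurable_funM; first apply: measurable_funM.
- have mI : measurable_fun setT (\1_(`]0, +oo[%classic : set R) : R -> R).
    by apply: measurable_indic; exact: measurable_itv.
  exact: (measurableT_comp mI).
- apply: (measurableT_comp me); apply: measurableT_comp => //.
  by apply: measurable_funM.
- apply: measurable_funM.
    by apply: (measurableT_comp (f := g)) => //; exact: continuous_measurable_fun.
  apply: (measurableT_comp me); apply: measurableT_comp => //.
  by apply: measurable_funM => //; exact: (measurableT_comp me).
Qed.

(** Everything is nonnegative, so Tonelli allows integrating e^(- (p + e^s) t)
    in t first. *)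
Lemma laplace_kernel_tonelli (p : R) : 0 < p ->
  (\int[mu]_(t in `]0%R, +oo[) (expR (- (p * t)) * F t)%:E =
   \int[mu]_s (g s / (p + expR s))%:E)%E.
Proof.
move=> p0.
pose f (x : R * R) := (\1_(`]0, +oo[%classic) x.1 * expR (- (p * x.1)) * (g x.2 * dexp x.1 x.2))%:E.
have f0 x : (0 <= f x)%E.
  rewrite lee_fin mulr_ge0//; first by rewrite mulr_ge0 ?expR_ge0// indicE ler0n.
have mf : measurable_fun setT f by apply/measurable_EFinP; exact: joint_measurable.
have H := @fubini_tonelli _ _ _ _ R mu mu f mf f0.
apply: etrans (etrans _ H) _; clear H f0 mf.
  rewrite integral_mkcond; apply: eq_integral => t _; rewrite patchE /f /=; clear f.
  case: ifPn; last first.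
    move=> /negbTE h; under eq_integral do rewrite indicE h !mul0r.
    by rewrite integral0.
  rewrite indicE => h; rewrite h mul1r.
  move: h; rewrite inE/= in_itv/= andbT => /ltW t0.
  have ig := g_dexp_integrable t0.
  under eq_integral do rewrite EFinM.
  apply/esym; apply: etrans (@integralZl _ _ R mu setT measurableT _ ig _) _.
  rewrite EFinM; congr (_ * _)%E.
  exact: F_EFin.
apply: eq_integral => s _; rewrite /f /=; clear f.
have ps : 0 < p + expR s by rewrite addr_gt0// expR_gt0.
under eq_integral.
  move=> t _.
  rewrite (_ : _ * _ * _ = g s * (\1_(`]0, +oo[%classic) t * expR (- ((p + expR s) * t)))); last first.
    rewrite /dexp mulrDl opprD expRD (mulrC t); ring.
  over.
have ie := integrable_expRN ps.
have E : (\int[mu]_t (\1_(`]0, +oo[%classic) t * expR (- ((p + expR s) * t)))%:E = ((p + expR s)^-1)%:E)%E.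
  rewrite -(Rintegral_expRN ps) /Rintegral fineK; last exact: integrable_fin_num.
  rewrite [RHS]integral_mkcond; apply: eq_integral => t _; rewrite patchE indicE.
  by case: (t \in _); rewrite ?mul1r ?mul0r.
under eq_integral do rewrite EFinM.
rewrite ge0_integralZl//.
- by rewrite E.
- apply/measurable_EFinP; apply: measurable_funM => //.
  apply: continuous_measurable_fun => x.
  apply: (@continuous_comp _ _ _ (fun x => - ((p + expR s) * x)) expR); last exact: continuous_expR.
  by apply: cvgN; apply: cvgMr; exact: cvg_id.
- by rewrite lee_fin.
Qed.

(** p is written e^P: shifting s by P factors 1 / p out of 1 / (p + e^s) and
    leaves [stieltjes_ml_kernel] at lam = p^-al. *)
Lemma laplace_kernel (P : R) :
  mu.-integrable `]0, +oo[ (EFin \o (fun t => expR (- (expR P * t)) * F t)) /\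
  \int[mu]_(t in `]0, +oo[) (expR (- (expR P * t)) * F t) =
  expR (- P) / (1 + expR (- (al * P))).
Proof.
have /andP[al0 al1] := al01.
have p0 := expR_gt0 P; have T := laplace_kernel_tonelli p0.
have [ik vk] := stieltjes_ml_kernel al0 al1 (expR_gt0 (- (al * P))).
pose G s := g s / (expR P + expR s).
have pe s : 0 < expR P + expR s by rewrite addr_gt0// expR_gt0.
have G0 s : 0 <= G s by rewrite divr_ge0// ltW.
have Gc : continuous G.
  move=> s; apply: cvgM; first exact: g_cont.
  apply: cvgV; first by rewrite gt_eqF.
  by apply: cvgD; [exact: cvg_cst|exact: continuous_expR].
have iG : mu.-integrable setT (EFin \o G).
  apply: (@integrable_le _ _ _ mu _ _ (fun s => expR (- P) * g s)) => //.
  - exact: continuous_measurable_fun.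
  - move=> s _; rewrite ger0_norm// /G mulrC ler_wpM2r// expRN lef_pV2 ?posrE//.
    by rewrite lerDl expR_ge0.
  - exact: integrable_mull.
have vG : \int[mu]_s G s = expR (- P) / (1 + expR (- (al * P))).
  rewrite (Rintegral_shift P Gc G0) -vk -RintegralZl//.
  apply: eq_Rintegral => s _; rewrite /G /g.
  have -> : expR (al * (s + P)) = expR (al * s) / expR (- (al * P)).
    by rewrite -expRN opprK -expRD mulrDr.
  rewrite mulrCA; congr (_ * _).
  by rewrite expRN -invfM mulrDr mulr1 -expRD [s + P]addrC.
have fin : (\int[mu]_s (G s)%:E)%E \is a fin_num by exact: integrable_fin_num.
split; last by rewrite -vG /Rintegral T.
apply/integrableP; split; first by apply/measurable_EFinP; exact: term_measurable.
under eq_integral do rewrite gee0_abs ?lee_fin ?mulr_ge0 ?expR_ge0//.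
by rewrite T ltey_eq fin.
Qed.

End laplace_of_kernel.

Section mittag_leffler_series.
Context (R : realType).
Notation mu := (@lebesgue_measure R).
Variable al : R.
Hypothesis al0 : 0 < al.

Let term (k : nat) (z : R) := z ^+ k / Gamma (al * k%:R + 1).

Let alk_ge0 (k : nat) : 0 <= al * k%:R.
Proof. by rewrite mulr_ge0// ltW. Qed.

(** [Gamma_ge] at T = (2 Y)^(1/al), for which T^(al k) = (2 Y)^k: the terms are
    then dominated by a geometric series of ratio 1/2. *)
Lemma mittag_leffler_term_le (Y z : R) (k : nat) : 0 < Y -> `|z| <= Y ->
  `|z ^+ k / Gamma (al * k%:R + 1)| <= expR ((2 * Y) `^ al^-1 + 1) * 2^-1 ^+ k.
Proof.
move=> Y0 zY; set T := (2 * Y) `^ al^-1.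
have Y2 : 0 < 2 * Y by rewrite mulr_gt0.
have T0 : 0 < T by rewrite powR_gt0.
have G0 := Gamma_gt0 (alk_ge0 k).
have Tk : T `^ (al * k%:R) = (2 * Y) ^+ k.
  by rewrite /T -powRrM mulrA mulVf ?mul1r ?powR_mulrn ?gt_eqF// ltW.
rewrite normrM normrV ?unitfE ?gt_eqF// (gtr0_norm G0) ler_pdivrMr//.
have := Gamma_ge (alk_ge0 k) T0; rewrite Tk => h.
have c0 : 0 <= expR (T + 1) * 2^-1 ^+ k.
  by rewrite mulr_ge0 ?expR_ge0// exprn_ge0// invr_ge0.
apply: le_trans (ler_wpM2l c0 h).
rewrite [leRHS](_ : _ = Y ^+ k).
  by rewrite normrX lerXn2r ?nnegrE ?normr_ge0// ltW.
rewrite expRN exprMn exprVn; field.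
by rewrite gt_eqF ?expR_gt0//= expf_neq0.
Qed.

Lemma cvg_geometric_half (c : R) :
  series (fun k => c * 2^-1 ^+ k) @ \oo --> c * 2.
Proof.
have h : `|2^-1 : R| < 1 by rewrite ger0_norm ?invr_ge0// invf_lt1// ltr1n.
have := @cvg_geometric_series _ c _ h.
by rewrite (_ : c / (1 - 2^-1) = c * 2)//; field.
Qed.

Let ml_term_M (Y z : R) (n : nat) : 0 < Y -> `[- Y, Y]%classic z ->
  `|term n z| <= expR ((2 * Y) `^ al^-1 + 1) * 2^-1 ^+ n.
Proof.
by move=> Y0 /=; rewrite in_itv/= => h; apply: mittag_leffler_term_le => //; rewrite ler_norml.
Qed.

Let M_cvg (c : R) : cvgn (series (fun k => c * 2^-1 ^+ k)).
Proof. by apply/cvg_ex; exists (c * 2); exact: (@cvg_geometric_half c). Qed.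

Lemma mittag_leffler_cvg (z : R) :
  series (fun k => z ^+ k / Gamma (al * k%:R + 1)) @ \oo --> mittag_leffler al z.
Proof.
have Y0 : 0 < `|z| + 1 by rewrite ltr_wpDl.
apply: (Mtest_cvg (fun n x => @ml_term_M _ x n Y0) (@M_cvg _)).
by rewrite /= in_itv/= -ler_norml lerDl.
Qed.

Lemma continuous_mittag_leffler : continuous (@mittag_leffler R al).
Proof.
move=> z; have Y0 : 0 < `|z| + 1 by rewrite ltr_wpDl.
have H : {within `[- (`|z| + 1), `|z| + 1], continuous (@mittag_leffler R al)}.
  apply: (Mtest_continuous (fun n x => @ml_term_M _ x n Y0) (@M_cvg _)) => n.
  by apply: continuous_subspaceT => x; apply: cvgMl; exact: exprn_continuous.
by apply: (within_continuous_oo H); rewrite -ltr_norml ltrDl.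
Qed.

Let b := 2 `^ al^-1.

Lemma mittag_leffler_partial_le (t : R) (n : nat) : 0 < t ->
  `|series (fun k => (- (t `^ al)) ^+ k / Gamma (al * k%:R + 1)) n| <=
  2 * expR 1 * expR (b * t).
Proof.
move=> t0; have ta : 0 < t `^ al by rewrite powR_gt0.
have bt : (2 * t `^ al) `^ al^-1 = b * t.
  by rewrite powRM ?powR_ge0// -powRrM mulfV ?gt_eqF// powRr1// ltW.
apply: (@le_trans _ _ (series (fun k => expR (b * t + 1) * 2^-1 ^+ k) n)).
  apply: le_trans (ler_norm_sum _ _ _) _.
  apply: ler_sum => i _; rewrite -bt; apply: mittag_leffler_term_le => //.
  by rewrite normrN gtr0_norm.
have -> : 2 * expR 1 * expR (b * t) = expR (b * t + 1) * 2 by rewrite expRD; ring.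
have /cvg_lim <- // := @cvg_geometric_half (expR (b * t + 1)).
apply: nondecreasing_cvgn_le; last exact: M_cvg.
apply: nondecreasing_series => k _ _.
by rewrite mulr_ge0 ?expR_ge0// exprn_ge0// invr_ge0.
Qed.

Let E (t : R) := mittag_leffler al (- (t `^ al)).

Lemma continuous_mittag_leffler_powR (t : R) : 0 < t -> {for t, continuous E}.
Proof.
move=> t0; apply: (@continuous_comp _ _ _ (fun t => - (t `^ al)) (mittag_leffler al)).
  by apply: cvgN; exact: continuous_powR_gt0.
exact: continuous_mittag_leffler.
Qed.

Let S (n : nat) (t : R) := series (fun k => (- (t `^ al)) ^+ k / Gamma (al * k%:R + 1)) n.

Let open_measurable (f : R -> R) : (forall t, 0 < t -> {for t, continuous f}) ->
  measurable_fun (`]0, +oo[%classic : set R) f.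
Proof.
move=> cf; apply: open_continuous_measurable_fun; first exact: interval_open.
by move=> t; rewrite inE/= in_itv/= andbT; exact: cf.
Qed.

Let exp_cont (p t : R) : {for t, continuous (fun t => expR (- (p * t)))}.
Proof.
apply: (@continuous_comp _ _ _ (fun x => - (p * x)) expR); last exact: continuous_expR.
by apply: cvgN; apply: cvgMr; exact: cvg_id.
Qed.

(** The series is integrated termwise for p > b = 2^(1/al): its partial
    sums are bounded by a multiple of e^(b t) uniformly.  The k-th term
    transforms to (-1)^k p^(- al k - 1), a geometric series that converges as
    soon as p > 1. *)
Lemma laplace_mittag_leffler (P : R) : b < expR P -> 0 < P ->
  mu.-integrable `]0, +oo[ (EFin \o (fun t => expR (- (expR P * t)) * E t)) /\
  \int[mu]_(t in `]0, +oo[) (expR (- (expR P * t)) * E t) =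
  expR (- P) / (1 + expR (- (al * P))).
Proof.
move=> bP P0; set p := expR P in bP *.
have p0 : 0 < p by exact: expR_gt0.
have pb : 0 < p - b by rewrite subr_gt0.
have dom t y : 0 < t -> `|y| <= 2 * expR 1 * expR (b * t) ->
    `|expR (- (p * t)) * y| <= 2 * expR 1 * expR (- ((p - b) * t)).
  move=> t0 yb; rewrite normrM ger0_norm ?expR_ge0//.
  apply: le_trans (ler_wpM2l (expR_ge0 _) yb) _.
  rewrite mulrCA -expRD ler_wpM2l ?mulr_ge0 ?expR_ge0// ler_expR; lra.
have mS n : measurable_fun (`]0, +oo[%classic : set R) (fun t => expR (- (p * t)) * S n t).
  apply: measurable_funM; first by apply: open_measurable => t _; exact: exp_cont.
  apply: measurable_sum => k; apply: measurable_funM => //.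
  apply: measurable_funX; apply: measurableT_comp => //.
  by apply: measurable_funTS; exact: measurable_powR.
have [iE cE] := @Rdominated_convergence _ _ R mu `]0, +oo[%classic
  (fun n t => expR (- (p * t)) * S n t) (fun t => expR (- (p * t)) * E t)
  (fun t => 2 * expR 1 * expR (- ((p - b) * t))) (measurable_itv _) mS
  (ltac:(apply: measurable_funM; apply: open_measurable => t t0; [exact: exp_cont|exact: continuous_mittag_leffler_powR]))
  (ltac:(apply: aeW => t _; apply: cvgMr; exact: mittag_leffler_cvg))
  (ltac:(apply: integrable_mull => //; exact: integrable_expRN))
  (ltac:(move=> n t /=; rewrite in_itv/= andbT => t0; apply: dom => //; exact: mittag_leffler_partial_le)).
split=> //; have ph : p^-1 = expR (- P) by rewrite expRN.
have val n : \int[mu]_(t in `]0, +oo[) (expR (- (p * t)) * S n t) =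
    series (geometric (expR (- P)) (- expR (- (al * P)))) n.
  rewrite /S /series /=.
  under eq_Rintegral do rewrite mulr_sumr.
  have tE k (t : R) : 0 < t -> expR (- (p * t)) * ((- (t `^ al)) ^+ k / Gamma (al * k%:R + 1)) =
      ((- 1) ^+ k / Gamma (al * k%:R + 1)) * (t `^ (al * k%:R) * expR (- (p * t))).
    move=> t0; rewrite powRrM powR_mulrn ?powR_ge0// -[- (t `^ al)]mulN1r exprMn; ring.
  rewrite (_ : \int[mu]_(t in `]0, +oo[) _ =
    \int[mu]_(t in `]0, +oo[) \sum_(0 <= k < n) ((- 1) ^+ k / Gamma (al * k%:R + 1)) * (t `^ (al * k%:R) * expR (- (p * t)))).
    rewrite Rintegral_sum//.
      apply: eq_bigr => k _; rewrite RintegralZl//; last exact: integrable_gamma.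
      rewrite laplace_powR// /geometric /= -ph.
      have G0 := Gamma_gt0 (alk_ge0 k).
      rewrite mulrA divfK ?gt_eqF//.
          rewrite -[- expR _]mulN1r exprMn mulrCA; congr (_ * _).
      rewrite /powR gt_eqF// expRK mulrDl mul1r expRD invfM mulrC -/p; congr (_ * _).
      rewrite -expRN -expRM_natl; congr expR; ring.
    by move=> k; apply: integrable_mull => //; exact: integrable_gamma.
  apply: eq_Rintegral => t; rewrite inE/= in_itv/= andbT => t0.
  by apply: eq_bigr => k _; exact: tE.
rewrite (funext val) in cE; apply: (cvg_unique _ cE) => //.
rewrite -[X in _ / (1 + X)]opprK; apply: cvg_geometric_series.
rewrite normrN ger0_norm ?expR_ge0// -expR0 ltr_expR oppr_lt0.
by rewrite mulr_gt0.
Qed.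

Hypothesis al1 : al < 1.

(** Both sides have the same Laplace transform at p0 + n for every n, so their
    difference times e^(- p0 t) has vanishing moments in the variable e^-t. *)
Lemma mittag_leffler_integral (t : R) : 0 < t ->
  mittag_leffler al (- (t `^ al)) =
  \int[mu]_s (ml_kernel al (expR (al * s)) * expR (- (t * expR s))).
Proof.
move=> t0; have al01 : 0 < al < 1 by rewrite al0.
set F := fun t => \int[mu]_s (ml_kernel al (expR (al * s)) * expR (- (t * expR s))).
have b0 : 0 <= b by exact: powR_ge0.
(* the termwise transform requires p > b and p > 1 *)
pose p0 : R := b + 2.
have ip n : [/\ b < expR (ln (p0 + n%:R)), 0 < ln (p0 + n%:R) & expR (ln (p0 + n%:R)) = p0 + n%:R].
  have h : 0 < p0 + n%:R by rewrite /p0 ltr_wpDr// ltr_wpDl.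
  rewrite lnK ?posrE//; split => //.
    by rewrite /p0 -addrA ltrDl ltr_wpDr.
  by apply: ln_gt0; rewrite /p0 -addrA ltr_wpDl// ltr_wpDr// ltr1n.
have LE n := laplace_mittag_leffler (let: And3 h _ _ := ip n in h) (let: And3 _ h _ := ip n in h).
have LF n := laplace_kernel al01 (ln (p0 + n%:R)).
pose h t := expR (- (p0 * t)) * E t - expR (- (p0 * t)) * F t.
suff H : forall t, (`]0, +oo[%classic : set R) t -> h t = 0.
  have := H t; rewrite /h /= in_itv/= andbT -mulrBr => /(_ t0)/eqP.
  by rewrite mulf_eq0 gt_eqF ?expR_gt0//= subr_eq0 => /eqP.
have hn n (x : R) : expR (- x) ^+ n * h x =
    expR (- ((p0 + n%:R) * x)) * E x - expR (- ((p0 + n%:R) * x)) * F x.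
  rewrite -mulrBr /h -mulrBr mulrA -expRM_natl -expRD; congr (expR _ * _); ring.
have iE n : mu.-integrable `]0, +oo[ (EFin \o (fun t => expR (- ((p0 + n%:R) * t)) * E t)).
  by have [_ _ <-] := ip n; have [] := LE n.
have iF n : mu.-integrable `]0, +oo[ (EFin \o (fun t => expR (- ((p0 + n%:R) * t)) * F t)).
  by have [_ _ <-] := ip n; have [] := LF n.
apply: (@moments_eq0 R _ (fun t => expR (- t))).
- exact: interval_open.
- apply: open_measurable => x x0; apply: (@continuous_comp _ _ _ -%R expR); last exact: continuous_expR.
  exact: opp_continuous.
- by move=> x /=; rewrite in_itv/= andbT => x0; rewrite expR_gt0/= -expR0 ltr_expR oppr_lt0.
- by move=> x z _ _ xz; rewrite ltr_expR ltrN2.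
- apply: integrable_subr => //; first by have := iE 0%N; rewrite addr0.
  by have := iF 0%N; rewrite addr0.
- move=> x /=; rewrite in_itv/= andbT => x0; apply: cvgB; apply: cvgM.
  + exact: exp_cont.
  + exact: continuous_mittag_leffler_powR.
  + exact: exp_cont.
  + exact: continuous_ml_laplace.
- move=> n; under eq_Rintegral do rewrite hn.
  rewrite RintegralB//; have [_ _ <-] := ip n.
  by have [_ ->] := LE n; have [_ ->] := LF n; rewrite subrr.
Qed.

Lemma mittag_leffler_kernel (y : R) : 0 < y ->
  mittag_leffler al (- y) =
  \int[mu]_s (ml_kernel al (expR (al * s) / y) * expR (- expR s)).
Proof.
move=> y0; pose t := y `^ al^-1; have t0 : 0 < t by rewrite powR_gt0.
have ty : t `^ al = y by rewrite -powRrM mulVf ?gt_eqF// powRr1// ltW.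
have al01 : 0 < al < 1 by rewrite al0.
have := mittag_leffler_integral t0; rewrite ty => ->.
rewrite (Rintegral_shift (- ln t)).
- apply: eq_Rintegral => s _; congr (ml_kernel _ _ * expR (- _)).
    rewrite mulrDr expRD mulrN expRN; congr (_ / _).
    by rewrite -[in RHS]ty /powR gt_eqF.
  by rewrite expRD expRN lnK ?posrE// mulrCA mulfV ?mulr1// gt_eqF.
- move=> s; apply: cvgM.
    have := @continuous_ml_kernel_exp _ al al 1 al01 ler01 s.
    by rewrite /continuous_at mulr1; under eq_fun do rewrite mulr1.
  apply: (@continuous_comp _ _ _ (fun s => - (t * expR s)) expR); last exact: continuous_expR.
  by apply: cvgN; apply: cvgMr; exact: continuous_expR.
- by move=> s; rewrite mulr_ge0 ?expR_ge0// ml_kernel_ge0// expR_ge0.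
Qed.

End mittag_leffler_series.

(** * Uniform asymptotics in the order alpha *)

Section weight.
Context (R : realType).
Notation mu := (@lebesgue_measure R).

Let affine_le_exp (k u : R) : 0 < k -> 0 <= u -> 1 + u <= (1 + k^-1) * expR (k * u).
Proof.
move=> k0 u0; rewrite mulrDl mul1r lerD//.
  by rewrite -expR0 ler_expR mulr_ge0// ltW.
by rewrite ler_pdivlMl// (le_trans _ (expR_ge1Dx _))// lerDr.
Qed.

Let expRN_expR_le (s : R) : expR (- expR s) <= 256 * expR (- (4 * s)).
Proof.
rewrite !expRN ler_pdivlMr ?expR_gt0// mulrC ler_pdivrMr ?expR_gt0// expRM_natl.
have h : expR s / 4 <= expR (expR s / 4).
  by rewrite (le_trans _ (expR_ge1Dx _))// lerDr.
have -> : expR (expR s) = expR (expR s / 4) ^+ 4.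
  by rewrite -expRM_natl; congr expR; field.
have -> : expR s ^+ 4 = 256 * (expR s / 4) ^+ 4 by field.
by apply: ler_wpM2l => //; apply: lerXn2r; rewrite ?nnegrE ?divr_ge0 ?expR_ge0.
Qed.

(** On the left e^(k s) decays; on the right exp(- e^s) absorbs everything,
    by e^u >= (u / 4)^4 at u = e^s, whence 256 = 4^4.  The factor 1 + |s| leaves
    room for one derivative in the exponent. *)
Lemma exp_weight_le (k a0 s : R) : 0 < a0 -> a0 <= k <= 2 ->
  expR (k * s) * expR (- expR s) * (1 + `|s|) <=
  256 * (1 + 2 / a0) * expR (- (a0 / 2 * `|s|)).
Proof.
move=> a00 /andP[ak k2]; have a2 : 0 < a0 / 2 by rewrite divr_gt0.
have C1 : 1 <= 1 + 2 / a0 by rewrite lerDl divr_ge0// ltW.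
have [s0|s0] := leP 0 s.
  rewrite ger0_norm//.
  apply: (@le_trans _ _ (expR (2 * s) * (256 * expR (- (4 * s))) * expR s)).
    apply: ler_pM; rewrite ?mulr_ge0 ?expR_ge0 ?addr_ge0//; last exact: expR_ge1Dx.
    apply: ler_pM; rewrite ?expR_ge0//.
    by rewrite ler_expR ler_wpM2r.
  have -> : expR (2 * s) * (256 * expR (- (4 * s))) * expR s = 256 * expR (- s).
    rewrite mulrCA -!mulrA -!expRD; congr (_ * expR _); ring.
  rewrite -mulrA ler_wpM2l//.
  apply: (@le_trans _ _ (1 * expR (- (a0 / 2 * s)))).
    rewrite mul1r ler_expR lerN2 ler_piMl// ler_pdivrMr// mul1r.
    exact: le_trans k2.
  by rewrite ler_wpM2r ?expR_ge0.
have n0 : 0 <= `|s| by [].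
have sE : s = - `|s| by rewrite ltr0_norm// opprK.
rewrite {1 2}sE; move: `|s| n0 => u u0.
apply: (@le_trans _ _ (expR (- (a0 * u)) * 1 * ((1 + (a0 / 2)^-1) * expR (a0 / 2 * u)))).
  apply: ler_pM; rewrite ?mulr_ge0 ?expR_ge0 ?addr_ge0//; last exact: affine_le_exp.
  have e1 : expR (k * - u) <= expR (- (a0 * u)) by rewrite ler_expR mulrN lerN2 ler_wpM2r.
  have e2 : expR (- expR (- u)) <= 1 by rewrite -[leRHS]expR0 ler_expR oppr_le0 expR_ge0.
  by apply: ler_pM => //; exact: expR_ge0.
have -> : expR (- (a0 * u)) * 1 * ((1 + (a0 / 2)^-1) * expR (a0 / 2 * u)) =
    (1 + 2 / a0) * expR (- (a0 / 2 * u)).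
  rewrite mulr1 mulrCA -expRD invf_div; congr (_ * expR _); by field.
rewrite ler_wpM2r ?expR_ge0// ler_peMl// ?ler1n//.
exact: le_trans ler01 C1.
Qed.

Lemma integrable_exp_weight (a0 C : R) (f : R -> R) : 0 < a0 ->
  measurable_fun setT f ->
  (forall s, `|f s| <= C * expR (- (a0 / 2 * `|s|))) ->
  mu.-integrable setT (EFin \o f) /\
  `|\int[mu]_s f s| <= C * \int[mu]_s expR (- (a0 / 2 * `|s|)).
Proof.
move=> a00 mf fC; have a2 : 0 < a0 / 2 by rewrite divr_gt0.
have iw := integrable_expRN_norm a2.
have iC : mu.-integrable setT (EFin \o (fun s => C * expR (- (a0 / 2 * `|s|)))).
  by apply: integrable_mull.
have If : mu.-integrable setT (EFin \o f).
  by apply: (@integrable_le _ _ _ mu _ _ (fun s => C * expR (- (a0 / 2 * `|s|)))).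
split=> //; rewrite -RintegralZl//.
by apply: le_norm_Rintegral.
Qed.

End weight.

Section trigonometric_lipschitz.
Context (R : realType).

Let lip (f g : R -> R) (x y : R) : (forall x, is_derive x (1 : R) f (g x)) ->
  (forall x, `|g x| <= 1) -> `|f x - f y| <= `|x - y|.
Proof.
move=> df g1; wlog xy : x y / x <= y.
  move=> H; have [yx|/ltW xy] := leP x y; first exact: H.
  by rewrite distrC (distrC x); exact: H.
have cf : {within `[x, y], continuous f}.
  by apply: derivable_within_continuous => z _; have [] := df z.
have [z _ h] := MVT_segment xy (fun z _ => df z) cf.
by rewrite distrC h (distrC x) normrM ler_piMl.
Qed.

Lemma cos_lip (x y : R) : `|cos x - cos y| <= `|x - y|.
Proof.
apply: (@lip cos (fun x => - sin x)) => z.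
by rewrite normrN ler_norml sin_le1 sin_geN1.
Qed.

Lemma sin_lip (x y : R) : `|sin x - sin y| <= `|x - y|.
Proof.
apply: (@lip sin cos) => z.
by rewrite ler_norml cos_le1 cos_geN1.
Qed.

End trigonometric_lipschitz.

Section kernel_scaled.
Context (R : realType).
Notation mu := (@lebesgue_measure R).

Definition ml_den (a z : R) := 1 + 2 * z * cos (pi * a) + z ^+ 2.

(** lam t^a E_a(- lam t^a) is sin(pi a) / pi times the integral of this over the
    line, tau being ln t. *)
Definition ml_integrand (a tau lam s : R) :=
  expR (a * s) * expR (- expR s) / ml_den a (expR (a * (s - tau)) / lam).

Let zz (a tau lam s : R) := expR (a * (s - tau)) / lam.

Let zz_ge0 a tau lam s : 0 < lam -> 0 <= zz a tau lam s.
Proof. by move=> l0; rewrite divr_ge0 ?expR_ge0// ltW. Qed.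

Let zz_cont a tau lam : continuous (zz a tau lam).
Proof.
move=> s; apply: cvgM; last exact: cvg_cst.
apply: (@continuous_comp _ _ _ (fun s => a * (s - tau)) expR); last exact: continuous_expR.
by apply: cvgMr; apply: cvgB; [exact: cvg_id|exact: cvg_cst].
Qed.

Let w_cont a : continuous (fun s : R => expR (a * s) * expR (- expR s)).
Proof.
move=> s; apply: cvgM.
  apply: (@continuous_comp _ _ _ (fun s => a * s) expR); last exact: continuous_expR.
  by apply: cvgMr; exact: cvg_id.
apply: (@continuous_comp _ _ _ (fun s => - expR s) expR); last exact: continuous_expR.
by apply: cvgN; exact: continuous_expR.
Qed.

Lemma continuous_ml_integrand a tau lam : 0 < a < 1 -> 0 < lam ->
  continuous (ml_integrand a tau lam).
Proof.
move=> a01 l0 s; apply: cvgM; first exact: w_cont.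
have cz := @zz_cont a tau lam s.
apply: cvgV; first by rewrite gt_eqF// ml_den_gt0// zz_ge0.
apply: cvgD; last by apply: cvgM; exact: cz.
apply: cvgD; first exact: cvg_cst.
by apply: cvgM; [apply: cvgM; [exact: cvg_cst|exact: cz]|exact: cvg_cst].
Qed.

Section lipschitz.
Variables (a0 a1 lam0 : R).
Hypotheses (a00 : 0 < a0) (a11 : a1 < 1) (lam00 : 0 < lam0).

Let c := (1 + cos (pi * a1)) / 2.

Let in01 a : a0 <= a <= a1 -> 0 < a < 1.
Proof. by move=> /andP[h1 h2]; rewrite (lt_le_trans a00 h1) (le_lt_trans h2 a11). Qed.

Let cos_ge a : a0 <= a <= a1 -> cos (pi * a1) <= cos (pi * a).
Proof.
move=> aa; have /andP[a_0 a_1] := in01 aa; have /andP[_ aa1] := aa.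
have [->//|ne] := eqVneq a a1; apply/ltW.
rewrite ltr_cos ?in_itv/=.
- by rewrite ltr_pM2l ?pi_gt0// lt_neqAle ne.
- by rewrite mulr_ge0 ?pi_ge0 ?(ltW a_0)//= ger_pMr ?pi_gt0// ltW.
- rewrite mulr_ge0 ?pi_ge0//= ?ger_pMr ?pi_gt0// ?(ltW a11)//.
  exact: le_trans (ltW a_0) aa1.
Qed.

Let c_gt0 a : a0 <= a <= a1 -> 0 < c.
Proof.
move=> /andP[h1 h2]; apply: half_cos_gt0; rewrite a11 andbT.
exact: lt_le_trans a00 (le_trans h1 h2).
Qed.

Let den_ge a z : a0 <= a <= a1 -> 0 <= z -> c * (1 + z) ^+ 2 <= ml_den a z.
Proof.
move=> aa z0; apply: le_trans (ml_den_ge _ z0).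
rewrite ler_wpM2r ?sqr_ge0// /c ler_wpM2r ?invr_ge0// lerD2l.
exact: cos_ge.
Qed.

Let exp_lip (x y : R) : `|expR x - expR y| <= `|x - y| * Num.max (expR x) (expR y).
Proof.
wlog xy : x y / y <= x.
  move=> H; have [yx|/ltW xy] := leP y x; first exact: H.
  by rewrite distrC (distrC x) maxC; exact: H.
have exy : expR y <= expR x by rewrite ler_expR.
rewrite !ger0_norm ?subr_ge0// (max_idPl exy).
have h := ler_wpM2l (expR_ge0 x) (expR_ge1Dx (y - x)).
have e : x + (y - x) = y by ring.
by move: h; rewrite -expRD e => h; lra.
Qed.

Let exp_absorb (k r : R) : 0 < k -> r * expR (- (k * r)) <= k^-1.
Proof.
move=> k0; rewrite expRN ler_pdivrMr ?expR_gt0// ler_pdivlMl//.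
by rewrite (le_trans _ (expR_ge1Dx _))// lerDr.
Qed.

(** The bound is uniform in tau because the factor s - tau that comes from
    varying the exponent is absorbed by e^(a (s - tau)) when s <= tau, and is at
    most s otherwise. *)
Let den_lip a b tau lam s : a0 <= a <= a1 -> a0 <= b <= a1 -> 0 <= tau -> lam0 <= lam ->
  `|(ml_den a (zz a tau lam s))^-1 - (ml_den b (zz b tau lam s))^-1| <=
  `|a - b| * (c^-2 * (2 * (`|s| + (a0 * lam0)^-1) + 2 * pi)).
Proof.
move=> aa bb tau0 ll; have l0 : 0 < lam by exact: lt_le_trans ll.
set z := zz a _ _ _; set y := zz b _ _ _.
have z0 : 0 <= z by exact: zz_ge0.
have y0 : 0 <= y by exact: zz_ge0.
have c0 := c_gt0 aa.
have Dz := den_ge aa z0; have Dy := den_ge bb y0.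
pose x := Num.max z y.
have zx : z <= x by rewrite le_max lexx.
have yx : y <= x by rewrite le_max lexx orbT.
have x0 : 0 <= x by exact: le_trans zx.
have Dz0 : 0 < ml_den a z by apply: lt_le_trans Dz; rewrite mulr_gt0// exprn_gt0// ltr_wpDr.
have Dy0 : 0 < ml_den b y by apply: lt_le_trans Dy; rewrite mulr_gt0// exprn_gt0// ltr_wpDr.
have zyl : `|z - y| <= `|a - b| * (`|s - tau| * x).
  rewrite /x /z /y /zz -mulrBl normrM (ger0_norm (x := lam^-1)) ?invr_ge0 ?(ltW l0)//.
  rewrite -maxr_pMl ?invr_ge0 ?(ltW l0)// !mulrA ler_wpM2r ?invr_ge0 ?(ltW l0)//.
  by apply: le_trans (exp_lip _ _) _; rewrite -mulrBl normrM.
have cosl : `|cos (pi * a) - cos (pi * b)| <= `|a - b| * pi.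
  by apply: le_trans (cos_lip _ _) _; rewrite -mulrBr normrM mulrC (ger0_norm (pi_ge0 R)).
have num : `|ml_den b y - ml_den a z| <=
    `|a - b| * (2 * (`|s - tau| * x) * (1 + x) + 2 * pi * x).
  have -> : ml_den b y - ml_den a z = (y - z) * (2 * cos (pi * b) + (y + z)) -
      2 * z * (cos (pi * a) - cos (pi * b)) by rewrite /ml_den; ring.
  have h1 : `|(y - z) * (2 * cos (pi * b) + (y + z))| <= `|a - b| * (`|s - tau| * x) * (2 + 2 * x).
    rewrite normrM distrC; apply: ler_pM => //.
    rewrite (le_trans (ler_normD _ _))// lerD//.
      by rewrite normrM ger0_norm// ler_piMr// ler_norml cos_le1 cos_geN1.
    by rewrite ger0_norm ?addr_ge0//; lra.
  have h2 : `|2 * z * (cos (pi * a) - cos (pi * b))| <= 2 * x * (`|a - b| * pi).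
    have z20 : 0 <= 2 * z by rewrite mulr_ge0.
    rewrite normrM (ger0_norm z20); apply: ler_pM; rewrite ?normr_ge0//.
    by rewrite ler_wpM2l.
  apply: le_trans (ler_normB _ _) _; apply: le_trans (lerD h1 h2) _.
  by rewrite le_eqVlt; apply/orP; left; apply/eqP; ring.
set B := `|s| + (a0 * lam0)^-1.
have r0 : 0 <= (a0 * lam0)^-1 by rewrite invr_ge0 mulr_ge0// ltW.
have B0 : 0 <= B by rewrite addr_ge0.
have bound : `|s - tau| * x <= B * (1 + x).
  have [st|ts] := leP s tau; last first.
    rewrite gtr0_norm ?subr_gt0//.
    have s0 : 0 <= s by exact: le_trans (ltW ts).
    apply: ler_pM; rewrite ?subr_ge0 ?(ltW ts)// /B ?(ger0_norm s0); last lra.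
    by rewrite lerBlDr -addrA lerDl addr_ge0.
  rewrite -normrN ger0_norm ?opprB ?subr_ge0//.
  apply: (@le_trans _ _ (a0 * lam0)^-1); last first.
    by rewrite (@le_trans _ _ B)// ?lerDr// ler_peMr// lerDl.
  apply: (@le_trans _ _ ((tau - s) * expR (- (a0 * (tau - s))) * lam^-1)).
    rewrite -mulrA ler_wpM2l ?subr_ge0// /x /z /y /zz -maxr_pMl ?invr_ge0 ?(ltW l0)//.
    rewrite ler_wpM2r ?invr_ge0 ?(ltW l0)// ge_max !ler_expR -mulrN opprB.
    have sn : s - tau <= 0 by rewrite subr_le0.
    by rewrite !ler_wnM2r//; [case/andP: bb|case/andP: aa].
  rewrite invfM ler_pM ?exp_absorb ?invr_ge0 ?(ltW l0)// ?lef_pV2 ?posrE//.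
  by rewrite mulr_ge0 ?expR_ge0// subr_ge0.
have -> : (ml_den a z)^-1 - (ml_den b y)^-1 = (ml_den b y - ml_den a z) / (ml_den a z * ml_den b y).
  by field; rewrite !gt_eqF.
have DD : 0 < ml_den a z * ml_den b y by rewrite mulr_gt0.
rewrite normrM normfV (gtr0_norm DD) ler_pdivrMr//.
have xx : (1 + x) ^+ 2 <= (1 + z) ^+ 2 * (1 + y) ^+ 2.
  have z1 : 1 <= (1 + z) ^+ 2 by rewrite exprn_ege1// lerDl.
  have y1 : 1 <= (1 + y) ^+ 2 by rewrite exprn_ege1// lerDl.
  rewrite /x; case: (leP z y) => _.
    by rewrite ler_peMl// (le_trans ler01).
  by rewrite ler_peMr// (le_trans ler01).
have Dprod : c ^+ 2 * (1 + x) ^+ 2 <= ml_den a z * ml_den b y.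
  apply: (@le_trans _ _ (c * (1 + z) ^+ 2 * (c * (1 + y) ^+ 2))).
    rewrite (_ : c * _ * _ = c ^+ 2 * ((1 + z) ^+ 2 * (1 + y) ^+ 2)); last by ring.
    by rewrite ler_wpM2l ?sqr_ge0.
  by apply: ler_pM => //; rewrite mulr_ge0 ?sqr_ge0// ltW.
apply: le_trans num _; rewrite -[leRHS]mulrA; apply: ler_wpM2l => //.
have K0 : 0 <= 2 * B + 2 * pi by rewrite addr_ge0// mulr_ge0// pi_ge0.
apply: (@le_trans _ _ (c^-2 * (2 * B + 2 * pi) * (c ^+ 2 * (1 + x) ^+ 2))); last first.
  by rewrite ler_wpM2l// mulr_ge0// invr_ge0 sqr_ge0.
rewrite [leRHS](_ : _ = (2 * B + 2 * pi) * (1 + x) ^+ 2); last by field; rewrite gt_eqF.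
rewrite [leRHS]mulrDl; apply: lerD.
  by rewrite expr2 !mulrA ler_wpM2r ?addr_ge0// -!mulrA ler_wpM2l.
rewrite ler_wpM2l ?mulr_ge0 ?pi_ge0//.
by rewrite expr2 (le_trans (_ : x <= 1 + x))// ?lerDr// ler_peMr ?addr_ge0// lerDl.
Qed.

Let K0 := 256 * (1 + 2 / a0).
Let E (s : R) := expR (- (a0 / 2 * `|s|)).
Let Q := \int[mu]_s E s.

Let w_le k s : a0 <= k <= 2 -> expR (k * s) * expR (- expR s) * (1 + `|s|) <= K0 * E s.
Proof. exact: exp_weight_le. Qed.

Let w_ge0 (k s : R) : 0 <= expR (k * s) * expR (- expR s).
Proof. by rewrite mulr_ge0 ?expR_ge0. Qed.

Let w_le1 k s : a0 <= k <= 2 -> expR (k * s) * expR (- expR s) <= K0 * E s.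
Proof.
move=> kk; apply: le_trans (w_le s kk).
by rewrite ler_peMr ?w_ge0// lerDl.
Qed.

Let in2 a : a0 <= a <= a1 -> a0 <= a <= 2.
Proof.
move=> aa; have /andP[_ /ltW h] := in01 aa; have /andP[-> _] := aa.
by rewrite (le_trans h)// ler1n.
Qed.

Let den_inv a tau lam s : a0 <= a <= a1 -> 0 < lam ->
  0 < (ml_den a (zz a tau lam s))^-1 <= c^-1.
Proof.
move=> aa l0; have z0 := @zz_ge0 a tau lam s l0; have D := den_ge aa z0.
have c0 := c_gt0 aa.
have D0 : c <= ml_den a (zz a tau lam s).
  by apply: le_trans D; rewrite ler_peMr ?(ltW c0)// exprn_ege1// lerDl.
have D1 := lt_le_trans c0 D0.
by rewrite invr_gt0 D1 lef_pV2 ?posrE.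
Qed.

Lemma ml_integrand_integrable a tau lam : a0 <= a <= a1 -> 0 < lam ->
  mu.-integrable setT (EFin \o ml_integrand a tau lam) /\
  `|\int[mu]_s ml_integrand a tau lam s| <= c^-1 * K0 * Q.
Proof.
move=> aa l0; apply: integrable_exp_weight => //.
  by apply: continuous_measurable_fun; apply: continuous_ml_integrand => //; exact: in01.
move=> s; have /andP[d0 d1] := @den_inv a tau lam s aa l0.
rewrite /ml_integrand ger0_norm ?mulr_ge0 ?w_ge0 ?(ltW d0)//.
rewrite mulrC -[c^-1 * K0 * _]mulrA; apply: ler_pM; rewrite ?w_ge0 ?(ltW d0)//.
exact: (w_le1 s (in2 aa)).
Qed.

Let K1 := c^-1 * K0 + c^-2 * (2 + 2 * (a0 * lam0)^-1 + 2 * pi) * K0.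

Lemma ml_integral_lip a b tau lam : a0 <= a <= a1 -> a0 <= b <= a1 -> 0 <= tau ->
  lam0 <= lam ->
  `|\int[mu]_s ml_integrand a tau lam s - \int[mu]_s ml_integrand b tau lam s| <=
  `|a - b| * K1 * Q.
Proof.
move=> aa bb tau0 ll; have l0 : 0 < lam by exact: lt_le_trans ll.
have [ia _] := ml_integrand_integrable tau aa l0.
have [ib _] := ml_integrand_integrable tau bb l0.
have ma := continuous_measurable_fun (@continuous_ml_integrand a tau lam (in01 aa) l0).
have mb := continuous_measurable_fun (@continuous_ml_integrand b tau lam (in01 bb) l0).
have H s : `|ml_integrand a tau lam s - ml_integrand b tau lam s| <= `|a - b| * K1 * E s.
  have /andP[d0 d1] := @den_inv a tau lam s aa l0.
  have dl := den_lip s aa bb tau0 ll.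
  rewrite /ml_integrand -/(zz a tau lam s) -/(zz b tau lam s).
  set da := (ml_den a _)^-1 in d0 d1 dl *; set db := (ml_den b _)^-1 in dl *.
  set w := expR (- expR s).
  have w0 : 0 <= w by exact: expR_ge0.
  have -> : expR (a * s) * w * da - expR (b * s) * w * db =
     (expR (a * s) - expR (b * s)) * w * da + expR (b * s) * w * (da - db) by ring.
  have h1 : `|(expR (a * s) - expR (b * s)) * w * da| <= `|a - b| * (c^-1 * K0 * E s).
    rewrite !normrM (ger0_norm w0) (gtr0_norm d0).
    apply: (@le_trans _ _ (`|a - b| * (`|s| * (Num.max (expR (a * s)) (expR (b * s)) * w)) * c^-1)).
      apply: ler_pM => //; rewrite ?mulr_ge0 ?(ltW d0)//.
      rewrite !mulrA ler_wpM2r//; apply: le_trans (exp_lip _ _) _.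
      by rewrite -mulrBl normrM.
    rewrite -mulrA ler_wpM2l// mulrC -mulrA ler_wpM2l ?invr_ge0 ?(ltW (c_gt0 aa))//.
    have m k : a0 <= k <= a1 -> `|s| * (expR (k * s) * w) <= K0 * E s.
      move=> kk; apply: le_trans (w_le s (in2 kk)).
      by rewrite mulrC ler_wpM2l ?mulr_ge0 ?expR_ge0// lerDr.
    by rewrite /Num.max; case: ifP => _; [exact: m bb|exact: m aa].
  have h2 : `|expR (b * s) * w * (da - db)| <=
      `|a - b| * (c^-2 * (2 + 2 * (a0 * lam0)^-1 + 2 * pi) * K0 * E s).
    rewrite normrM ger0_norm ?w_ge0//.
    apply: le_trans (ler_wpM2l (w_ge0 _ _) dl) _.
    rewrite mulrCA ler_wpM2l// mulrCA -[leRHS]mulrA -[leRHS]mulrA ler_wpM2l ?invr_ge0 ?sqr_ge0//.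
    have r0 : 0 <= (a0 * lam0)^-1 by rewrite invr_ge0 mulr_ge0// ltW.
    have P0 : 0 <= (pi : R) by exact: pi_ge0.
    have s0 : 0 <= `|s| by [].
    apply: (@le_trans _ _ ((2 + 2 * (a0 * lam0)^-1 + 2 * pi) * (expR (b * s) * w * (1 + `|s|)))); last first.
      by rewrite ler_wpM2l ?w_le ?in2// !addr_ge0// mulr_ge0.
    rewrite [leRHS](_ : _ = expR (b * s) * expR (- expR s) *
      ((2 + 2 * (a0 * lam0)^-1 + 2 * pi) * (1 + `|s|))); last by rewrite /w; ring.
    apply: ler_wpM2l; first exact: w_ge0.
    move: (a0 * lam0)^-1 r0 `|s| s0 (pi : R) P0 => r r0 u u0 P P0.
    by have := mulr_ge0 r0 u0; have := mulr_ge0 P0 u0; nra.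
  apply: le_trans (ler_normD _ _) _; apply: le_trans (lerD h1 h2) _.
  by rewrite le_eqVlt; apply/orP; left; apply/eqP; rewrite /K1; ring.
rewrite -RintegralB//.
by have [_] := integrable_exp_weight a00 (measurable_funB ma mb) H.
Qed.

(** ml_den differs from 1 by O(z) with z = e^(a (s - tau)) / lam, which brings a
    factor e^(- a tau) and doubles the exponent of the weight. *)
Let ml_integral_limit a tau lam : a0 <= a <= a1 -> 0 <= tau -> lam0 <= lam ->
  `|\int[mu]_s ml_integrand a tau lam s - \int[mu]_s (expR (a * s) * expR (- expR s))| <=
  2 * (c * lam0)^-1 * K0 * expR (- (a0 * tau)) * Q.
Proof.
move=> aa tau0 ll; have l0 : 0 < lam by exact: lt_le_trans ll.
have [ia _] := ml_integrand_integrable tau aa l0.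
have ma := continuous_measurable_fun (@continuous_ml_integrand a tau lam (in01 aa) l0).
have mw : measurable_fun setT (fun s : R => expR (a * s) * expR (- expR s)).
  by apply: continuous_measurable_fun; exact: w_cont.
have [iw _] : mu.-integrable setT (EFin \o (fun s : R => expR (a * s) * expR (- expR s))) /\
    `|\int[mu]_s (expR (a * s) * expR (- expR s))| <= K0 * Q.
  apply: integrable_exp_weight => // s.
  by rewrite ger0_norm ?w_ge0// w_le1// in2.
have H s : `|ml_integrand a tau lam s - expR (a * s) * expR (- expR s)| <=
    2 * (c * lam0)^-1 * K0 * expR (- (a0 * tau)) * E s.
  rewrite /ml_integrand -/(zz a tau lam s).
  have z0 := @zz_ge0 a tau lam s l0; have D := den_ge aa z0.
  have zE : zz a tau lam s = expR (a * s) * expR (- (a * tau)) / lam.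
    by rewrite /zz -expRD; congr (expR _ / _); ring.
  set z := zz a tau lam s in z0 D zE *.
  have c0 := c_gt0 aa.
  have S0 : 0 < (1 + z) ^+ 2 by rewrite exprn_gt0// ltr_wpDr.
  have D0 : 0 < ml_den a z by apply: lt_le_trans D; rewrite mulr_gt0.
  rewrite -[X in _ - X]mulr1 -mulrBr normrM ger0_norm ?w_ge0//.
  have -> : (ml_den a z)^-1 - 1 = (1 - ml_den a z) / ml_den a z by field; rewrite gt_eqF.
  have h : `|(1 - ml_den a z) / ml_den a z| <= 2 * z / c.
    rewrite normrM normfV (gtr0_norm D0) ler_pdivrMr//.
    apply: (@le_trans _ _ (2 * z / c * (c * (1 + z) ^+ 2))); last first.
      by rewrite ler_wpM2l// mulr_ge0 ?invr_ge0 ?(ltW c0)// mulr_ge0.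
    rewrite [leRHS](_ : _ = 2 * z * (1 + z) ^+ 2); last by field; rewrite gt_eqF.
    apply: (@le_trans _ _ (2 * z + z ^+ 2)); last by nra.
    rewrite /ml_den distrC (_ : 1 + 2 * z * cos (pi * a) + z ^+ 2 - 1 = 2 * z * cos (pi * a) + z ^+ 2); last by ring.
    apply: (le_trans (ler_normD _ _)); rewrite (ger0_norm (sqr_ge0 z)) lerD2r.
    have z20 : 0 <= 2 * z by rewrite mulr_ge0.
    by rewrite normrM (ger0_norm z20) ler_piMr// ler_norml cos_le1 cos_geN1.
  apply: le_trans (ler_wpM2l (w_ge0 _ _) h) _.
  have aa2 : a0 <= 2 * a <= 2.
    have /andP[p0 p1] := in01 aa; have /andP[p2 _] := aa.
    by apply/andP; split; lra.
  rewrite zE.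
  rewrite [leLHS](_ : _ = 2 / (c * lam) * (expR (2 * a * s) * expR (- expR s)) * expR (- (a * tau))); last first.
    have -> : expR (2 * a * s) = expR (a * s) * expR (a * s) by rewrite -expRD; congr expR; ring.
    by field; rewrite !gt_eqF.
  have -> : 2 * (c * lam0)^-1 * K0 * expR (- (a0 * tau)) * E s =
    2 / (c * lam0) * (K0 * E s) * expR (- (a0 * tau)) by ring.
  apply: ler_pM; rewrite ?expR_ge0//.
  - by rewrite mulr_ge0 ?w_ge0// divr_ge0// mulr_ge0// ltW.
  - apply: ler_pM; rewrite ?w_ge0 ?w_le1//.
      by rewrite divr_ge0// mulr_ge0// ltW.
    have p1 : 0 < c * lam by exact: mulr_gt0.
    have p2 : 0 < c * lam0 by exact: mulr_gt0.
    have p3 : c * lam0 <= c * lam by rewrite ler_pM2l.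
    by apply: ler_wpM2l => //; rewrite lef_pV2 ?posrE.
  - by rewrite ler_expR lerN2 ler_wpM2r//; case/andP: aa.
rewrite -RintegralB//.
by have [_] := integrable_exp_weight a00 (measurable_funB ma mw) H.
Qed.

Lemma weight_integral_ge a : a0 <= a <= a1 ->
  expR (- expR 1) <= \int[mu]_s (expR (a * s) * expR (- expR s)).
Proof.
move=> aa; have /andP[a_0 _] := in01 aa.
have mw : measurable_fun setT (fun s : R => expR (a * s) * expR (- expR s)).
  by apply: continuous_measurable_fun; exact: w_cont.
have [iw _] : mu.-integrable setT (EFin \o (fun s : R => expR (a * s) * expR (- expR s))) /\
    `|\int[mu]_s (expR (a * s) * expR (- expR s))| <= K0 * Q.
  apply: integrable_exp_weight => // s.
  by rewrite ger0_norm ?w_ge0// w_le1// in2.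
set k := expR _.
have E1 : k = \int[mu]_s (\1_(`]0, 1]%classic) s * k).
  rewrite -(@Rintegral_restrict_sub _ _ _ mu)//.
  by rewrite Rintegral_cst//= lebesgue_measure_itv/= lte_fin ltr01/= oppr0 addr0 mulr1.
rewrite [leLHS]E1; apply: le_Rintegral => //.
  rewrite (_ : EFin \o _ = EFin \o (fun x => k * \1_(`]0, 1]%classic) x)).
    by apply: integrable_mull => //; exact: integrable_indic_itv.
  by apply/funext => x /=; rewrite mulrC.
move=> s _; rewrite indicE.
case: (boolP (s \in _)) => [|_]; last by rewrite mul0r w_ge0.
rewrite inE/= in_itv/= => /andP[s0 s1]; rewrite /k mul1r.
rewrite -[leLHS]mul1r; apply: ler_pM; rewrite ?expR_ge0//.
  by rewrite -[leLHS]expR0 ler_expR mulr_ge0// ltW.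
by rewrite ler_expR lerN2 ler_expR.
Qed.

Let sg (a : R) := sin (pi * a) / pi.

(** lam t^a E_a(- lam t^a), as a function of a and tau = ln t. *)
Definition scaled_ml a tau lam := sin (pi * a) / pi * \int[mu]_s ml_integrand a tau lam s.

Let sg_le a : a0 <= a <= a1 -> 0 < sg a <= 1.
Proof. by move=> aa; apply: sin_pi_ratio; exact: in01. Qed.

Lemma scaled_ml_lip : exists2 C, 0 <= C & forall a b tau lam,
  a0 <= a <= a1 -> a0 <= b <= a1 -> 0 <= tau -> lam0 <= lam ->
  `|scaled_ml a tau lam - scaled_ml b tau lam| <= C * `|a - b|.
Proof.
exists (`|K1 * Q| + `|c^-1 * K0 * Q|); first exact: addr_ge0.
move=> a b tau lam aa bb tau0 ll; have l0 : 0 < lam by exact: lt_le_trans ll.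
have h1 := ml_integral_lip aa bb tau0 ll.
have [_ h2] := ml_integrand_integrable tau bb l0.
rewrite /scaled_ml -/(sg a) -/(sg b).
set Ia := Rintegral _ _ _ in h1 *; set Ib := Rintegral _ _ _ in h1 h2 *.
have -> : sg a * Ia - sg b * Ib = sg a * (Ia - Ib) + (sg a - sg b) * Ib by ring.
apply: le_trans (ler_normD _ _) _; rewrite [leRHS]mulrDl; apply: lerD.
  have /andP[s0 s1] := sg_le aa.
  rewrite normrM (gtr0_norm s0) -[leRHS]mul1r; apply: ler_pM; rewrite ?(ltW s0)//.
  apply: le_trans h1 _; rewrite -mulrA mulrC ler_wpM2r//; exact: ler_norm.
rewrite normrM mulrC; apply: ler_pM => //.
  exact: le_trans h2 (ler_norm _).
rewrite /sg -mulrBl normrM normfV (ger0_norm (pi_ge0 R)) ler_pdivrMr ?pi_gt0//.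
by apply: le_trans (sin_lip _ _) _; rewrite -mulrBr normrM mulrC (ger0_norm (pi_ge0 R)).
Qed.

Lemma scaled_ml_bound : exists C, forall a tau lam,
  a0 <= a <= a1 -> lam0 <= lam -> `|scaled_ml a tau lam| <= C.
Proof.
exists (c^-1 * K0 * Q) => a tau lam aa ll; have l0 : 0 < lam by exact: lt_le_trans ll.
have [_ h2] := ml_integrand_integrable tau aa l0.
have /andP[s0 s1] := sg_le aa.
by rewrite /scaled_ml normrM (gtr0_norm s0) -[leRHS]mul1r; apply: ler_pM; rewrite ?(ltW s0).
Qed.

(** sin(pi a) Gamma(a) / pi, the integral being Gamma(a) in logarithmic
    variables. *)
Definition scaled_ml_limit a := sin (pi * a) / pi * \int[mu]_s (expR (a * s) * expR (- expR s)).

Lemma scaled_ml_cvg : exists2 C, 0 <= C & forall a tau lam,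
  a0 <= a <= a1 -> 0 <= tau -> lam0 <= lam ->
  `|scaled_ml a tau lam - scaled_ml_limit a| <= C * expR (- (a0 * tau)).
Proof.
exists `|2 * (c * lam0)^-1 * K0 * Q| => // a tau lam aa tau0 ll.
have h := ml_integral_limit aa tau0 ll.
have /andP[s0 s1] := sg_le aa.
rewrite /scaled_ml /scaled_ml_limit -mulrBr normrM (gtr0_norm s0) -[leRHS]mul1r.
apply: ler_pM; rewrite ?(ltW s0)//; apply: le_trans h _.
by rewrite -mulrA (mulrC (expR _)) mulrA ler_wpM2r ?expR_ge0// ler_norm.
Qed.

Lemma scaled_ml_limit_ge : a0 <= a1 -> exists2 v, 0 < v & forall a, a0 <= a <= a1 ->
  v <= scaled_ml_limit a.
Proof.
move=> a01; have cs : {within `[a0, a1], continuous sg}.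
  apply: continuous_subspaceT => a; apply: cvgM; last exact: cvg_cst.
  apply: (@continuous_comp _ _ _ (fun a => pi * a) sin); last exact: continuous_sin.
  by apply: cvgMr; exact: cvg_id.
have [m mI mle] := EVT_min a01 cs; rewrite in_itv/= in mI; have /andP[m0 m1] := sg_le mI.
exists (sg m * expR (- expR 1)).
  by rewrite mulr_gt0 ?expR_gt0.
move=> a aa; apply: ler_pM; rewrite ?expR_ge0 ?weight_integral_ge//.
  exact: ltW.
by apply: mle; rewrite in_itv.
Qed.

Lemma mittag_leffler_scaled (a lam t : R) : a0 <= a <= a1 -> 0 < lam -> 0 < t ->
  mittag_leffler a (- (lam * t `^ a)) =
  expR (- (a * ln t)) * (scaled_ml a (ln t) lam / lam).
Proof.
move=> aa l0 t0; have a01 := in01 aa; have /andP[a_0 a_1] := a01.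
have ta : t `^ a = expR (a * ln t) by rewrite /powR gt_eqF.
rewrite mittag_leffler_kernel ?mulr_gt0 ?powR_gt0//.
have [ii _] := ml_integrand_integrable (ln t) aa l0.
transitivity (expR (- (a * ln t)) / lam * (sg a) * \int[mu]_s ml_integrand a (ln t) lam s); last first.
  by rewrite /scaled_ml -/(sg a); ring.
rewrite -RintegralZl//; apply: eq_Rintegral => s _.
have zE : expR (a * s) / (lam * t `^ a) = zz a (ln t) lam s.
  rewrite ta /zz invfM mulrCA -expRN -expRD mulrC; congr (expR _ / _); ring.
rewrite /ml_kernel zE /ml_integrand -/(zz a (ln t) lam s) -/(ml_den a _) -/(sg a).
rewrite {1}/zz mulrBr expRD.
ring.
Qed.

End lipschitz.

End kernel_scaled.

Section sequences.
Context (R : realType).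
Implicit Types u v : nat -> R.

Lemma le_norm_lim_series u v : (forall n, `|u n| <= v n) -> cvgn (series v) ->
  cvgn (series u) /\ `|limn (series u)| <= limn (series v).
Proof.
move=> uv cv; split.
  exact: (@Mtest_cvg R setT (fun n _ => u n) v (fun n _ _ => uv n) cv 0 I).
have := @Mtest_tail R setT (fun n _ => u n) v (fun n _ _ => uv n) cv 0%N 0 I.
by rewrite /series /= !big_geq// !subr0.
Qed.

Lemma cvg_seriesZ u (k : R) : cvgn (series u) ->
  cvgn (series (fun n => k * u n)) /\
  limn (series (fun n => k * u n)) = k * limn (series u).
Proof.
move=> cu; have H : series (fun n => k * u n) @ \oo --> k * limn (series u).
  rewrite (_ : series _ = (fun n => k * series u n)); first exact: cvgMr.
  by apply/funext => n; rewrite /series /= mulr_sumr.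
by split; [apply/cvg_ex; exists (k * limn (series u))|exact: cvg_lim H].
Qed.

Lemma cvg_seriesB u v : cvgn (series u) -> cvgn (series v) ->
  cvgn (series (fun n => u n - v n)) /\
  limn (series (fun n => u n - v n)) = limn (series u) - limn (series v).
Proof.
move=> cu cv.
have H : series (fun n => u n - v n) @ \oo --> limn (series u) - limn (series v).
  rewrite (_ : series _ = (fun n => series u n - series v n)); first exact: cvgB.
  by apply/funext => n; rewrite /series /= sumrB.
by split; [apply/cvg_ex; exists (limn (series u) - limn (series v))|exact: cvg_lim H].
Qed.

(** Factoring out t^-a leaves a quantity V(a) that is Lipschitz in a and bounded
    below by a positive constant, both uniformly in large t; the factor t^-a then
    wins because its logarithmic slope is ln t. *)
Lemma eventually_strictly_decreasing (a0 a1 lam0 : R) (c lam : nat -> R) :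
  0 < a0 -> a0 <= a1 -> a1 < 1 -> 0 < lam0 -> (forall n, lam0 <= lam n) ->
  cvgn (series (fun n => `|c n| / lam n)) ->
  0 < limn (series (fun n => c n / lam n)) ->
  exists2 T, 1 < T & forall t, T <= t -> forall a b, a0 <= a -> a < b -> b <= a1 ->
    limn (series (fun n => c n * mittag_leffler b (- (lam n * t `^ b)))) <
    limn (series (fun n => c n * mittag_leffler a (- (lam n * t `^ a)))).
Proof.
move=> a00 a01 a11 lam00 ll cM W0.
have l0 n : 0 < lam n by exact: lt_le_trans (ll n).
pose d n := c n / lam n.
have dn n : `|d n| = `|c n| / lam n.
  by rewrite normrM normfV (gtr0_norm (l0 n)).
have cd : cvgn (series (fun n => `|d n|)) by rewrite (funext dn).
set B := limn (series (fun n => `|d n|)).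
have B0 : 0 <= B.
  have [_ h] := le_norm_lim_series (fun n => lexx `|d n|) cd.
  by apply: le_trans h.
have [C1 C10 lip] := scaled_ml_lip a00 a11 lam00.
have [C2 C20 lim] := scaled_ml_cvg a00 a11 lam00.
have [C3 bnd] := scaled_ml_bound a00 a11 lam00.
have [v v0 vle] := scaled_ml_limit_ge a00 a11 a01.
pose V a tau := limn (series (fun n => d n * scaled_ml a tau (lam n))).
have norm_series (f : nat -> R) K : (forall n, `|f n| <= K) ->
    cvgn (series (fun n => d n * f n)) /\
    `|limn (series (fun n => d n * f n))| <= K * B.
  move=> fK; have [cK <-] := cvg_seriesZ K cd.
  apply: le_norm_lim_series => // n.
  by rewrite normrM mulrC ler_wpM2r.
have cV a tau : a0 <= a <= a1 -> cvgn (series (fun n => d n * scaled_ml a tau (lam n))).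
  by move=> aa; have [] := norm_series _ C3 (fun n => bnd a tau (lam n) aa (ll n)).
have VL a b tau : a0 <= a <= a1 -> a0 <= b <= a1 -> 0 <= tau ->
    V b tau <= V a tau + C1 * `|b - a| * B.
  move=> aa bb tau0; rewrite -lerBlDl; apply: le_trans (ler_norm _) _.
  have [_ <-] := cvg_seriesB (cV b tau bb) (cV a tau aa).
  have [_] := norm_series _ _ (fun n => lip b a tau (lam n) bb aa tau0 (ll n)).
  by under eq_fun do rewrite mulrBr.
set W := limn (series (fun n => c n / lam n)) in W0.
have VW a tau : a0 <= a <= a1 -> 0 <= tau ->
    W * v - C2 * expR (- (a0 * tau)) * B <= V a tau.
  move=> aa tau0.
  have cW : cvgn (series (fun n => c n / lam n)).
    by have [] := le_norm_lim_series (fun n => lexx `|d n|) cd.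
  have [cW' EW] := cvg_seriesZ (scaled_ml_limit a) cW.
  have h : `|V a tau - scaled_ml_limit a * W| <= C2 * expR (- (a0 * tau)) * B.
    rewrite -EW; have [_ <-] := cvg_seriesB (cV a tau aa) cW'.
    have [_] := norm_series _ _ (fun n => lim a tau (lam n) aa tau0 (ll n)).
    by under eq_fun do rewrite mulrBr [d _ * scaled_ml_limit _]mulrC.
  have h2 : W * v <= scaled_ml_limit a * W by rewrite mulrC ler_wpM2r ?vle// ltW.
  by move: h; rewrite ler_norml => /andP[h _]; lra.
pose v0' := W * v / 2.
have v0'0 : 0 < v0' by rewrite divr_gt0// mulr_gt0.
(* K bounds ln t from below: the first summand makes V at least v0', half of
   the lower bound of its limit, and the second makes ln t exceed the Lipschitz
   constant C1 * B of V divided by v0' *)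
pose K := (a0 * v0')^-1 * (C2 * B) + C1 * B / v0' + 1.
have P1 : 0 <= (a0 * v0')^-1 * (C2 * B) by apply: mulr_ge0; [rewrite invr_ge0; exact: ltW (mulr_gt0 a00 v0'0)|exact: mulr_ge0].
have P2 : 0 <= C1 * B / v0' by apply: divr_ge0; [exact: mulr_ge0|exact: ltW].
have K0 : 0 < K by rewrite /K ltr_wpDl// addr_ge0.
exists (expR K); first by rewrite -expR0 ltr_expR.
move=> t Kt a b aa ab bb.
have t0 : 0 < t by exact: lt_le_trans (expR_gt0 K) Kt.
have aI : a0 <= a <= a1 by rewrite aa (le_trans (ltW ab)).
have bI : a0 <= b <= a1 by rewrite bb andbT (le_trans aa (ltW ab)).
have tauK : K <= ln t by rewrite -[leLHS]expRK ler_ln ?posrE ?expR_gt0.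
have UV x : a0 <= x <= a1 ->
    limn (series (fun n => c n * mittag_leffler x (- (lam n * t `^ x)))) =
    expR (- (x * ln t)) * V x (ln t).
  move=> xI; have [_ <-] := cvg_seriesZ (expR (- (x * ln t))) (cV x (ln t) xI).
  congr (limn (series _)); apply/funext => n.
  rewrite (mittag_leffler_scaled a00 a11 xI (l0 n) t0) /d.
  by field; rewrite gt_eqF.
have tr (x y x' y' : R) : x = x' -> y = y' -> x' < y' -> x < y by move=> -> ->.
apply: (tr _ _ _ _ (UV b bI) (UV a aI)); clear UV tr; set tau := ln t in tauK *.
have tau0 : 0 < tau by exact: lt_le_trans tauK.
have Vl : v0' <= V a tau.
  apply: le_trans (VW _ _ aI (ltW tau0)).
  suff : C2 * expR (- (a0 * tau)) * B <= v0' by rewrite /v0'; lra.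
  have h : tau * expR (- (a0 * tau)) <= a0^-1.
    rewrite expRN ler_pdivrMr ?expR_gt0// ler_pdivlMl//.
    by rewrite (le_trans _ (expR_ge1Dx _))// lerDr.
  have h3 : (a0 * v0')^-1 * (C2 * B) <= tau by apply: le_trans tauK; rewrite /K; lra.
  rewrite mulrAC -(ler_pM2l tau0) mulrCA.
  apply: (@le_trans _ _ (C2 * B * a0^-1)); first by rewrite ler_wpM2l// mulr_ge0.
  rewrite -ler_pdivrMr// (le_trans _ h3)//.
  by rewrite [(a0 * v0')^-1]invfM [leRHS]mulrC mulrA.
have dlt : 0 < b - a by rewrite subr_gt0.
have VLab := VL a b tau aI bI (ltW tau0); rewrite (gtr0_norm dlt) in VLab.
have -> : expR (- (a * tau)) = expR (- (b * tau)) * expR ((b - a) * tau).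
  by rewrite -expRD; congr expR; ring.
rewrite -mulrA ltr_pM2l ?expR_gt0//.
apply: (@lt_le_trans _ _ ((1 + (b - a) * tau) * V a tau)); last first.
  by rewrite ler_wpM2r ?expR_ge1Dx// (le_trans (ltW v0'0)).
apply: le_lt_trans VLab _; rewrite mulrDl mul1r ltrD2l.
rewrite mulrAC mulrC -mulrA ltr_pM2l//.
apply: (@lt_le_trans _ _ (tau * v0')); last by rewrite ler_pM2l.
rewrite -ltr_pdivrMr// (lt_le_trans _ tauK)// /K.
by rewrite ltr_pwDr// lerDr.
Qed.

End sequences.

(** * Eigenfunction expansions *)

Section eigenfunctions.
Context (R : realType).
Notation mu := (@lebesgue_measure R).
Variable L : R.
Hypothesis L0 : 0 < L.
Local Notation D := (`]0, L[%classic : set R).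

Lemma sin_natpi (n : nat) : sin (n%:R * pi : R) = 0.
Proof.
elim: n => [|n IH]; first by rewrite mul0r sin0.
by rewrite -natr1 mulrDl mul1r sinD IH mul0r sinpi mulr0 addr0.
Qed.

Lemma eigenfunE n x : eigenfunA L n x = Num.sqrt (2 / L) * sin (n%:R * phase L x).
Proof. by rewrite /eigenfunA /phase; congr (_ * sin _); rewrite !mulrA. Qed.

Lemma eigenfun_le n x : `|eigenfunA L n x| <= Num.sqrt (2 / L).
Proof.
rewrite eigenfunE normrM ger0_norm ?sqrtr_ge0// ler_piMr ?sqrtr_ge0//.
by rewrite ler_norml sin_le1 sin_geN1.
Qed.

Let trig_cont (f : R -> R) (r : R) : continuous f -> continuous (fun x => f (r * phase L x)).
Proof.
move=> cf x; apply: (@continuous_comp _ _ _ (fun x => r * phase L x) f); last exact: cf.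
by apply: cvgMr; exact: continuous_phase.
Qed.

Lemma continuous_eigenfun n : continuous (eigenfunA L n).
Proof.
rewrite (funext (eigenfunE n)) => x; apply: cvgMr.
exact: (trig_cont (@continuous_sin R)).
Qed.

Lemma isL2_eigenfun n : isL2 L (eigenfunA L n).
Proof. by apply: isL2_continuous => //; apply: continuous_subspaceT; exact: continuous_eigenfun. Qed.

Lemma is_derive_phase (r x : R) : is_derive x 1 (fun x => r * phase L x) (r * (pi / L)).
Proof.
rewrite (_ : (fun x => _) = (fun x => (r * (pi / L)) * x)); last first.
  by apply/funext => y; rewrite /phase; field; rewrite gt_eqF.
by apply: is_derive_eq; rewrite /GRing.scale/= mulr1.
Qed.

Let integral_cos (r : R) : r != 0 -> sin (r * pi) = 0 ->
  \int[mu]_(x in D) cos (r * phase L x) = 0.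
Proof.
move=> r0 sr; pose F x := (r * (pi / L))^-1 * sin (r * phase L x).
have k0 : r * (pi / L) != 0 by rewrite mulf_neq0// gt_eqF// divr_gt0// pi_gt0.
have dF (x : R) : is_derive x 1 F (cos (r * phase L x)).
  have h := is_derive_phase r x.
  rewrite /F; move: (r * (pi / L)) k0 h => k k0 h.
  by apply: is_derive_eq; rewrite /GRing.scale/=; field.
have FT : (\int[mu]_(x in `[0%R, L]) (cos (r * phase L x))%:E = (F L)%:E - (F 0)%:E)%E.
  apply: continuous_FTC2 => //.
  - by apply: continuous_subspaceT; exact: (trig_cont (@continuous_cos R)).
  - have cF x : {for x, continuous F}.
      exact: is_derive_continuous (dF x).
    split; first by move=> x _; have [] := dF x.
      by apply: cvg_at_right_filter; exact: cF.
    by apply: cvg_at_left_filter; exact: cF.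
  - by move=> x _; rewrite derive1E (@derive_val _ _ _ _ _ _ _ (dF x)).
rewrite integral_itv_bndoo in FT; last first.
  apply/measurable_EFinP; apply: measurable_funTS; apply: continuous_measurable_fun.
  exact: (trig_cont (@continuous_cos R)).
rewrite /Rintegral FT /=.
rewrite /F /phase !(mulr0, mul0r, sin0, subr0).
by rewrite mulfK ?gt_eqF// sr mulr0.
Qed.

Lemma eigenfun_orthonormal i j : (0 < i)%N -> (0 < j)%N ->
  \int[mu]_(x in D) (eigenfunA L i x * eigenfunA L j x) = (i == j)%:R.
Proof.
move=> i0 j0.
have E x : eigenfunA L i x * eigenfunA L j x =
    L^-1 * (cos ((i%:R - j%:R) * phase L x) - cos ((i%:R + j%:R) * phase L x)).
  rewrite !eigenfunE mulrACA -expr2 sqr_sqrtr ?divr_ge0// ?(ltW L0)//.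
  have e1 : (i%:R - j%:R) * phase L x = i%:R * phase L x - j%:R * phase L x by ring.
  have e2 : (i%:R + j%:R) * phase L x = i%:R * phase L x + j%:R * phase L x by ring.
  rewrite e1 e2; clear e1 e2; move: (i%:R * phase L x) (j%:R * phase L x) => u v.
  by rewrite cosB cosD; field; rewrite gt_eqF.
have ic r : mu.-integrable D (EFin \o (fun x => cos (r * phase L x))).
  apply: continuous_itv_integrable (ltW L0) _.
  by apply: continuous_subspaceT; exact: (trig_cont (@continuous_cos R)).
under eq_Rintegral do rewrite E.
rewrite RintegralZl//; last exact: integrable_subr.
rewrite RintegralB//.
rewrite (integral_cos (r := i%:R + j%:R)); last first.
- by rewrite mulrDl sinD !sin_natpi mul0r mulr0 addr0.
- by rewrite -natrD pnatr_eq0 addn_eq0 negb_and -!lt0n i0.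
rewrite subr0; have [->|ij] := eqVneq i j.
  rewrite subrr; under eq_Rintegral do rewrite mul0r cos0.
  by rewrite Rintegral_cst//= lebesgue_measure_itv/= lte_fin L0/= subr0 mul1r mulVf// gt_eqF.
rewrite integral_cos ?mulr0//.
  by rewrite subr_eq0 eqr_nat.
by rewrite mulrBl sinB !sin_natpi mul0r mulr0 subr0.
Qed.

Lemma continuous_sine_partial_sum (c : nat -> R) N :
  continuous (fun x => series (fun k => c k * eigenfunA L k.+1 x) N).
Proof.
elim: N => [|N IH] x.
  rewrite (_ : (fun x => _) = fun=> 0); first exact: cvg_cst.
  by apply/funext => y; rewrite /series /= big_geq.
rewrite (_ : (fun x => _) = fun x => series (fun k => c k * eigenfunA L k.+1 x) N +
    c N * eigenfunA L N.+1 x); last first.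
  by apply/funext => y; rewrite /series /= big_nat_recr.
by apply: cvgD; [exact: IH|apply: cvgMr; exact: continuous_eigenfun].
Qed.

(** Comparison with the telescoping series of 2 (1/(k+1) - 1/(k+2)). *)
Lemma cvg_series_inv_sqr (u : nat -> R) (K : R) :
  (forall k, `|u k| <= K / k.+1%:R ^+ 2) -> cvgn (series u).
Proof.
move=> uK; pose v (k : nat) := K * (2 * (k.+1%:R^-1 - k.+2%:R^-1)).
have K0 : 0 <= K by have := le_trans (normr_ge0 _) (uK 0%N); rewrite expr1n divr1.
have uv n : `|u n| <= v n.
  apply: le_trans (uK n) _; rewrite ler_wpM2l//.
  have n1 : (0 : R) < n.+1%:R by rewrite ltr0n.
  have n2 : (0 : R) < n.+2%:R by rewrite ltr0n.
  have -> : 2 * (n.+1%:R^-1 - n.+2%:R^-1) = (2 / n.+2%:R) / n.+1%:R :> R.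
    rewrite -[n.+2]addn1 natrD in n2 *; field; rewrite !gt_eqF//.
  rewrite expr2 invfM ler_wpM2r ?invr_ge0 ?(ltW n1)//.
  rewrite ler_pdivlMr// ler_pdivrMl// -natrM ler_nat.
  by rewrite muln2 doubleS !ltnS -addnn leq_addr.
apply: (le_norm_lim_series uv _).1; apply/cvg_ex; exists (K * 2 * 1).
have -> : series v = (fun n => K * 2 * (1 - n.+1%:R^-1)).
  apply/funext => n; rewrite /series /=.
  elim: n => [|n IH]; first by rewrite big_geq// invr1 subrr mulr0.
  by rewrite big_nat_recr//= IH /v; ring.
apply: cvgMr; rewrite -[X in _ --> X]subr0; apply: cvgB; first exact: cvg_cst.
exact: cvg_harmonic.
Qed.

Section sine_series.
Variables (c : nat -> R) (K : R).
Hypothesis cK : forall k, `|c k| <= K / k.+1%:R ^+ 2.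

Let M (k : nat) := Num.sqrt (2 / L) * (K / k.+1%:R ^+ 2).

Let uM n x : `|c n * eigenfunA L n.+1 x| <= M n.
Proof.
rewrite normrM mulrC /M; apply: ler_pM => //; exact: eigenfun_le.
Qed.

Let cM : cvgn (series M).
Proof.
apply: (@cvg_series_inv_sqr _ (Num.sqrt (2 / L) * K)) => k.
have K0 : 0 <= K / k.+1%:R ^+ 2 by exact: le_trans (normr_ge0 _) (cK k).
by rewrite /M normrM !ger0_norm ?sqrtr_ge0// mulrA.
Qed.

Definition sine_sum (x : R) := limn (series (fun k => c k * eigenfunA L k.+1 x)).
Let S N x := series (fun k => c k * eigenfunA L k.+1 x) N.

Lemma continuous_sine_sum : {within `[0, L], continuous sine_sum}.
Proof.
apply: (@Mtest_continuous R _ (fun k x => c k * eigenfunA L k.+1 x) M (fun n x _ => uM n x) cM).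
move=> n; apply: continuous_subspaceT => x; apply: cvgMr; exact: continuous_eigenfun.
Qed.

Let S_cont N : continuous (S N).
Proof. exact: continuous_sine_partial_sum. Qed.

Let S_L2 N : isL2 L (S N).
Proof. by apply: isL2_continuous => //; apply: continuous_subspaceT; exact: S_cont. Qed.

Let diff_L2 N : isL2 L (fun x => sine_sum x - S N x).
Proof. by apply: isL2_sub => //; apply: isL2_continuous => //; exact: continuous_sine_sum. Qed.

Lemma sine_sum_norm2 :
  norm2 L (sine_sum \- (fun x => series (fun k => c k * eigenfunA L k.+1 x) N)) @[N --> \oo] --> 0%E.
Proof.
apply: (@norm2_uniform_cvg0 _ _ (fun N x => sine_sum x - S N x) (fun N => limn (series M) - series M N)) => //.
- by move=> k; exact: isL2_measurable (diff_L2 k).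
- move=> N x _; exact: (@Mtest_tail R setT (fun k x => c k * eigenfunA L k.+1 x) M (fun n x _ => uM n x) cM N x I).
- exact: Mtest_tail_cvg0 cM.
Qed.

(** Uniform convergence gives L^2 convergence, so the coefficients of the partial
    sums, known by orthonormality, converge to those of the sum. *)
Lemma eigencoef_sine_sum j : eigencoef L sine_sum j.+1 = c j.
Proof.
have vL := isL2_eigenfun j.+1.
have := L2_cvg0_mul diff_L2 vL ((norm2_cvg0 diff_L2).1 sine_sum_norm2).
have sL : isL2 L sine_sum by apply: isL2_continuous => //; exact: continuous_sine_sum.
have val N : (j < N)%N -> \int[mu]_(x in D) ((sine_sum x - S N x) * eigenfunA L j.+1 x) =
    eigencoef L sine_sum j.+1 - c j.
  move=> jN; under eq_Rintegral do rewrite mulrBl.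
  rewrite RintegralB//; [|exact: isL2_mul..].
  congr (_ - _).
  under eq_Rintegral do rewrite /S /series /= mulr_suml.
  rewrite Rintegral_sum//; last first.
    move=> i; apply: isL2_mul => //; apply: isL2_scale; exact: isL2_eigenfun.
  under eq_bigr => i _.
    under eq_Rintegral do rewrite -mulrA.
    rewrite RintegralZl//; last by apply: isL2_mul => //; exact: isL2_eigenfun.
    rewrite eigenfun_orthonormal//; over.
  rewrite (bigD1_seq j) ?mem_index_iota ?iota_uniq//= eqxx mulr1.
  rewrite big1 ?addr0// => i ij; rewrite eqSS (negbTE ij) mulr0//.
move=> H; apply/eqP; rewrite -subr_eq0; apply/eqP.
apply: (cvg_unique _ _ H) => //; apply: (cvg_near_cst).
by exists j.+1 => // N /= jN; rewrite val.
Qed.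

End sine_series.

Section mild.
Variables (kappa q : R) (phi : R -> R).
Hypotheses (k0 : 0 < kappa) (q0 : 0 <= q) (phiL : isL2 L phi).

Lemma eigencoef_bound : exists2 K, 0 <= K & forall n, `|eigencoef L phi n| <= K.
Proof.
have ip := isL2_integrable phiL.
exists (\int[mu]_(x in D) (Num.sqrt (2 / L) * `|phi x|)).
  by apply: Rintegral_ge0 => x _; rewrite mulr_ge0 ?sqrtr_ge0.
move=> n; apply: le_norm_Rintegral => //.
- by apply: isL2_mul => //; exact: isL2_eigenfun.
- by apply: integrable_mull => //; exact: integrable_norm.
- by move=> x _; rewrite normrM mulrC ler_wpM2r// eigenfun_le.
Qed.

Lemma eigenvalue_ge k : kappa * (pi / L) ^+ 2 * k.+1%:R ^+ 2 <= eigenvalueA L kappa q k.+1.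
Proof.
rewrite /eigenvalueA -[leLHS]addr0 lerD// le_eqVlt; apply/orP; left; apply/eqP.
by rewrite !exprMn; ring.
Qed.

Lemma eigenvalue_unit_gt0 : 0 < kappa * (pi / L) ^+ 2.
Proof. by rewrite mulr_gt0// exprn_gt0// divr_gt0// pi_gt0. Qed.

Lemma eigenvalue_ge1 k : kappa * (pi / L) ^+ 2 <= eigenvalueA L kappa q k.+1.
Proof.
apply: le_trans (eigenvalue_ge k); rewrite ler_peMr ?(ltW eigenvalue_unit_gt0)//.
by rewrite exprn_ege1// ler1n.
Qed.

Lemma eigenvalue_gt0 k : 0 < eigenvalueA L kappa q k.+1.
Proof. exact: lt_le_trans eigenvalue_unit_gt0 (eigenvalue_ge1 k). Qed.

Lemma coef_over_eigenvalue (f : nat -> R) C : (forall k, `|f k| <= C) ->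
  exists K, forall k,
    `|eigencoef L phi k.+1 / eigenvalueA L kappa q k.+1 * f k| <= K / k.+1%:R ^+ 2.
Proof.
move=> fC; have [B B0 pB] := eigencoef_bound.
exists (B / (kappa * (pi / L) ^+ 2) * C) => k.
have l0 := eigenvalue_gt0 k; have u0 := eigenvalue_unit_gt0.
have n0 : (0 : R) < k.+1%:R ^+ 2 by rewrite exprn_gt0// ltr0n.
rewrite !normrM normfV (gtr0_norm l0).
have lk := eigenvalue_ge k; set U := kappa * (pi / L) ^+ 2 in u0 lk *.
rewrite [leRHS](_ : _ = B / (U * k.+1%:R ^+ 2) * C); last by rewrite [in RHS]invfM; ring.
apply: ler_pM; rewrite ?mulr_ge0 ?invr_ge0 ?(ltW l0)//.
apply: ler_pM; rewrite ?invr_ge0 ?(ltW l0)//.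
by rewrite lef_pV2 ?posrE// mulr_gt0.
Qed.

(** The coefficients phi_n E_a(- lambda_n t^a) are O(n^-2), so the series
    converges uniformly to a continuous function; [mild_solution] agrees with it
    inside the interval because continuous L^2 limits are unique there. *)
Lemma mild_solutionE (a t x : R) : 0 < a < 1 -> 1 <= t -> 0 < x < L ->
  mild_solution L kappa q phi a t x =
  limn (series (fun k => eigencoef L phi k.+1 * eigenfunA L k.+1 x *
    mittag_leffler a (- (eigenvalueA L kappa q k.+1 * t `^ a)))).
Proof.
move=> /andP[a0 a1] t1 xL; have t0 : 0 < t by exact: lt_le_trans t1.
pose c k := eigencoef L phi k.+1 * mittag_leffler a (- eigenvalueA L kappa q k.+1 * t `^ a).
have [C bC] := scaled_ml_bound a0 a1 eigenvalue_unit_gt0.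
have aa : a <= a <= a by rewrite lexx.
have cE k : c k = eigencoef L phi k.+1 / eigenvalueA L kappa q k.+1 *
    (expR (- (a * ln t)) * scaled_ml a (ln t) (eigenvalueA L kappa q k.+1)).
  rewrite /c mulNr (mittag_leffler_scaled a0 a1 aa (eigenvalue_gt0 k) t0).
  by field; rewrite gt_eqF// eigenvalue_gt0.
have [K cK] : exists K, forall k, `|c k| <= K / k.+1%:R ^+ 2.
  have [|K cK] := @coef_over_eigenvalue (fun k => expR (- (a * ln t)) * scaled_ml a (ln t) (eigenvalueA L kappa q k.+1)) C.
    move=> k; rewrite normrM (gtr0_norm (expR_gt0 _)) -[leRHS]mul1r.
    apply: ler_pM; rewrite ?expR_ge0 ?bC ?eigenvalue_ge1//.
    by rewrite -[leRHS]expR0 ler_expR oppr_le0 mulr_ge0 ?(ltW a0)// ln_ge0.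
  by exists K => k; rewrite cE.
have mE N y : mild_partial_sum L kappa q phi a t N y =
    series (fun k => c k * eigenfunA L k.+1 y) N.
  by rewrite /mild_partial_sum /series /= big_add1.
have sS : [set w : R -> R | {within `[0, L], continuous w} /\
    norm2 L (w \- mild_partial_sum L kappa q phi a t N) @[N --> \oo] --> 0%E] (sine_sum c).
  split; first exact: continuous_sine_sum cK.
  under eq_fun do rewrite (funext (mE _)).
  exact: sine_sum_norm2 cK.
have [wc wn] := getPex (ex_intro _ _ sS); case: sS => sc sn.
rewrite /mild_solution.
have SL N : isL2 L (mild_partial_sum L kappa q phi a t N).
  apply: isL2_continuous => //; apply: continuous_subspaceT => y.
  by rewrite (funext (mE N)); exact: continuous_sine_partial_sum.
rewrite (L2_limit_unique L0 SL wc sc wn sn xL) /sine_sum.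
congr (limn (series _)); apply/funext => k; rewrite /c mulNr; ring.
Qed.

End mild.
End eigenfunctions.

(** * Integration by parts for primitives of integrable functions *)

Section primitives.
Context (R : realType).
Notation mu := (@lebesgue_measure R).

Lemma integrable_indic_mul (E : set R) (f : R -> R) : measurable E ->
  mu.-integrable E (EFin \o f) -> mu.-integrable setT (EFin \o (fun x => \1_E x * f x)).
Proof.
move=> mE h; have := (@integrable_mkcond _ _ _ mu E (EFin \o f) mE).1 h.
rewrite (_ : (EFin \o f) \_ E = EFin \o (fun x => \1_E x * f x))//.
apply/funext => x /=; rewrite patchE indicE.
by case: (x \in E); rewrite ?mul1r ?mul0r.
Qed.

Lemma Rintegral_indic_mul (E : set R) (f : R -> R) : measurable E ->
  \int[mu]_x (\1_E x * f x) = \int[mu]_(x in E) f x.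
Proof. by move=> mE; rewrite -(@Rintegral_restrict_sub _ _ _ mu). Qed.

Let EFin_Rintegral (f : R -> R) : mu.-integrable setT (EFin \o f) ->
  (\int[mu]_x (f x)%:E)%E = (\int[mu]_x f x)%:E.
Proof. by move=> /integrable_fin_num h; rewrite /Rintegral fineK//; exact: h. Qed.

(** Exchange of integrations over the part of a product integrand that lies in K,
    with the inner integrals written as functions of the outer variable. *)
Section kernel_fubini.
Variables (K : set (R * R)) (A B : R -> R).
Hypothesis mK : measurable K.
Hypotheses (iA : mu.-integrable setT (EFin \o A)) (iB : mu.-integrable setT (EFin \o B)).

Let f (p : R * R) := (\1_K p * (B p.1 * A p.2))%:E.

Let mf : measurable_fun setT f.
Proof.
apply/measurable_EFinP; apply: measurable_funM.
  by apply: measurable_indic.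
apply: measurable_funM.
  exact: (measurableT_comp (integrable_measurable iB) measurable_fst).
exact: (measurableT_comp (integrable_measurable iA) measurable_snd).
Qed.

Let k_le p : `|\1_K p| <= 1 :> R.
Proof. by rewrite indicE; case: (_ \in _); rewrite ?normr1 ?normr0. Qed.

Let msec1 y : measurable_fun setT (fun z : R => \1_K (y, z) : R).
Proof.
have mk : measurable_fun setT (\1_K : R * R -> R) by apply: measurable_indic.
by apply: (measurableT_comp mk); apply: measurable_fun_pair.
Qed.

Let msec2 z : measurable_fun setT (fun y : R => \1_K (y, z) : R).
Proof.
have mk : measurable_fun setT (\1_K : R * R -> R) by apply: measurable_indic.
by apply: (measurableT_comp mk); apply: measurable_fun_pair.
Qed.

Let isec1 y : mu.-integrable setT (EFin \o (fun z => \1_K (y, z) * A z)).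
Proof.
apply: (@integrable_bounded_mul _ _ _ mu _ _ _ 1) => //.
exact: msec1.
Qed.

Let isec2 z : mu.-integrable setT (EFin \o (fun y => \1_K (y, z) * B y)).
Proof.
apply: (@integrable_bounded_mul _ _ _ mu _ _ _ 1) => //.
exact: msec2.
Qed.

Let if2 : (mu \x mu)%E.-integrable setT f.
Proof.
apply/integrable12ltyP => //.
apply: (@le_lt_trans _ _ (\int[mu]_y (`|B y| * \int[mu]_z `|A z|)%:E)%E).
  apply: ge0_le_integral => //.
  - by move=> y _; apply: integral_ge0.
  - apply: (@measurable_fun_fubini_tonelli_F _ _ _ _ R mu (fun p => `|f p|)%E).
    + exact: measurableT_comp.
    + by move=> p; exact: abse_ge0.
  - apply/measurable_EFinP; apply: measurable_funM => //.
    by apply: measurableT_comp => //; exact: integrable_measurable iB.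
  - move=> y _.
    have iN : mu.-integrable setT (EFin \o (fun z => `|B y| * `|A z|)).
      by apply: integrable_mull => //; exact: integrable_norm.
    rewrite -RintegralZl//; last exact: integrable_norm.
    rewrite -EFin_Rintegral//; apply: ge0_le_integral => //.
    + apply: measurableT_comp => //.
      by apply: (measurableT_comp mf).
    + exact: measurable_int iN.
    + move=> z _; rewrite /f /= lee_fin normrM -[leRHS]mul1r.
      by apply: ler_pM => //; rewrite ?normr_ge0// normrM.
have iN : mu.-integrable setT (EFin \o (fun y => `|B y| * \int[mu]_z `|A z|)).
  under eq_fun do rewrite mulrC.
  by apply: integrable_mull => //; exact: integrable_norm.
by have /integrable_fin_num := iN => // h; rewrite ltey_eq h.
Qed.

Lemma Rfubini_kernel :
  \int[mu]_y (B y * \int[mu]_z (\1_K (y, z) * A z)) =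
  \int[mu]_z (A z * \int[mu]_y (\1_K (y, z) * B y)).
Proof.
have H := @Fubini _ _ _ _ R mu mu f if2.
rewrite /Rintegral; congr fine; move: H.
have -> : (\int[mu]_x \int[mu]_y f (x, y))%E =
    (\int[mu]_y (B y * \int[mu]_z (\1_K (y, z) * A z))%:E)%E.
  apply: eq_integral => y _.
  have i1 : mu.-integrable setT (EFin \o (fun z => B y * (\1_K (y, z) * A z))).
    by apply: integrable_mull => //; exact: isec1.
  have E := EFin_Rintegral i1; rewrite RintegralZl in E => //.
  rewrite -E.
  by apply: eq_integral => z _; rewrite /f /= mulrCA.
have -> : (\int[mu]_y \int[mu]_x f (x, y))%E =
    (\int[mu]_z (A z * \int[mu]_y (\1_K (y, z) * B y))%:E)%E.
  apply: eq_integral => z _.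
  have i1 : mu.-integrable setT (EFin \o (fun y => A z * (\1_K (y, z) * B y))).
    by apply: integrable_mull => //; exact: isec2.
  have E := EFin_Rintegral i1; rewrite RintegralZl in E => //.
  rewrite -E.
  by apply: eq_integral => y _; rewrite /f /= [B y * _]mulrC mulrCA.
by [].
Qed.

End kernel_fubini.

Definition prim (a : R -> R) (x : R) := \int[mu]_(t in `[0, x]) a t.

Lemma continuous_prim a (x : R) : 0 <= x -> mu.-integrable setT (EFin \o a) ->
  {within `[0, x], continuous (prim a)}.
Proof.
move=> x0 ia; apply: (parameterized_integral_continuous x0).
by apply: (@integrableS _ _ _ mu setT).
Qed.

Lemma Rintegral_derive (psi dpsi : R -> R) (a b : R) : a <= b ->
  (forall x, is_derive x (1 : R) psi (dpsi x)) -> continuous dpsi ->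
  \int[mu]_(t in `[a, b]) dpsi t = psi b - psi a.
Proof.
rewrite le_eqVlt => /predU1P[<- _ _|ab dp cd].
  by rewrite set_itv1 Rintegral_set1 subrr.
have cp x : {for x, continuous psi}.
  exact: is_derive_continuous (dp x).
rewrite /Rintegral (@continuous_FTC2 _ dpsi psi)//.
- exact: continuous_subspaceT.
- split; first by move=> x _; have [] := dp x.
    by apply: cvg_at_right_filter; exact: cp.
  by apply: cvg_at_left_filter; exact: cp.
- by move=> x _; rewrite derive1E (@derive_val _ _ _ _ _ _ _ (dp x)).
Qed.

Lemma continuous_integrable_cc (f : R -> R) (a b : R) : continuous f ->
  mu.-integrable `[a, b] (EFin \o f).
Proof.
move=> cf; apply: continuous_compact_integrable; first exact: segment_compact.
exact: continuous_subspaceT.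
Qed.

(** Both sides are iterated integrals of a(z) psi'(y) over the triangle
    z <= y <= x, which asks no more of a than integrability. *)
Lemma prim_by_parts (a psi dpsi : R -> R) (x : R) : 0 <= x ->
  mu.-integrable setT (EFin \o a) ->
  (forall x, is_derive x (1 : R) psi (dpsi x)) -> continuous dpsi ->
  \int[mu]_(y in `[0, x]) (prim a y * dpsi y) =
  prim a x * psi x - \int[mu]_(y in `[0, x]) (a y * psi y).
Proof.
move=> x0 ia dp cd.
pose I := (`[0, x]%classic : set R).
pose A z := \1_I z * a z; pose B y := \1_I y * dpsi y.
pose K := [set p : R * R | p.2 <= p.1].
have mK : measurable K.
  have := @measurable_fun_ler _ _ R setT snd fst measurable_snd measurable_fst.
  move=> /(_ measurableT [set true] Logic.I).
  rewrite setTI (_ : _ @^-1` _ = K)//.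
have KE y z : ((y, z) \in K) = (z <= y) by apply/idP/idP; rewrite inE.
have iaE E : measurable E -> mu.-integrable E (EFin \o a).
  by move=> mE; apply: (@integrableS _ _ _ mu setT).
have mI : measurable I by exact: measurable_itv.
have iA : mu.-integrable setT (EFin \o A).
  by apply: integrable_indic_mul => //; exact: iaE.
have iB : mu.-integrable setT (EFin \o B).
  by apply: integrable_indic_mul => //; exact: continuous_integrable_cc.
have := Rfubini_kernel mK iA iB.
have -> : \int[mu]_y (B y * \int[mu]_z (\1_K (y, z) * A z)) =
    \int[mu]_(y in `[0, x]) (prim a y * dpsi y).
  rewrite -[RHS]Rintegral_indic_mul//; apply: eq_Rintegral => y _; rewrite /B.
  rewrite -/I indicE; case: (boolP (y \in I)) => yI; last by rewrite !mul0r.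
  rewrite !mul1r mulrC; congr (_ * _).
  rewrite /prim -[RHS]Rintegral_indic_mul//; apply: eq_Rintegral => z _.
  rewrite /A mulrA; congr (_ * _).
  move: yI; rewrite inE /I /= in_itv/= => /andP[y0 yx].
  rewrite !indicE KE !mem_setE !in_itv/=.
  case: (leP z y) => zy; last by rewrite mul0r andbF.
  by rewrite mul1r (le_trans zy yx).
have -> : \int[mu]_z (A z * \int[mu]_y (\1_K (y, z) * B y)) =
    \int[mu]_(z in `[0, x]) (a z * (psi x - psi z)).
  rewrite -[RHS]Rintegral_indic_mul//; apply: eq_Rintegral => z _; rewrite /A.
  rewrite -/I -mulrA indicE; case: (boolP (z \in I)) => zI; last by rewrite !mul0r.
  rewrite !mul1r; congr (_ * _).
  move: zI; rewrite inE /I /= in_itv/= => /andP[z0 zx].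
  rewrite -(Rintegral_derive zx dp cd) -[RHS]Rintegral_indic_mul//.
  apply: eq_Rintegral => y _.
  rewrite /B mulrA; congr (_ * _).
  rewrite !indicE KE !mem_setE !in_itv/=.
  case: (leP z y) => zy; last by rewrite mul0r.
  by rewrite mul1r (le_trans z0 zy).
move=> ->.
have cp : continuous psi.
  by move=> y; exact: is_derive_continuous (dp y).
have iap : mu.-integrable `[0, x] (EFin \o (fun y => a y * psi y)).
  have [M M0 pM] := within_continuous_bounded x0 (continuous_subspaceT cp).
  rewrite (_ : EFin \o _ = EFin \o (fun y => psi y * a y)); last first.
    by apply/funext => y /=; rewrite mulrC.
  apply: (@integrable_bounded_mul _ _ _ mu _ _ _ M) => //; last exact: iaE.
  by apply: measurable_funTS; exact: continuous_measurable_fun.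
under eq_Rintegral do rewrite mulrBr.
rewrite RintegralB//; last first.
  rewrite (_ : EFin \o _ = EFin \o (fun y => psi x * a y)); last first.
    by apply/funext => y /=; rewrite mulrC.
  by apply: integrable_mull => //; exact: iaE.
congr (_ - _).
under eq_Rintegral do rewrite mulrC.
by rewrite RintegralZl//; [rewrite mulrC|exact: iaE].
Qed.

End primitives.

(** * Cutoffs and test functions *)

Section cutoff_profile.
Context (R : realType).
Implicit Types e x y : R.

(** A quadratic two-sided estimate suits a function defined by cases, such as the
    square of a positive part at its corner. *)
Lemma is_derive_quadratic (f : R -> R) (x d C : R) : 0 <= C ->
  (forall h, `|f (x + h) - f x - d * h| <= C * h ^+ 2) -> is_derive x 1 f d.
Proof.
move=> C0 H.
have c : (h^-1 *: ((f \o shift x) (h *: (1 : R)) - f x)) @[h --> 0^'] --> d.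
  apply/cvgrPdist_lt => eps eps0; near=> h.
  have h0 : h != 0 by near: h; exact: nbhs_dnbhs_neq.
  have hs : `|h| < eps / (C + 1).
    near: h; apply: dnbhs0_lt; rewrite divr_gt0// ltr_wpDl//.
  have -> : d - h^-1 *: ((f \o shift x) (h *: (1 : R)) - f x) =
      - h^-1 * (f (x + h) - f x - d * h).
    rewrite /GRing.scale /= mulr1 [h + x]addrC; field; rewrite h0//.
  rewrite normrM normrN normfV ltr_pdivrMl ?normr_gt0//.
  apply: le_lt_trans (H h) _.
  rewrite -(real_normK (num_real h)) expr2 mulrCA ltr_pM2l ?normr_gt0//.
  apply: (@le_lt_trans _ _ ((C + 1) * `|h|)).
    by rewrite ler_wpM2r// lerDl.
  by rewrite -ltr_pdivlMl ?ltr_wpDl// mulrC.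
apply: DeriveDef; first by apply/cvg_ex; exists d.
by apply: cvg_lim.
Unshelve. all: by end_near. Qed.

Definition pos_part e y : R := Num.max (y - e) 0.

Lemma pos_part_ge0 e y : 0 <= pos_part e y.
Proof. by rewrite /pos_part le_max lexx orbT. Qed.

Lemma pos_part_eq0 e y : y <= e -> pos_part e y = 0.
Proof. by move=> h; apply/max_idPr; rewrite subr_le0. Qed.

Lemma pos_part_sub e y : e <= y -> pos_part e y = y - e.
Proof. by move=> h; apply/max_idPl; rewrite subr_ge0. Qed.

Lemma is_derive_pos_part_sqr e y :
  is_derive y 1 (fun y => pos_part e y ^+ 2) (2 * pos_part e y).
Proof.
apply: (@is_derive_quadratic _ _ _ 1) => // h; rewrite mul1r.
have [ey|ye] := leP e y; have [ey'|ye'] := leP e (y + h).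
- rewrite !pos_part_sub// (_ : _ - _ = h ^+ 2); last by ring.
  by rewrite ger0_norm ?sqr_ge0.
- rewrite (pos_part_sub ey) (pos_part_eq0 (ltW ye')) expr0n/=.
  rewrite ler_norml; apply/andP; split; nra.
- rewrite (pos_part_sub ey') (pos_part_eq0 (ltW ye)) expr0n/=.
  rewrite ler_norml; apply/andP; split; nra.
- rewrite !pos_part_eq0 ?(ltW ye) ?(ltW ye')//.
  rewrite (_ : _ - _ = 0); last by ring.
  by rewrite normr0 sqr_ge0.
Qed.

Lemma continuous_pos_part e : continuous (pos_part e).
Proof.
move=> y; rewrite /pos_part.
apply: (@continuous_comp _ _ _ (fun y => y - e) (fun z => Num.max z 0)).
  by apply: cvgB; [exact: cvg_id|exact: cvg_cst].
rewrite (_ : (fun z => Num.max z 0) = fun z => 2^-1 * (z + `|z|)).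
  by apply: cvgMr; apply: cvgD; [exact: cvg_id|exact: norm_continuous].
apply/funext => z; have [z0|z0] := leP 0 z.
  by rewrite ger0_norm//; field.
by rewrite ltr0_norm// subrr mulr0.
Qed.

(** Three properties dictate the formula: it is C^1 and vanishes for y <= e; it
    tends to 1 for every y > 0 as e tends to 0; and y times its derivative stays
    bounded uniformly in e. *)
Definition ramp e y : R := pos_part e y ^+ 2 / (pos_part e y ^+ 2 + e ^+ 2).
Definition dramp e y : R :=
  2 * pos_part e y * e ^+ 2 / (pos_part e y ^+ 2 + e ^+ 2) ^+ 2.

Section ramp_facts.
Variable e : R.
Hypothesis e0 : 0 < e.

Let den y := pos_part e y ^+ 2 + e ^+ 2.
Let den_gt0 y : 0 < den y.
Proof. by rewrite /den ltr_wpDl ?sqr_ge0// exprn_gt0. Qed.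

Lemma is_derive_ramp y : is_derive y 1 (ramp e) (dramp e y).
Proof.
have h := is_derive_pos_part_sqr e y.
have d0 : den y != 0 by rewrite gt_eqF.
have hd : is_derive y 1 den (2 * pos_part e y).
  by apply: is_derive_eq; rewrite addr0.
have hv := is_deriveV d0 hd.
have := is_deriveM h hv; rewrite /ramp /dramp -/(den y) => hm.
apply: (is_derive_eq hm); rewrite /GRing.scale/=.
move: d0; rewrite /den; move: (pos_part e y) => p d0; field.
by rewrite d0.
Qed.

Lemma continuous_ramp : continuous (ramp e).
Proof.
by move=> y; exact: is_derive_continuous (is_derive_ramp y).
Qed.

Lemma continuous_dramp : continuous (dramp e).
Proof.
move=> y; have cp := @continuous_pos_part e y.
apply: cvgM; first by apply: cvgM; [apply: cvgM; [exact: cvg_cst|exact: cp]|exact: cvg_cst].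
have cd : {for y, continuous den} by apply: cvgD; [apply: cvgM; exact: cp|exact: cvg_cst].
apply: cvgV; first by rewrite expf_neq0// gt_eqF// den_gt0.
by apply: cvgM; exact: cd.
Qed.

Lemma ramp_ge0_le1 y : 0 <= ramp e y <= 1.
Proof.
rewrite /ramp divr_ge0 ?sqr_ge0 ?(ltW (den_gt0 y))//= ler_pdivrMr ?den_gt0//.
by rewrite mul1r lerDl sqr_ge0.
Qed.

Lemma ramp_eq0 y : y <= e -> ramp e y = 0.
Proof. by move=> ye; rewrite /ramp pos_part_eq0// expr0n/= mul0r. Qed.

Lemma dramp_eq0 y : y <= e -> dramp e y = 0.
Proof. by move=> ye; rewrite /dramp pos_part_eq0// mulr0 !mul0r. Qed.

Lemma dramp_le y : 0 <= y -> 0 <= y * dramp e y <= 3.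
Proof.
move=> y0; have p0 := pos_part_ge0 e y; have d0 := den_gt0 y.
apply/andP; split.
  rewrite mulr_ge0// /dramp divr_ge0 ?sqr_ge0//.
  by rewrite mulr_ge0 ?sqr_ge0// mulr_ge0.
have yp : y <= pos_part e y + e.
  by rewrite -lerBlDr /pos_part le_max lexx.
rewrite /dramp mulrA -/(den y) ler_pdivrMr ?exprn_gt0//.
apply: (@le_trans _ _ ((pos_part e y + e) * (2 * pos_part e y * e ^+ 2))).
  by apply: ler_wpM2r => //; apply: mulr_ge0; [exact: mulr_ge0|exact: sqr_ge0].
rewrite /den; move: (pos_part e y) p0 => p p0.
have h1 : 2 * p * (p + e) <= 3 * (p ^+ 2 + e ^+ 2) by have := sqr_ge0 (p - e); nra.
have -> : (p + e) * (2 * p * e ^+ 2) = 2 * p * (p + e) * e ^+ 2 by ring.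
rewrite [X in _ <= 3 * X]expr2 [leRHS]mulrA; apply: ler_pM; rewrite ?sqr_ge0 ?lerDr ?sqr_ge0//.
by apply: mulr_ge0; [exact: mulr_ge0|rewrite addr_ge0// ltW].
Qed.

End ramp_facts.

Let en (k : nat) : R := k.+1%:R^-1.
Let en_cvg : en k @[k --> \oo] --> (0 : R).
Proof. exact: cvg_harmonic. Qed.

Let pos_part_cvg y : 0 < y -> pos_part (en k) y @[k --> \oo] --> y.
Proof.
move=> y0; have h : y - en k @[k --> \oo] --> y.
  by rewrite -[X in _ --> X]subr0; apply: cvgB; [exact: cvg_cst|exact: en_cvg].
apply: cvg_trans h; apply: near_eq_cvg.
have /cvgrPdist_lt/(_ _ y0) := en_cvg.
apply: filterS => k; rewrite sub0r normrN => kl.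
by rewrite pos_part_sub// ltW// (le_lt_trans (ler_norm _)).
Qed.

Lemma ramp_cvg y : 0 < y -> ramp k.+1%:R^-1 y @[k --> \oo] --> (1 : R).
Proof.
move=> y0; have h := pos_part_cvg y0.
have hs : pos_part (en k) y ^+ 2 @[k --> \oo] --> y ^+ 2 by apply: cvgM; exact: h.
have : ramp (en k) y @[k --> \oo] --> y ^+ 2 / (y ^+ 2 + 0 ^+ 2).
  apply: cvgM; first exact: hs.
  apply: cvgV; first by rewrite expr0n/= addr0 expf_neq0// gt_eqF.
  by apply: cvgD; [exact: hs|apply: cvgM; exact: en_cvg].
by rewrite expr0n/= addr0 divff// expf_neq0// gt_eqF.
Qed.

Lemma dramp_cvg y : 0 < y -> dramp k.+1%:R^-1 y @[k --> \oo] --> (0 : R).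
Proof.
move=> y0; have h := pos_part_cvg y0.
have hs : pos_part (en k) y ^+ 2 @[k --> \oo] --> y ^+ 2 by apply: cvgM; exact: h.
have he : en k ^+ 2 @[k --> \oo] --> (0 : R) ^+ 2 by apply: cvgM; exact: en_cvg.
have hd : pos_part (en k) y ^+ 2 + en k ^+ 2 @[k --> \oo] --> y ^+ 2 + 0 ^+ 2 by apply: cvgD.
have : dramp (en k) y @[k --> \oo] --> 2 * y * 0 ^+ 2 / (y ^+ 2 + 0 ^+ 2) ^+ 2.
  apply: cvgM; first by apply: cvgM => //; apply: cvgM; [exact: cvg_cst|exact: h].
  apply: cvgV; first by rewrite expf_neq0// expr0n/= addr0 expf_neq0// gt_eqF.
  by apply: cvgM; exact: hd.
by rewrite expr0n/= mulr0 mul0r.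
Qed.

End cutoff_profile.

Section cutoff.
Context (R : realType).
Notation mu := (@lebesgue_measure R).
Variables (L : R) (h h1 : R -> R) (M : R).
Hypotheses (L0 : 0 < L).
Hypothesis dh : forall x : R, 0 < x < L -> is_derive x 1 h (h1 x).
Hypothesis ch1 : forall x : R, 0 < x < L -> {for x, continuous h1}.
Hypotheses (hM : forall x : R, 0 < x < L -> `|h x| <= M)
  (h1M : forall x : R, 0 < x < L -> `|h1 x| <= M).
Local Notation D := (`]0, L[%classic : set R).

(** A smooth substitute for the distance to the boundary. *)
Definition bump (x : R) := x * (L - x).

Lemma bump_gt0 x : (0 < bump x) = (0 < x < L).
Proof.
apply/idP/andP => [|[x0 xL]]; last by rewrite mulr_gt0// subr_gt0.
rewrite /bump; have [x0|x0] := ltP 0 x; first by rewrite pmulr_rgt0// subr_gt0.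
rewrite ltNge mulr_le0_ge0// subr_ge0.
exact: le_trans x0 (ltW L0).
Qed.

Definition cutoff e x := ramp e (bump x) * h x.
Definition dcutoff e x :=
  dramp e (bump x) * (L - 2 * x) * h x + ramp e (bump x) * h1 x.

Let db (x : R) : is_derive x 1 bump (L - 2 * x).
Proof. by apply: is_derive_eq; rewrite /GRing.scale/=; ring. Qed.

Let cb : continuous bump.
Proof.
by move=> x; exact: is_derive_continuous (db x).
Qed.

(** Outside the open interval and near its ends the cutoff is identically zero,
    whatever h does there. *)
Let near_low e x : 0 < e -> ~~ (0 < x < L) -> \forall y \near x, bump y <= e.
Proof.
move=> e0; rewrite -bump_gt0 -leNgt => bx.
have := @cb x => /cvgrPdist_lt/(_ _ e0); apply: filterS => y.
rewrite distrC => /(le_lt_trans (ler_norm _)) /ltW.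
by rewrite lerBlDr => /le_trans; apply; rewrite gerDl.
Qed.

Lemma is_derive_cutoff (e x : R) : 0 < e -> is_derive x (1 : R) (cutoff e) (dcutoff e x).
Proof.
move=> e0; have [xL|xL] := boolP (0 < x < L).
  have dr : is_derive x 1 (ramp e \o bump) (dramp e (bump x) * (L - 2 * x)).
    have := is_derive1_comp (is_derive_ramp e0 (bump x)) (db x).
    by move=> hr; apply: (is_derive_eq hr); rewrite /GRing.scale/=.
  have := is_deriveM dr (dh xL) => hm.
  by apply: (is_derive_eq hm); rewrite /dcutoff /GRing.scale/=; ring.
have nl := near_low e0 xL.
have bx : bump x <= e by exact: nbhs_singleton nl.
rewrite /dcutoff dramp_eq0// ramp_eq0// !mul0r addr0.
have hc : is_derive x (1 : R) (cst (0 : R) : R -> R) (0 : R) by exact: is_derive_cst.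
apply: (near_eq_is_derive _ hc).
by apply: filterS nl => y ye; rewrite /cutoff ramp_eq0// mul0r.
Qed.

Lemma derive1_cutoff e : 0 < e -> derive1 (cutoff e) = dcutoff e.
Proof.
move=> e0; apply/funext => x.
by rewrite derive1E (@derive_val _ _ _ _ _ _ _ (is_derive_cutoff x e0)).
Qed.

Lemma continuous_dcutoff e : 0 < e -> continuous (dcutoff e).
Proof.
move=> e0 x; have [xL|xL] := boolP (0 < x < L); last first.
  have nl := near_low e0 xL.
  have bx : bump x <= e by exact: nbhs_singleton nl.
  have E : dcutoff e x = 0 by rewrite /dcutoff dramp_eq0// ramp_eq0// !mul0r addr0.
  rewrite /continuous_at E.
  have H : (fun=> 0 : R) @ x --> (0 : R) by exact: cvg_cst.
  apply: cvg_trans H; apply: near_eq_cvg; apply: filterS nl => y ye.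
  by rewrite /dcutoff dramp_eq0// ramp_eq0// !mul0r addr0.
have chx : {for x, continuous h}.
  exact: is_derive_continuous (dh xL).
apply: cvgD; last first.
  apply: cvgM; last exact: ch1.
  by apply: (@continuous_comp _ _ _ bump (ramp e)); [exact: cb|exact: continuous_ramp].
apply: cvgM; last exact: chx.
apply: cvgM.
  by apply: (@continuous_comp _ _ _ bump (dramp e)); [exact: cb|exact: continuous_dramp].
by apply: cvgB; [exact: cvg_cst|apply: cvgMr; exact: cvg_id].
Qed.

(** The support lies in the closed set e <= bump x, which is contained in the
    open interval. *)
Lemma test_function_cutoff e : 0 < e -> test_function L (cutoff e).
Proof.
move=> e0; split.
- by move=> x; have [] := is_derive_cutoff x e0.
- by rewrite derive1_cutoff//; exact: continuous_dcutoff.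
- have cl : closed [set x | e <= bump x].
    rewrite (_ : [set x | _] = bump @^-1` [set y | e <= y])//.
    by apply: preimage_closed; [move=> x _; exact: cb|exact: closed_ge].
  move=> x cx; rewrite /= in_itv/= -bump_gt0; apply: lt_le_trans e0 _.
  suff sub : [set x | cutoff e x != 0] `<=` [set x | e <= bump x].
    by have := closureS sub cx; rewrite -((closure_id _).1 cl).
  move=> y /=; apply: contra_neqT; rewrite -ltNge => /ltW ye.
  by rewrite /cutoff ramp_eq0// mul0r.
Qed.

Let en (k : nat) : R := k.+1%:R^-1.
Let en_gt0 k : 0 < en k. Proof. by rewrite invr_gt0. Qed.

Let D_measurable (f : R -> R) : (forall x, 0 < x < L -> {for x, continuous f}) ->
  measurable_fun D f.
Proof.
move=> cf; apply: open_continuous_measurable_fun; first exact: interval_open.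
by move=> x; rewrite inE/= in_itv/=; exact: cf.
Qed.

Let h_cont x : 0 < x < L -> {for x, continuous h}.
Proof.
by move=> xL; exact: is_derive_continuous (dh xL).
Qed.

Lemma isL2_C1 : isL2 L h /\ isL2 L h1.
Proof.
by split; apply: (isL2_bounded (M := M)) => //; apply: D_measurable; [exact: h_cont|exact: ch1].
Qed.

Let M0 : 0 <= M.
Proof.
have xL : 0 < L / 2 < L by rewrite divr_gt0//= ltr_pdivrMr// ltr_pMr// ltr1n.
exact: le_trans (normr_ge0 _) (hM xL).
Qed.

Let L2_bounded_cvg (F : nat -> R -> R) (C : R) :
  (forall k, measurable_fun D (F k)) -> (forall k x, 0 < x < L -> `|F k x| <= C) ->
  (forall x, 0 < x < L -> F k x @[k --> \oo] --> (0 : R)) ->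
  norm2 L (F k) @[k --> \oo] --> 0%E.
Proof.
move=> mF FC F0; have FL k : isL2 L (F k) by apply: (isL2_bounded (M := C)) => //; exact: FC.
apply/(norm2_cvg0 FL).
have [] := @Rdominated_convergence _ _ R mu D (fun k x => F k x ^+ 2) (fun=> 0) (fun=> C ^+ 2) (measurable_itv _).
- by move=> k; apply: measurable_funX; exact: mF.
- exact: measurable_cst.
- apply: aeW => x /=; rewrite in_itv/= => xL; apply: cvg_sqr0; exact: F0.
- apply: (integrable_bounded (M := C ^+ 2)) => //; first exact: lebesgue_itv_lty.
  by move=> x _; rewrite ger0_norm ?sqr_ge0.
- move=> k x /=; rewrite in_itv/= => xL; rewrite normrX lerXn2r ?nnegrE//.
    exact: le_trans (FC k x xL).
  exact: FC.
by move=> _; rewrite Rintegral_cst//= mul0r.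
Qed.

Let cutoff_measurable k : measurable_fun D (cutoff (en k)).
Proof.
by apply: D_measurable => x _; exact: is_derive_continuous (is_derive_cutoff x (en_gt0 k)).
Qed.

Lemma cutoff_norm2 : norm2 L (h \- cutoff k.+1%:R^-1) @[k --> \oo] --> 0%E.
Proof.
have [hL _] := isL2_C1.
have E x e : h x - cutoff e x = (1 - ramp e (bump x)) * h x by rewrite /cutoff; ring.
apply: (@L2_bounded_cvg (fun k x => h x - cutoff (en k) x) M).
- move=> k; apply: measurable_funB; [exact: isL2_measurable hL|exact: cutoff_measurable].
- move=> k x xL; rewrite E normrM -[leRHS]mul1r; apply: ler_pM => //; last exact: hM.
  have /andP[r0 r1] := ramp_ge0_le1 (en_gt0 k) (bump x).
  by rewrite ger0_norm ?subr_ge0// gerBl.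
- move=> x xL; under eq_fun do rewrite E.
  have : (1 - ramp (en k) (bump x)) * h x @[k --> \oo] --> (1 - 1) * h x.
    apply: cvgM; last exact: cvg_cst.
    by apply: cvgB; [exact: cvg_cst|apply: ramp_cvg; rewrite bump_gt0].
  by rewrite subrr mul0r.
Qed.

(** This is what puts h into H^1_0.  Differentiating the ramp contributes
    dramp (bump x) h x; under |h| <= C bump it is bounded by [dramp_le] and tends
    to 0 pointwise, so it disappears in L^2. *)
Lemma cutoff_derive_norm2 (C : R) : 0 <= C ->
  (forall x, 0 < x < L -> `|h x| <= C * bump x) ->
  norm2 L (h1 \- derive1 (cutoff k.+1%:R^-1)) @[k --> \oo] --> 0%E.
Proof.
move=> C0 hC.
have dE k : derive1 (cutoff (en k)) = dcutoff (en k) by exact: derive1_cutoff.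
under eq_fun do rewrite (dE _).
have E x e : h1 x - dcutoff e x = (1 - ramp e (bump x)) * h1 x -
    dramp e (bump x) * ((L - 2 * x) * h x) by rewrite /dcutoff; ring.
apply: (@L2_bounded_cvg (fun k x => h1 x - dcutoff (en k) x) (M + 3 * (L * C))).
- move=> k; apply: measurable_funB; first by apply: D_measurable; exact: ch1.
  by apply: D_measurable => x _; exact: continuous_dcutoff.
- move=> k x xL; rewrite E; apply: le_trans (ler_normB _ _) _; apply: lerD.
    rewrite normrM -[leRHS]mul1r; apply: ler_pM => //; last exact: h1M.
    have /andP[r0 r1] := ramp_ge0_le1 (en_gt0 k) (bump x).
    by rewrite ger0_norm ?subr_ge0// gerBl.
  have bx : 0 < bump x by rewrite bump_gt0.
  have /andP[d0 d3] := dramp_le (en_gt0 k) (ltW bx).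
  have dr0 : 0 <= dramp (en k) (bump x) by rewrite -(pmulr_rge0 _ bx).
  rewrite normrM (ger0_norm dr0).
  apply: (@le_trans _ _ (dramp (en k) (bump x) * (L * (C * bump x)))).
    apply: ler_wpM2l => //; rewrite normrM; apply: ler_pM => //; last exact: hC.
    by case/andP: xL => x0 xl; rewrite ler_norml; apply/andP; split; lra.
  rewrite (_ : dramp _ _ * _ = bump x * dramp (en k) (bump x) * (L * C)); last by ring.
  by apply: ler_wpM2r => //; rewrite mulr_ge0// ltW.
- move=> x xL; under eq_fun do rewrite E.
  have bx : 0 < bump x by rewrite bump_gt0.
  have : (1 - ramp (en k) (bump x)) * h1 x - dramp (en k) (bump x) * ((L - 2 * x) * h x)
      @[k --> \oo] --> (1 - 1) * h1 x - 0 * ((L - 2 * x) * h x).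
    apply: cvgB; apply: cvgM; (try exact: cvg_cst); last exact: dramp_cvg.
    by apply: cvgB; [exact: cvg_cst|exact: ramp_cvg].
  by rewrite subrr !mul0r subr0.
Qed.

End cutoff.

(** * Eigencoefficients of solutions of A w = f *)

Section linear_vanishing.
Context (R : realType).
Variables (L : R) (h h1 : R -> R) (M : R).
Hypotheses (L0 : 0 < L) (ch : {within `[0, L], continuous h}).
Hypothesis dh : forall x : R, 0 < x < L -> is_derive x (1 : R) h (h1 x).
Hypothesis h1M : forall x : R, 0 < x < L -> `|h1 x| <= M.
Hypotheses (h0 : h 0 = 0) (hL : h L = 0).

Let M0 : 0 <= M.
Proof.
have xL : 0 < L / 2 < L by rewrite divr_gt0//= ltr_pdivrMr// ltr_pMr// ltr1n.
exact: le_trans (normr_ge0 _) (h1M xL).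
Qed.

Let slope (a b : R) : 0 <= a -> a <= b -> b <= L -> `|h b - h a| <= M * (b - a).
Proof.
rewrite le_eqVlt => a0; rewrite le_eqVlt => /predU1P[-> _|ab bL].
  by rewrite !subrr normr0 mulr0.
have ca : {within `[a, b], continuous h}.
  apply: continuous_subspaceW ch => x /=; rewrite !in_itv/= => /andP[ax xb].
  rewrite (le_trans xb bL) andbT; case/predU1P: a0 => [->//|a0].
  by rewrite (le_trans (ltW a0)).
have a0' : 0 <= a by case/predU1P: a0 => [->//|/ltW].
have [z zab ->] := @MVT _ h h1 _ _ ab
  (fun z zab => ltac:(apply: dh; move: zab; rewrite in_itv/= => /andP[az zb];
     rewrite (le_lt_trans a0' az) (lt_le_trans zb bL)//)) ca.
move: zab; rewrite in_itv/= => /andP[az zb].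
have zL : 0 < z < L by rewrite (le_lt_trans a0' az) (lt_le_trans zb bL).
by rewrite normrM (ger0_norm (x := b - a)) ?subr_ge0 ?(ltW ab)// ler_wpM2r ?h1M// subr_ge0 ltW.
Qed.

(** By the mean value theorem h is at most M times the distance to either end;
    the nearer end is used, and the farther factor of bump is at least L / 2. *)
Lemma le_bump x : 0 < x < L -> `|h x| <= 2 * M / L * bump L x.
Proof.
move=> /andP[x0 xL].
have s1 := slope (lexx 0) (ltW x0) (ltW xL); rewrite h0 !subr0 in s1.
have s2 := slope (ltW x0) (ltW xL) (lexx L); rewrite hL sub0r normrN in s2.
rewrite /bump (_ : _ * _ = M * (2 * (x * (L - x)) / L)); last by ring.
have [xl|xl] := leP x (L / 2).
  apply: le_trans s1 _; rewrite ler_wpM2l// ler_pdivlMr// mulrCA ler_wpM2l// ?(ltW x0)//; lra.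
apply: le_trans s2 _; rewrite ler_wpM2l// ler_pdivlMr//.
rewrite (_ : 2 * _ = (L - x) * (2 * x)); last by ring.
by rewrite ler_wpM2l ?subr_ge0 ?(ltW xL)//; lra.
Qed.

End linear_vanishing.

Section coefficients.
Context (R : realType).
Notation mu := (@lebesgue_measure R).
Variable L : R.
Hypothesis L0 : 0 < L.
Local Notation D := (`]0, L[%classic : set R).

Lemma test_function_isL2 psi : test_function L psi -> isL2 L psi /\ isL2 L (derive1 psi).
Proof.
move=> [dpsi cpsi _].
have cp : continuous psi.
  by move=> x; apply: differentiable_continuous; apply/derivable1_diffP; exact: dpsi.
by split; apply: (isL2_continuous L0); apply: continuous_subspaceT; [exact: cp|exact: cpsi].
Qed.

Lemma test_function_ends psi : test_function L psi -> psi 0 = 0 /\ psi L = 0.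
Proof.
move=> [_ _ sub].
have H x : ~ (`]0, L[%classic : set R) x -> psi x = 0.
  move=> nx; apply/eqP/negPn/negP => px; apply: nx; apply: sub.
  exact: subset_closure.
by split; apply: H; rewrite /= in_itv/= ltxx ?andbF.
Qed.

Lemma pairing_cvg (F : nat -> R -> R) (f h : R -> R) :
  isL2 L f -> isL2 L h -> (forall k, isL2 L (F k)) ->
  norm2 L (h \- F k) @[k --> \oo] --> 0%E ->
  \int[mu]_(x in D) (f x * F k x) @[k --> \oo] --> \int[mu]_(x in D) (f x * h x).
Proof.
move=> fL hL FL n0.
have dL k : isL2 L (fun x => h x - F k x) by exact: isL2_sub.
have := L2_cvg0_mul dL fL ((norm2_cvg0 dL).1 n0).
have E k : \int[mu]_(x in D) ((h x - F k x) * f x) =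
    \int[mu]_(x in D) (f x * h x) - \int[mu]_(x in D) (f x * F k x).
  rewrite -RintegralB//; [|exact: isL2_mul..].
  by apply: eq_Rintegral => x _; ring.
rewrite (funext E) => H.
set I := \int[mu]_(x in D) (f x * h x) in H *.
have : I - (I - \int[mu]_(x in D) (f x * F k x)) @[k --> \oo] --> I - 0.
  by apply: cvgB; [exact: cvg_cst|exact: H].
rewrite subr0 (_ : (fun k => I - _) = fun k => \int[mu]_(x in D) (f x * F k x))//.
by apply/funext => k; rewrite opprB addrC subrK.
Qed.

Lemma cvg_eq_lim (u v : nat -> R) (a b : R) : (forall k, u k = v k) ->
  u k @[k --> \oo] --> a -> v k @[k --> \oo] --> b -> a = b.
Proof. by move=> /funext <- ua ub; apply: (cvg_unique _ ua). Qed.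

Lemma test_function_by_parts psi (h dh : R -> R) : test_function L psi ->
  (forall x : R, is_derive x (1 : R) h (dh x)) -> continuous dh ->
  \int[mu]_(x in D) (h x * derive1 psi x) = - \int[mu]_(x in D) (dh x * psi x).
Proof.
move=> tpsi hd cdh; have [psi0 psiL] := test_function_ends tpsi.
have [dpsi cdpsi _] := tpsi.
have dp (x : R) : is_derive x (1 : R) psi (derive1 psi x).
  by apply: DeriveDef; [exact: dpsi|rewrite derive1E].
have cont (f df : R -> R) : (forall x : R, is_derive x (1 : R) f (df x)) -> continuous f.
  by move=> H x; exact: is_derive_continuous (H x).
have cpsi := cont _ _ dp; have ch := cont _ _ hd.
have dm (x : R) : is_derive x (1 : R) (fun x => h x * psi x) (h x * derive1 psi x + dh x * psi x).
  have hm := is_deriveM (hd x) (dp x).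
  by apply: (is_derive_eq hm); rewrite /GRing.scale/= [psi x * _]mulrC.
have c1 : continuous (fun x => h x * derive1 psi x).
  by move=> x; apply: cvgM; [exact: ch|exact: cdpsi].
have c2 : continuous (fun x => dh x * psi x).
  by move=> x; apply: cvgM; [exact: cdh|exact: cpsi].
have cm : continuous (fun x => h x * derive1 psi x + dh x * psi x).
  by move=> x; apply: cvgD; [exact: c1|exact: c2].
have := Rintegral_derive (ltW L0) dm cm.
rewrite psiL psi0 !mulr0 subrr.
have mcm : measurable_fun `]0, L[ (EFin \o (fun x => h x * derive1 psi x + dh x * psi x)).
  by apply/measurable_EFinP; apply: measurable_funTS; apply: continuous_measurable_fun.
rewrite /Rintegral integral_itv_bndoo// => H.
apply/eqP; rewrite -addr_eq0 -[X in _ == X]H -RintegralD//.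
- by apply: continuous_itv_integrable (ltW L0) _; exact: continuous_subspaceT.
- by apply: continuous_itv_integrable (ltW L0) _; exact: continuous_subspaceT.
Qed.

Variables (kappa q : R).

Let s : R := Num.sqrt (2 / L).

(** Formally - kappa w'' + q w = f is multiplied by v_n and integrated by parts
    twice.  The eigenfunction v_n is not compactly supported, so it is replaced
    by cutoffs converging in H^1 (S1).  The weak derivative w1 that occurs in the
    equation and the weak derivative g that is approximated in H^1_0 need not be
    the same function; they have the same integral against v_n', an L^2 limit of
    test functions (S2).  The last integration by parts is done on the
    approximants of w (S3), where v_n may be any C^1 function. *)
Lemma eigencoef_graphA w f n : isL2 L f -> graphA L kappa q w f ->
  eigencoef L f n = eigenvalueA L kappa q n * eigencoef L w n.
Proof.
move=> fL [[_ [g wg [chi [tchi chiw chig]]]] [w1 [w2 [ww1 w1w2 Aw]]]].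
have [wL w1L W] := ww1; have [_ w2L W1] := w1w2; have [_ gL G] := wg.
pose k := n%:R * (pi / L).
pose ev x := eigenfunA L n x; pose dev x := s * k * cos (n%:R * phase L x).
have evE x : ev x = s * sin (n%:R * phase L x) by exact: eigenfunE.
have dph (x : R) := is_derive_phase L0 n%:R x.
have dev1 (x : R) : is_derive x (1 : R) ev (dev x).
  rewrite (funext evE); have h := dph x.
  by apply: is_derive_eq; rewrite /dev /k /GRing.scale/=; ring.
have dev2 (x : R) : is_derive x (1 : R) dev (- k ^+ 2 * ev x).
  rewrite evE /dev; have h := dph x.
  apply: is_derive_eq; rewrite -/k; move: (n%:R * phase L x) => u; rewrite /GRing.scale/=; ring.
have cev : continuous ev by exact: continuous_eigenfun.
have cdev : continuous dev.
  by move=> x; exact: is_derive_continuous (dev2 x).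
have cdev2 : continuous (fun x => - k ^+ 2 * ev x) by move=> x; apply: cvgMr; exact: cev.
have [M1 _ bM1] := within_continuous_bounded (ltW L0) (continuous_subspaceT cev).
have [M2 _ bM2] := within_continuous_bounded (ltW L0) (continuous_subspaceT cdev).
have [M3 _ bM3] := within_continuous_bounded (ltW L0) (continuous_subspaceT cdev2).
pose M := `|M1| + `|M2| + `|M3|.
have le1 x : 0 < x < L -> `|ev x| <= M.
  move=> /andP[x0 xL]; apply: le_trans (bM1 x _) _; first by rewrite !ltW.
  by rewrite /M -addrA (le_trans (ler_norm _))// lerDl addr_ge0.
have le2 x : 0 < x < L -> `|dev x| <= M.
  move=> /andP[x0 xL]; apply: le_trans (bM2 x _) _; first by rewrite !ltW.
  by rewrite /M addrAC (le_trans (ler_norm _))// lerDr addr_ge0.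
have le3 x : 0 < x < L -> `|- k ^+ 2 * ev x| <= M.
  move=> /andP[x0 xL]; apply: le_trans (bM3 x _) _; first by rewrite !ltW.
  by rewrite /M (le_trans (ler_norm _))// lerDr addr_ge0.
have ev0 : ev 0 = 0 by rewrite evE /phase mulr0 mul0r mulr0 sin0 mulr0.
have evL : ev L = 0 by rewrite evE /phase mulfK ?gt_eqF// sin_natpi mulr0.
have evLin := le_bump L0 (continuous_subspaceT cev) (fun x _ => dev1 x) le2 ev0 evL.
have M0 : 0 <= M by rewrite !addr_ge0.
have tev j := test_function_cutoff L0 (fun x _ => dev1 x) (fun x _ => @cdev x) (ltac:(by rewrite invr_gt0) : 0 < (j.+1%:R^-1 : R)).
have tdev j := test_function_cutoff L0 (fun x _ => dev2 x) (fun x _ => @cdev2 x) (ltac:(by rewrite invr_gt0) : 0 < (j.+1%:R^-1 : R)).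
have evL2 : isL2 L ev by apply: isL2_continuous => //; exact: continuous_subspaceT.
have devL2 : isL2 L dev by apply: isL2_continuous => //; exact: continuous_subspaceT.
have nev := cutoff_norm2 L0 (fun x _ => dev1 x) (fun x _ => @cdev x) le1 le2.
have C0 : 0 <= 2 * M / L by apply: divr_ge0; [exact: mulr_ge0|exact: ltW].
have nev1 := cutoff_derive_norm2 L0 (fun x _ => dev1 x) (fun x _ => @cdev x) le2 C0 evLin.
have ndev := cutoff_norm2 L0 (fun x _ => dev2 x) (fun x _ => @cdev2 x) le2 le3.
have S1 : \int[mu]_(x in D) (w1 x * dev x) = - \int[mu]_(x in D) (w2 x * ev x).
  have c1 := pairing_cvg w1L devL2 (fun j => (test_function_isL2 (tev j)).2) nev1.
  have c2 := pairing_cvg w2L evL2 (fun j => (test_function_isL2 (tev j)).1) nev.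
  apply: (cvg_eq_lim _ c1); last by apply: cvgN; exact: c2.
  by move=> j; exact: W1 _ (tev j).
have S2 : \int[mu]_(x in D) (w1 x * dev x) = \int[mu]_(x in D) (g x * dev x).
  have c1 := pairing_cvg w1L devL2 (fun j => (test_function_isL2 (tdev j)).1) ndev.
  have c2 := pairing_cvg gL devL2 (fun j => (test_function_isL2 (tdev j)).1) ndev.
  apply: (cvg_eq_lim _ c1 c2) => j.
  by apply: oppr_inj; rewrite -(W _ (tdev j)) -(G _ (tdev j)).
have S3 : \int[mu]_(x in D) (g x * dev x) = k ^+ 2 * \int[mu]_(x in D) (w x * ev x).
  have c1 := pairing_cvg devL2 gL (fun j => (test_function_isL2 (tchi j)).2) chig.
  have c2 := pairing_cvg evL2 wL (fun j => (test_function_isL2 (tchi j)).1) chiw.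
  under eq_Rintegral do rewrite mulrC.
  rewrite [X in _ = _ * X](_ : _ = \int[mu]_(x in D) (ev x * w x)); last first.
    by apply: eq_Rintegral => x _; rewrite mulrC.
  apply: (cvg_eq_lim _ c1); last by apply: cvgMr; exact: c2.
  move=> j; rewrite (test_function_by_parts (tchi j) dev2 cdev2).
  have iec := isL2_mul evL2 (test_function_isL2 (tchi j)).1.
  rewrite -[X in - X = _](_ : - k ^+ 2 * \int[mu]_(x in D) (ev x * chi j x) = _).
    by rewrite mulNr opprK.
  by rewrite -RintegralZl//; apply: eq_Rintegral => x _; rewrite mulrA.
have ael : \int[mu]_(x in D) (f x * ev x) =
    \int[mu]_(x in D) (- kappa * (w2 x * ev x) + q * (w x * ev x)).
  rewrite /Rintegral; congr fine; apply: ae_eq_integral => //.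
  - by apply/measurable_EFinP; exact: integrable_measurable (isL2_mul fL evL2).
  - apply/measurable_EFinP; apply: measurable_funD; apply: measurable_funM => //;
      exact: integrable_measurable (isL2_mul _ _).
  - have [Z [mZ Z0 hZ]] := Aw; exists Z; split => // x /= nx; apply: hZ => /= Ax.
    apply: nx => Dx; rewrite -Ax ?inE//; congr EFin; ring.
rewrite /eigencoef ael RintegralD//; first last.
- by apply: integrable_mull => //; exact: isL2_mul.
- by apply: integrable_mull => //; exact: isL2_mul.
rewrite !RintegralZl//; try exact: isL2_mul.
have -> : \int[mu]_(x in D) (w2 x * ev x) = - (k ^+ 2 * \int[mu]_(x in D) (w x * ev x)).
  by rewrite -S3 -S2 S1 opprK.
rewrite /eigenvalueA /k mulrA; ring.
Qed.

End coefficients.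

(** * The Green function of A *)

Section hyperbolic.
Context (R : realType).

(** S is sinh(r x) / r with r^2 = m, or x itself when m = 0; C is its
    derivative.  The addition formula is kept because at x + y = L it is the
    constancy of the Wronskian of S(x) and S(L - x). *)
Lemma hyperbolic_pair (m : R) : 0 <= m -> exists S C : R -> R,
  [/\ forall x : R, is_derive x (1 : R) S (C x),
      forall x : R, is_derive x (1 : R) C (m * S x),
      forall x y, S (x + y) = S x * C y + C x * S y,
      S 0 = 0 & forall x, 0 < x -> 0 < S x].
Proof.
rewrite le_eqVlt => /predU1P[<-|m0].
  exists id, (cst 1); split => //.
  - by move=> x; exact: is_derive_id.
  - by move=> x; rewrite mul0r; exact: is_derive_cst.
  - by move=> x y /=; rewrite mulr1 mul1r.
pose r := Num.sqrt m; have r0 : 0 < r by rewrite sqrtr_gt0.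
have rr : m = r ^+ 2 by rewrite sqr_sqrtr// ltW.
pose S x := (expR (r * x) - expR (- r * x)) / (2 * r).
pose C x := (expR (r * x) + expR (- r * x)) / 2.
have dl (k x : R) : is_derive x (1 : R) (fun x => expR (k * x)) (k * expR (k * x)).
  have dk : is_derive x (1 : R) (fun x => k * x) k.
    by apply: is_derive_eq; rewrite /GRing.scale/= mulr1.
  have h := is_derive1_comp (is_derive_expR (k * x)) dk.
  by apply: (is_derive_eq h); rewrite /GRing.scale/= mulrC.
exists S, C; split.
- move=> x; have h1 := dl r x; have h2 := dl (- r) x.
  apply: is_derive_eq; rewrite /C /GRing.scale/=.
  by move: (expR (r * x)) (expR (- r * x)) => u v; field; rewrite gt_eqF.
- move=> x; have h1 := dl r x; have h2 := dl (- r) x.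
  apply: is_derive_eq; rewrite /S rr /GRing.scale/=.
  by move: (expR (r * x)) (expR (- r * x)) => u v; field; rewrite gt_eqF.
- move=> x y; rewrite /S /C !mulrDr !expRD.
  move: (expR (r * x)) (expR (- r * x)) (expR (r * y)) (expR (- r * y)) => a b c d.
  by field; rewrite gt_eqF.
- by rewrite /S !mulr0 subrr mul0r.
- move=> x x0; rewrite /S divr_gt0 ?mulr_gt0// subr_gt0 ltr_expR mulNr.
  by rewrite (lt_trans (y := 0)) ?oppr_lt0 ?mulr_gt0.
Qed.

End hyperbolic.

Section green.
Context (R : realType).
Notation mu := (@lebesgue_measure R).
Variables (L kappa q : R) (phi : R -> R).
Hypotheses (L0 : 0 < L) (kappa0 : 0 < kappa) (phiL : isL2 L phi).
Local Notation D := (`]0, L[%classic : set R).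
Let m := q / kappa.
Variables (S C : R -> R).
Hypothesis dS : forall x : R, is_derive x (1 : R) S (C x).
Hypothesis dC : forall x : R, is_derive x (1 : R) C (m * S x).
Hypothesis SD : forall x y, S (x + y) = S x * C y + C x * S y.
Hypothesis S0 : S 0 = 0.
Hypothesis S_gt0 : forall x, 0 < x -> 0 < S x.

Let cont (f df : R -> R) : (forall x : R, is_derive x (1 : R) f (df x)) -> continuous f.
Proof.
by move=> H x; exact: is_derive_continuous (H x).
Qed.

Let cS : continuous S. Proof. exact: cont dS. Qed.
Let cC : continuous C. Proof. exact: cont dC. Qed.

Let Sr (x : R) := S (L - x).
Let Cr (x : R) := C (L - x).

Let refl_derive (f df : R -> R) : (forall x : R, is_derive x (1 : R) f (df x)) ->
  forall x : R, is_derive x (1 : R) (fun x => f (L - x)) (- df (L - x)).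
Proof.
move=> H x.
have dl : is_derive x (1 : R) (fun x : R => L - x) (- 1).
  have h1 : is_derive x (1 : R) (cst L : R -> R) (0 : R) by exact: is_derive_cst.
  have h2 : is_derive x (1 : R) (id : R -> R) (1 : R) by exact: is_derive_id.
  by apply: (is_derive_eq (is_deriveB h1 h2)); rewrite sub0r.
have h := is_derive1_comp (g := fun x : R => L - x) (H (L - x)) dl.
by apply: (is_derive_eq h); rewrite /GRing.scale/= mulrN1.
Qed.

Let dSr (x : R) : is_derive x (1 : R) Sr (- Cr x). Proof. exact: refl_derive. Qed.
Let dCr (x : R) : is_derive x (1 : R) Cr (- (m * Sr x)).
Proof. exact: (refl_derive dC). Qed.
Let cSr : continuous Sr. Proof. exact: cont dSr. Qed.
Let cCr : continuous Cr. Proof. exact: cont dCr. Qed.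

Let aS y := \1_D y * (phi y * S y).
Let aT y := \1_D y * (phi y * Sr y).

Let ia (f : R -> R) : continuous f -> mu.-integrable setT (EFin \o (fun y => \1_D y * (phi y * f y))).
Proof.
move=> cf; apply: integrable_indic_mul => //.
apply: isL2_mul => //; apply: isL2_continuous => //; exact: continuous_subspaceT.
Qed.

Let iaS : mu.-integrable setT (EFin \o aS). Proof. exact: ia. Qed.
Let iaT : mu.-integrable setT (EFin \o aT). Proof. exact: ia. Qed.

Let P := prim aS.
Let T := prim aT.
Let Q x := T L - T x.
Let K := (kappa * S L)^-1.

(** Variation of constants; [green_der] and [green_der2] are the expected first
    and second derivatives. *)
Definition green_sol x := K * (Sr x * P x + S x * Q x).
Definition green_der x := K * (- Cr x * P x + C x * Q x).
Definition green_der2 x := m * green_sol x - kappa^-1 * phi x.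

Let cP : {within `[0, L], continuous P}. Proof. exact: continuous_prim (ltW L0) iaS. Qed.
Let cT : {within `[0, L], continuous T}. Proof. exact: continuous_prim (ltW L0) iaT. Qed.

Let within_mul (f g : R -> R) : {within `[0, L], continuous f} ->
  {within `[0, L], continuous g} -> {within `[0, L], continuous (fun x => f x * g x)}.
Proof.
move=> /subspace_continuousP cf /subspace_continuousP cg.
by apply/subspace_continuousP => x xL; apply: cvgM; [exact: cf|exact: cg].
Qed.

Let within_add (f g : R -> R) : {within `[0, L], continuous f} ->
  {within `[0, L], continuous g} -> {within `[0, L], continuous (fun x => f x + g x)}.
Proof.
move=> /subspace_continuousP cf /subspace_continuousP cg.
by apply/subspace_continuousP => x xL; apply: cvgD; [exact: cf|exact: cg].
Qed.

Let cQ : {within `[0, L], continuous Q}.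
Proof.
have /subspace_continuousP cT' := cT; apply/subspace_continuousP => x xL.
by apply: cvgB; [exact: cvg_cst|exact: cT'].
Qed.

Lemma continuous_green_sol : {within `[0, L], continuous green_sol}.
Proof.
apply: within_mul; first by apply: continuous_subspaceT; exact: cst_continuous.
by apply: within_add; apply: within_mul => //; exact: continuous_subspaceT.
Qed.

Lemma continuous_green_der : {within `[0, L], continuous green_der}.
Proof.
apply: within_mul; first by apply: continuous_subspaceT; exact: cst_continuous.
apply: within_add; apply: within_mul => //; last exact: continuous_subspaceT.
by apply: continuous_subspaceT => x; apply: cvgN; exact: cCr.
Qed.

Let icont (f : R -> R) x : x <= L -> {within `[0, L], continuous f} ->
  mu.-integrable `[0, x] (EFin \o f).
Proof.
move=> xL cf; apply: continuous_compact_integrable; first exact: segment_compact.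
apply: continuous_subspaceW cf => y /=; rewrite !in_itv/= => /andP[-> yx].
exact: le_trans xL.
Qed.

Let ia_cc (a f : R -> R) x : x <= L -> mu.-integrable setT (EFin \o a) -> continuous f ->
  mu.-integrable `[0, x] (EFin \o (fun y => a y * f y)).
Proof.
move=> xL ia' cf; have [M M0 fM] := within_continuous_bounded (ltW L0) (continuous_subspaceT cf).
rewrite (_ : EFin \o _ = EFin \o (fun y => f y * a y)); last first.
  by apply/funext => y /=; rewrite mulrC.
apply: (@integrable_bounded_mul _ _ _ mu _ _ _ M) => //.
- by apply: measurable_funTS; exact: continuous_measurable_fun.
- move=> y /=; rewrite in_itv/= => /andP[y0 yx]; apply: fM.
  by rewrite y0 (le_trans yx).
- by apply: (@integrableS _ _ _ mu setT).
Qed.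

Let green_parts (f1 df1 f2 df2 : R -> R) x : 0 <= x <= L ->
  (forall x : R, is_derive x (1 : R) f1 (df1 x)) -> continuous df1 ->
  (forall x : R, is_derive x (1 : R) f2 (df2 x)) -> continuous df2 ->
  \int[mu]_(y in `[0, x]) (P y * df1 y + Q y * df2 y) =
  P x * f1 x + Q x * f2 x - T L * f2 0 -
    \int[mu]_(y in `[0, x]) (aS y * f1 y - aT y * f2 y).
Proof.
move=> /andP[x0 xL] d1 c1 d2 c2.
have cf1 := cont d1; have cf2 := cont d2.
have i1 : mu.-integrable `[0, x] (EFin \o (fun y => P y * df1 y)).
  by apply: icont => //; apply: within_mul => //; exact: continuous_subspaceT.
have i2 : mu.-integrable `[0, x] (EFin \o (fun y => T y * df2 y)).
  by apply: icont => //; apply: within_mul => //; exact: continuous_subspaceT.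
have i3 : mu.-integrable `[0, x] (EFin \o (fun y => T L * df2 y)).
  by apply: integrable_mull => //; apply: icont => //; exact: continuous_subspaceT.
have j1 := ia_cc xL iaS cf1; have j2 := ia_cc xL iaT cf2.
rewrite (RintegralB _ j1 j2)//.
have -> : \int[mu]_(y in `[0, x]) (P y * df1 y + Q y * df2 y) =
    \int[mu]_(y in `[0, x]) (P y * df1 y) +
    (\int[mu]_(y in `[0, x]) (T L * df2 y) - \int[mu]_(y in `[0, x]) (T y * df2 y)).
  rewrite -RintegralB// -RintegralD//; last exact: integrable_subr.
  by apply: eq_Rintegral => y _; rewrite /Q mulrBl.
rewrite RintegralZl//; last by apply: icont => //; exact: continuous_subspaceT.
rewrite (Rintegral_derive x0 d2 c2).
rewrite (prim_by_parts x0 iaS d1 c1) (prim_by_parts x0 iaT d2 c2) /Q -/P -/T.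
ring.
Qed.

Let dM (f df g dg : R -> R) : (forall x : R, is_derive x (1 : R) f (df x)) ->
  (forall x : R, is_derive x (1 : R) g (dg x)) ->
  forall x : R, is_derive x (1 : R) (fun x => f x * g x) (f x * dg x + df x * g x).
Proof.
move=> df' dg' x; have h := is_deriveM (df' x) (dg' x).
by apply: (is_derive_eq h); rewrite /GRing.scale/= [g x * _]mulrC.
Qed.

Let cM (f df g dg : R -> R) : continuous f -> continuous df -> continuous g ->
  continuous dg -> continuous (fun x => f x * dg x + df x * g x).
Proof.
move=> cf cdf cg cdg x.
by apply: cvgD; apply: cvgM; [exact: cf|exact: cdg|exact: cdf|exact: cg].
Qed.

(** The terms in phi that come from differentiating P and Q are phi S Sr and
    - phi Sr S, which cancel: this is why [green_der] contains no phi. *)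
Let green_by_parts (psi dpsi : R -> R) x : 0 <= x <= L ->
  (forall x : R, is_derive x (1 : R) psi (dpsi x)) -> continuous dpsi ->
  \int[mu]_(y in `[0, x]) (green_sol y * dpsi y + green_der y * psi y) =
  green_sol x * psi x.
Proof.
move=> xL dp cdp; have cp := cont dp.
have cNCr : continuous (fun x => - Cr x) by move=> y; apply: cvgN; exact: cCr.
have h := green_parts xL (dM dSr dp) (cM cSr cNCr cp cdp) (dM dS dp) (cM cS cC cp cdp).
have -> : \int[mu]_(y in `[0, x]) (green_sol y * dpsi y + green_der y * psi y) =
   \int[mu]_(y in `[0, x]) (K * (P y * (Sr y * dpsi y + - Cr y * psi y) +
     Q y * (S y * dpsi y + C y * psi y))).
  by apply: eq_Rintegral => y _; rewrite /green_sol /green_der; ring.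
have /andP[x0 xl] := xL.
rewrite RintegralZl//; last first.
  apply: icont => //; apply: within_add; apply: within_mul => //; apply: continuous_subspaceT.
    exact: (cM cSr cNCr cp cdp).
  exact: (cM cS cC cp cdp).
rewrite h S0 mul0r mulr0 subr0 (_ : Rintegral _ _ _ = 0); last first.
  under eq_Rintegral => y _.
    rewrite (_ : aS y * _ - _ = 0); last by rewrite /aS /aT; ring.
    over.
  by rewrite Rintegral_cst//= mul0r.
by rewrite /green_sol; ring.
Qed.

Lemma green_solE x : 0 <= x <= L -> green_sol x = \int[mu]_(y in `[0, x]) green_der y.
Proof.
move=> xL.
have d1 (y : R) : is_derive y (1 : R) (cst (1 : R) : R -> R) ((cst 0 : R -> R) y).
  exact: is_derive_cst.
have h := green_by_parts xL d1 (@cst_continuous _ _ 0).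
rewrite -[LHS]mulr1 -h; apply: eq_Rintegral => y _.
by rewrite /= mulr0 add0r mulr1.
Qed.

Lemma green_sol0 : green_sol 0 = 0.
Proof. by rewrite green_solE ?lexx ?(ltW L0)// set_itv1 Rintegral_set1. Qed.

Lemma green_solL : green_sol L = 0.
Proof. by rewrite /green_sol /Sr /Q !subrr S0 mul0r mulr0 addr0 mulr0. Qed.

Lemma is_derive_green_sol x : 0 < x < L -> is_derive x (1 : R) green_sol (green_der x).
Proof.
move=> xL; have /andP[x0 xl] := xL.
have cg : {for x, continuous green_der} := within_continuous_oo continuous_green_der xL.
have i : mu.-integrable `[0, L] (EFin \o green_der) by apply: icont => //; exact: continuous_green_der.
have [d1 d2] := continuous_FTC1_closed xl i x0 cg.
have hd : is_derive x (1 : R) (fun x => \int[mu]_(t in `[0, x]) green_der t) (green_der x).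
  by apply: DeriveDef; [exact: d1|rewrite -derive1E; exact: d2].
apply: (near_eq_is_derive _ hd).
have : \forall y \near x, y \in `]0, L[ by apply: near_in_itvoo; rewrite in_itv.
by apply: filterS => y; rewrite in_itv/= => /andP[y0 yL]; rewrite green_solE// !ltW.
Qed.

Let green_L2 : isL2 L green_sol.
Proof. by apply: isL2_continuous => //; exact: continuous_green_sol. Qed.

Let green_der_L2 : isL2 L green_der.
Proof. by apply: isL2_continuous => //; exact: continuous_green_der. Qed.

Let green_der2_L2 : isL2 L green_der2.
Proof. by apply: isL2_sub; apply: isL2_scale. Qed.

Let oo_cc (f : R -> R) : measurable_fun D f ->
  \int[mu]_(x in D) f x = \int[mu]_(x in `[0, L]) f x.
Proof.
move=> mf; rewrite /Rintegral; congr fine; apply/esym; apply: integral_itv_bndoo.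
exact/measurable_EFinP.
Qed.

Let test_derive psi : test_function L psi ->
  [/\ forall x : R, is_derive x (1 : R) psi (derive1 psi x), continuous psi &
      continuous (derive1 psi)].
Proof.
move=> [dpsi cpsi _]; have dp (x : R) : is_derive x (1 : R) psi (derive1 psi x).
  by apply: DeriveDef; [exact: dpsi|rewrite derive1E].
by split => //; exact: cont dp.
Qed.

Lemma green_weak_derivative : weak_derivative L green_sol green_der.
Proof.
split=> // psi tpsi; have [dp cp cdp] := test_derive tpsi.
have [_ psiL] := test_function_ends tpsi.
have [pL dpL] := test_function_isL2 L0 tpsi.
have i1 := isL2_mul green_L2 dpL; have i2 := isL2_mul green_der_L2 pL.
apply/eqP; rewrite -addr_eq0 -RintegralD// oo_cc; last first.
  by apply: measurable_funD; [exact: integrable_measurable i1|exact: integrable_measurable i2].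
rewrite (green_by_parts _ dp cdp) ?lexx ?(ltW L0)//.
by rewrite psiL mulr0.
Qed.

(** Here the terms in phi add up to - phi (Sr C + Cr S) = - phi S(L), and
    the constant K is chosen to turn this into - phi / kappa. *)
Lemma green_weak_derivative2 : weak_derivative L green_der green_der2.
Proof.
split=> // psi tpsi; have [dp cp cdp] := test_derive tpsi.
have [psi0 psiL] := test_function_ends tpsi.
have [pL dpL] := test_function_isL2 L0 tpsi.
have cNCr : continuous (fun x => - Cr x) by move=> y; apply: cvgN; exact: cCr.
have dNCr (x : R) : is_derive x (1 : R) (fun x => - Cr x) (m * Sr x).
  have h := is_deriveN (dCr x).
  by apply: (is_derive_eq h); rewrite opprK.
have cmSr : continuous (fun x => m * Sr x) by move=> y; apply: cvgMr; exact: cSr.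
have cmS : continuous (fun x => m * S x) by move=> y; apply: cvgMr; exact: cS.
have LL : 0 <= L <= L by rewrite lexx ltW.
have h := green_parts LL (dM dNCr dp) (cM cNCr cmSr cp cdp) (dM dC dp) (cM cC cmS cp cdp).
rewrite psi0 psiL !mulr0 subr0 addr0 sub0r in h.
have i1 := isL2_mul green_der_L2 dpL; have i2 := isL2_mul green_L2 pL.
have i3 := isL2_mul phiL pL.
have SL0 := S_gt0 L0.
have E1 : \int[mu]_(x in D) (green_der x * derive1 psi x) +
    m * \int[mu]_(x in D) (green_sol x * psi x) = kappa^-1 * \int[mu]_(x in D) (phi x * psi x).
  rewrite -RintegralZl// -RintegralD//; last exact: integrable_mull.
  rewrite oo_cc; last first.
    apply: measurable_funD; first exact: integrable_measurable i1.
    by apply: measurable_funM => //; exact: integrable_measurable i2.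
  have -> : \int[mu]_(x in `[0, L]) (green_der x * derive1 psi x + m * (green_sol x * psi x)) =
     \int[mu]_(y in `[0, L]) (K * (P y * (- Cr y * derive1 psi y + m * Sr y * psi y) +
       Q y * (C y * derive1 psi y + m * S y * psi y))).
    by apply: eq_Rintegral => y _; rewrite /green_sol /green_der; ring.
  rewrite RintegralZl//; last first.
    apply: icont => //; apply: within_add; apply: within_mul => //; apply: continuous_subspaceT.
      exact: (cM cNCr cmSr cp cdp).
    exact: (cM cC cmS cp cdp).
  rewrite h.
  have -> : \int[mu]_(y in `[0, L]) (aS y * (- Cr y * psi y) - aT y * (C y * psi y)) =
      - S L * \int[mu]_(x in D) (phi x * psi x).
    rewrite -[in RHS]Rintegral_indic_mul//.
    have -> : \int[mu]_x (\1_D x * (phi x * psi x)) =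
        \int[mu]_(x in `[0, L]) (\1_D x * (phi x * psi x)).
      rewrite -[RHS]Rintegral_indic_mul//; apply: eq_Rintegral => y _.
      rewrite !indicE; case: (boolP (y \in D)) => yD; last by rewrite !mul0r mulr0.
      by rewrite mem_set ?mul1r//; apply: subset_itv_oo_cc; exact: set_mem.
    rewrite -RintegralZl//; last first.
      apply: (@integrableS _ _ _ mu setT) => //.
      by apply: integrable_indic_mul.
    apply: eq_Rintegral => y _; rewrite /aS /aT.
    have -> : S L = Sr y * C y + Cr y * S y by rewrite -SD subrK.
    ring.
  by rewrite /K invfM; field; rewrite !gt_eqF.
have -> : \int[mu]_(x in D) (green_der2 x * psi x) =
    m * \int[mu]_(x in D) (green_sol x * psi x) - kappa^-1 * \int[mu]_(x in D) (phi x * psi x).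
  rewrite -!RintegralZl// -RintegralB//; [|exact: integrable_mull..].
  by apply: eq_Rintegral => x _; rewrite /green_der2; ring.
by rewrite -E1; ring.
Qed.

Lemma green_graphA : graphA L kappa q green_sol phi.
Proof.
have [M _ bM] := within_continuous_bounded (ltW L0) continuous_green_sol.
have [M1 _ bM1] := within_continuous_bounded (ltW L0) continuous_green_der.
pose B := `|M| + `|M1|.
have le1 x : 0 < x < L -> `|green_sol x| <= B.
  move=> /andP[x0 xL]; apply: le_trans (bM x _) _; first by rewrite !ltW.
  by rewrite (le_trans (ler_norm _))// lerDl.
have le2 x : 0 < x < L -> `|green_der x| <= B.
  move=> /andP[x0 xL]; apply: le_trans (bM1 x _) _; first by rewrite !ltW.
  by rewrite (le_trans (ler_norm _))// lerDr.
have cg x : 0 < x < L -> {for x, continuous green_der}.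
  by move=> xL; exact: (within_continuous_oo continuous_green_der xL).
have lin := le_bump L0 continuous_green_sol is_derive_green_sol le2 green_sol0 green_solL.
have C0 : 0 <= 2 * B / L by apply: divr_ge0; [apply: mulr_ge0 => //; exact: addr_ge0|exact: ltW].
have wd := green_weak_derivative; have wd2 := green_weak_derivative2.
split; first split.
- by exists green_der => //; exists green_der2.
- exists green_der => //; exists (fun k => cutoff L green_sol k.+1%:R^-1); split.
  + move=> k; apply: (@test_function_cutoff R L green_sol green_der L0 is_derive_green_sol cg).
    by rewrite invr_gt0.
  + exact: (cutoff_norm2 L0 is_derive_green_sol cg le1 le2).
  + exact: (cutoff_derive_norm2 L0 is_derive_green_sol cg le2 C0 lin).
- exists green_der, green_der2; split => //; apply: aeW => x _.
  by rewrite /green_der2 /m; field; rewrite gt_eqF.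
Qed.

Section positivity.
Hypothesis phi_ge0 : {ae mu, forall x, x \in `]0, L[ -> 0 <= phi x}.
Hypothesis phi_neq0 : ~ {ae mu, forall x, x \in `]0, L[ -> phi x = 0}.

(** The Green function of A, up to the factor K. *)
Let G x y := if y <= x then Sr x * S y else S x * Sr y.

Let G_gt0 x y : 0 < x < L -> 0 < y < L -> 0 < G x y.
Proof.
move=> /andP[x0 xL] /andP[y0 yL]; rewrite /G /Sr.
by case: ifP => _; rewrite mulr_gt0// S_gt0// subr_gt0.
Qed.

Let H x y := \1_D y * (G x y * phi y).

Let HE x y : 0 < x < L ->
  H x y = Sr x * (\1_(`[0, x]%classic) y * aS y) +
    S x * (\1_(`[0, L]%classic) y * aT y - \1_(`[0, x]%classic) y * aT y).
Proof.
move=> /andP[x0 xL]; rewrite /H /aS /aT !indicE !mem_setE !in_itv/= /G.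
case: (boolP (0 < y < L)) => [/andP[y0 yL]|_]; last by rewrite !(mul0r, mulr0, subr0, addr0).
rewrite (ltW y0) (ltW yL)/=; case: ifP => _ /=; ring.
Qed.

Let indic_int (a : R -> R) x : mu.-integrable setT (EFin \o a) ->
  mu.-integrable setT (EFin \o (fun y => \1_(`[0, x]%classic) y * a y)).
Proof.
move=> i; apply: integrable_indic_mul; first exact: measurable_itv.
by apply: (@integrableS _ _ _ mu setT).
Qed.

Let H_int x : 0 < x < L -> mu.-integrable setT (EFin \o H x).
Proof.
move=> xL; rewrite (funext (fun y => HE y xL)).
apply: integrable_addr => //; apply: integrable_mull => //; first exact: indic_int.
by apply: integrable_subr => //; exact: indic_int.
Qed.

Let green_H x : 0 < x < L -> green_sol x = K * \int[mu]_y H x y.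
Proof.
move=> xL; rewrite /green_sol (funext (fun y => HE y xL)); congr (_ * _).
have i1 := indic_int x iaS; have i2 := indic_int L iaT; have i3 := indic_int x iaT.
rewrite RintegralD//; first last.
- by apply: integrable_mull => //; exact: integrable_subr.
- exact: integrable_mull.
rewrite !RintegralZl//; last exact: integrable_subr.
rewrite RintegralB// !Rintegral_indic_mul//.
Qed.

(** The integrand H x is almost everywhere nonnegative; if its integral were zero
    it would vanish almost everywhere, and so would phi, as G x is positive. *)
Lemma green_sol_gt0 x : 0 < x < L -> 0 < green_sol x.
Proof.
move=> xL; rewrite green_H// mulr_gt0//.
  by rewrite invr_gt0 mulr_gt0// S_gt0.
have mH := integrable_measurable (H_int xL).
have Hae : {ae mu, forall y, `|H x y| = H x y}.
  have [Z [mZ Z0 hZ]] := phi_ge0; exists Z; split => // y /= ny; apply: hZ => /= py.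
  apply: ny; rewrite ger0_norm// /H indicE mem_setE.
  case: (boolP (y \in `]0, L[)) => [yD|_]; last by rewrite mul0r.
  by rewrite mul1r mulr_ge0// ?py// ltW// G_gt0.
have E : (\int[mu]_y `|(H x y)%:E|)%E = (\int[mu]_y H x y)%:E.
  have -> : (\int[mu]_y H x y)%:E = (\int[mu]_y (H x y)%:E)%E.
    by rewrite /Rintegral fineK//; exact: integrable_fin_num (H_int xL).
  apply: ae_eq_integral => //.
  - by apply: measurableT_comp => //; exact/measurable_EFinP.
  - exact/measurable_EFinP.
  - have [Z [mZ Z0 hZ]] := Hae; exists Z; split => // y /= ny; apply: hZ => /= py.
    by apply: ny => _; rewrite py.
have I0 : 0 <= \int[mu]_y H x y by rewrite -lee_fin -E integral_ge0.
rewrite lt_neqAle I0 andbT; apply/negP => /eqP I1.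
apply: phi_neq0; rewrite -I1 in E.
have mHE : measurable_fun setT (EFin \o H x) by exact/measurable_EFinP.
have := (ae_eq_integral_abs mu measurableT mHE).1 E.
move=> [Z [mZ Z0 hZ]]; exists Z; split => // y /= ny; apply: hZ => /= py.
apply: ny => yD; have := py I; rewrite /H indicE mem_setE yD mul1r => -[] /eqP.
by rewrite mulf_eq0 gt_eqF ?G_gt0//= => /eqP.
Qed.

End positivity.
End green.

(** * Positivity of A^-1 phi and the conclusion *)

Section resolvent_at_zero.
Context (R : realType).
Variables (L kappa q : R) (phi : R -> R).
Hypotheses (L0 : 0 < L) (k0 : 0 < kappa) (q0 : 0 <= q) (phiL : isL2 L phi).

Let c (k : nat) := eigencoef L phi k.+1 / eigenvalueA L kappa q k.+1.

Let c_bound : exists K, forall k, `|c k| <= K / k.+1%:R ^+ 2.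
Proof.
have [|K cK] := @coef_over_eigenvalue _ _ L0 _ _ phi k0 q0 phiL (fun=> 1) 1.
  by move=> k; rewrite normr1.
by exists K => k; have := cK k; rewrite mulr1.
Qed.

(** Both sides are continuous with the same sine coefficients. *)
Lemma graphA_sine_sum w : {within `[0, L], continuous w} -> graphA L kappa q w phi ->
  forall x, 0 < x < L -> w x = sine_sum L c x.
Proof.
move=> cw gw x xL; have [K cK] := c_bound.
have cs : {within `[0, L], continuous (sine_sum L c)} by exact: continuous_sine_sum cK.
have wL := isL2_continuous L0 cw; have sL := isL2_continuous L0 cs.
have coef n : eigencoef L w n.+1 = eigencoef L (sine_sum L c) n.+1.
  rewrite (eigencoef_sine_sum L0 cK) /c (eigencoef_graphA L0 n.+1 phiL gw).
  by rewrite mulrC mulKf// gt_eqF// eigenvalue_gt0.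
have cd : {within `[0, L], continuous (fun x => w x - sine_sum L c x)}.
  move: cw cs => /subspace_continuousP cw /subspace_continuousP cs.
  by apply/subspace_continuousP => y yL; apply: cvgB; [exact: cw|exact: cs].
apply/eqP; rewrite -subr_eq0; apply/eqP.
apply: (sine_complete L0 cd) => // -[//|n] _.
have s0 : Num.sqrt (2 / L) != 0 by rewrite gt_eqF// sqrtr_gt0 divr_gt0.
apply: (mulfI s0); rewrite mulr0 -RintegralZl//; last first.
  apply: isL2_mul; first exact: isL2_sub.
  apply: isL2_continuous => //; apply: continuous_subspaceT => y.
  apply: (@continuous_comp _ _ _ (fun y => n.+1%:R * phase L y) sin); last exact: continuous_sin.
  by apply: cvgMr; exact: continuous_phase.
transitivity (eigencoef L w n.+1 - eigencoef L (sine_sum L c) n.+1); last first.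
  by rewrite coef subrr.
have vL := isL2_eigenfun L0 n.+1.
rewrite /eigencoef -RintegralB//; [|exact: isL2_mul..].
by apply: eq_Rintegral => y _; rewrite eigenfunE; ring.
Qed.

Hypothesis phi_ge0 : {ae lebesgue_measure, forall x, x \in `]0, L[ -> 0 <= phi x}.
Hypothesis phi_neq0 : ~ {ae lebesgue_measure, forall x, x \in `]0, L[ -> phi x = 0}.

(** [green_sol] shows that the set from which [invA] chooses is inhabited; all its
    members agree with the sine sum inside the interval. *)
Lemma invA_gt0 x : 0 < x < L -> 0 < invA L kappa q phi x /\ 0 < sine_sum L c x.
Proof.
move=> xL; have [|S [C [dS dC SD S0 Sp]]] := @hyperbolic_pair R (q / kappa).
  by rewrite divr_ge0// ltW.
have cw : {within `[0, L], continuous (green_sol L kappa phi S)}.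
  exact: (@continuous_green_sol R L kappa phi L0 phiL S C dS).
have gw : graphA L kappa q (green_sol L kappa phi S) phi 
  := @green_graphA R L kappa q phi L0 k0 phiL S C dS dC SD S0 Sp.
have wp := @green_sol_gt0 R L kappa phi L0 k0 phiL S C dS Sp phi_ge0 phi_neq0 x xL.
have Wp : 0 < sine_sum L c x by rewrite -(graphA_sine_sum cw gw xL).
split=> //.
have [ci gi] : [set w : R -> R | {within `[0, L], continuous w} /\ graphA L kappa q w phi]
    (invA L kappa q phi).
  by apply: (@getPex _ [set w : R -> R | _ /\ _]); exists (green_sol L kappa phi S).
by rewrite (graphA_sine_sum ci gi xL).
Qed.

End resolvent_at_zero.

Theorem corollary7p3 (R : realType) (L kappa q alpha0 alpha1 : R)
    (phi : R -> R)
    (L_gt0 : 0 < L) (kappa_gt0 : 0 < kappa) (q_ge0 : 0 <= q)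
    (alpha0_gt0 : 0 < alpha0) (alpha01 : alpha0 <= alpha1)
    (alpha1_lt1 : alpha1 < 1)
    (phi_L2 : isL2 L phi)
    (phi_ge0 : {ae lebesgue_measure, forall x, x \in `]0, L[ -> 0 <= phi x})
    (phi_neq0 :
      ~ {ae lebesgue_measure, forall x, x \in `]0, L[ -> phi x = 0}) :
  (forall x, 0 < x < L -> 0 < invA L kappa q phi x) /\
  forall xs : R, 0 < xs < L ->
    (exists T : R, 1 < T /\
      forall t0 : R, T <= t0 ->
        (forall d0 a b : R,
          a \in `[alpha0, alpha1] -> b \in `[alpha0, alpha1] ->
          mild_solution L kappa q phi a t0 xs = d0 ->
          mild_solution L kappa q phi b t0 xs = d0 ->
          a = b) /\
        (forall d0 : R,
          (exists2 a : R, a \in `[alpha0, alpha1] &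
             mild_solution L kappa q phi a t0 xs = d0) ->
          exists! a : R, a \in `[alpha0, alpha1] /\
             mild_solution L kappa q phi a t0 xs = d0)) /\
    (\forall t0 \near +oo, forall a b : R,
       a \in `[alpha0, alpha1] -> b \in `[alpha0, alpha1] -> a < b ->
       mild_solution L kappa q phi b t0 xs <
       mild_solution L kappa q phi a t0 xs).
Proof.
split=> [x xL|xs xsL].
  exact: (invA_gt0 L_gt0 kappa_gt0 q_ge0 phi_L2 phi_ge0 phi_neq0 xL).1.
have [_ W0] := invA_gt0 L_gt0 kappa_gt0 q_ge0 phi_L2 phi_ge0 phi_neq0 xsL.
pose c k := eigencoef L phi k.+1 * eigenfunA L k.+1 xs.
pose lam k := eigenvalueA L kappa q k.+1.
have lp k : 0 < lam k by exact: eigenvalue_gt0.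
have cE k : c k / lam k = eigencoef L phi k.+1 / lam k * eigenfunA L k.+1 xs.
  by rewrite /c mulrAC.
have sc : cvgn (series (fun k => `|c k| / lam k)).
  have [|K cK] := @coef_over_eigenvalue _ _ L_gt0 _ _ phi kappa_gt0 q_ge0 phi_L2
    (fun k => eigenfunA L k.+1 xs) (Num.sqrt (2 / L)).
    by move=> k; exact: eigenfun_le.
  apply: (@cvg_series_inv_sqr _ _ K) => k.
  suff -> : `| `|c k| / lam k| = `|c k / lam k| by rewrite cE; exact: cK.
  by rewrite [LHS]normrM [RHS]normrM normr_id.
have W1 : 0 < limn (series (fun k => c k / lam k)).
  by move: W0; rewrite /sine_sum (funext cE).
have [T T1 dec] := eventually_strictly_decreasing alpha0_gt0 alpha01 alpha1_lt1
  (eigenvalue_unit_gt0 L_gt0 kappa_gt0) (eigenvalue_ge1 L_gt0 kappa_gt0 q_ge0) sc W1.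
have mono t : T <= t -> forall a b, a \in `[alpha0, alpha1] -> b \in `[alpha0, alpha1] ->
    a < b -> mild_solution L kappa q phi b t xs < mild_solution L kappa q phi a t xs.
  move=> Tt a b; rewrite !in_itv/= => /andP[a0 a1] /andP[b0 b1] ab.
  have t1 : 1 <= t by exact: le_trans (ltW T1) Tt.
  rewrite !(mild_solutionE L_gt0 kappa_gt0 q_ge0 phi_L2)//.
  - exact: dec.
  - by rewrite (lt_le_trans alpha0_gt0 a0) (le_lt_trans a1).
  - by rewrite (lt_le_trans alpha0_gt0 b0) (le_lt_trans b1).
have inj t : T <= t -> forall d a b, a \in `[alpha0, alpha1] -> b \in `[alpha0, alpha1] ->
    mild_solution L kappa q phi a t xs = d -> mild_solution L kappa q phi b t xs = d ->
    a = b.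
  move=> Tt d a b aI bI ad bd; case: (ltgtP a b) => // ab.
  - by have := mono t Tt a b aI bI ab; rewrite ad bd ltxx.
  - by have := mono t Tt b a bI aI ab; rewrite ad bd ltxx.
split; last first.
  by exists T; split; [exact: num_real|move=> t /ltW Tt; exact: mono].
exists T; split => // t Tt; split; first exact: inj.
move=> d [a aI ad]; exists a; split => // b [bI bd].
exact: inj Tt d a b aI bI ad bd.
Qed.
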